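(* Let $s\in(0,1)$, let $m\ge0$ be an integer, and set $\sigma:=m+s$ and $C_\sigma:=\big(\sqrt{\pi}\,2^{\sigma-1}\Gamma(\sigma+1/2)\big)^{-1}$. Let $\Omega=(-1,1)$. If $u\in\mathbb{W}^{\sigma}_{+}(\Omega)$, then for all integers $n\ge\sigma>1/2$, $$\hat u_n^{C}=(-1)^{n+[n-s]}C_\sigma\Big\{\int_{-1}^1{}_x^RD_1^{s}u^{(m)}(x)\,{}^{l}G_{n-\sigma}^{(\sigma)}(x)\,\omega_\sigma(x)\,dx+\big\{{}_xI_1^{1-s}u^{(m)}(x)\,{}^{l}G_{n-\sigma}^{(\sigma)}(x)\,\omega_\sigma(x)\big\}\big|_{x=1}\Big\}.$$ Similarly, if $u\in\mathbb{W}^{\sigma}_{-}(\Omega)$, then for all integers $n\ge\sigma>1/2$, $$\hat u_n^{C}=C_\sigma\Big\{\int_{-1}^1{}_{-1}^{\ \ R}D_x^{s}u^{(m)}(x)\,{}^{r}G_{n-\sigma}^{(\sigma)}(x)\,\omega_\sigma(x)\,dx+\big\{{}_{-1}I_x^{1-s}u^{(m)}(x)\,{}^{r}G_{n-\sigma}^{(\sigma)}(x)\,\omega_\sigma(x)\big\}\big|_{x=-1}\Big\}.$$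
   Context: Chebyshev coefficients: $\hat u_n^C=\frac{2}{\pi}\int_{-1}^1 u(x)\frac{T_n(x)}{\sqrt{1-x^2}}\,dx$, with $T_n(x)=\cos(n\arccos x)$. $[\nu]$ is the largest integer $\le\nu$, and $\omega_\lambda(x)=(1-x^2)^{\lambda-1/2}$. Generalised Gegenbauer functions of fractional degree: for real $\lambda>-1/2$, $\nu\ge 0$ and $x\in(-1,1)$, $${}^{r}G_\nu^{(\lambda)}(x)={}_2F_1\big(-\nu,\nu+2\lambda;\lambda+\tfrac12;\tfrac{1-x}{2}\big),\qquad {}^{l}G_\nu^{(\lambda)}(x)=(-1)^{[\nu]}{}_2F_1\big(-\nu,\nu+2\lambda;\lambda+\tfrac12;\tfrac{1+x}{2}\big),$$ where ${}_2F_1(a,b;c;z)=\sum_{j\ge0}\frac{(a)_j(b)_j}{(c)_j}\frac{z^j}{j!}$ and $(a)_0=1$, $(a)_j=a(a+1)\cdots(a+j-1)$. Riemann–Liouville integrals and derivatives for $s\in(0,1)$: ${}_xI_1^{1-s}f(x)=\frac{1}{\Gamma(1-s)}\int_x^1\frac{f(y)}{(y-x)^{s}}dy$, ${}_x^RD_1^sf=-\frac{d}{dx}\{{}_xI_1^{1-s}f\}$, ${}_{-1}I_x^{1-s}f(x)=\frac{1}{\Gamma(1-s)}\int_{-1}^x\frac{f(y)}{(x-y)^{s}}dy$, ${}_{-1}^{\ \ R}D_x^sf=\frac{d}{dx}\{{}_{-1}I_x^{1-s}f\}$. Spaces: $\mathbb{W}^{m+s}_{+}(\Omega)$ (resp.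 $\mathbb{W}^{m+s}_{-}(\Omega)$) is the set of $u\in L^1(\Omega)$ such that $u,u',\dots,u^{(m-1)}$ are absolutely continuous on $[-1,1]$ (no condition if $m=0$) and ${}_xI_1^{1-s}u^{(m)}\in\mathrm{BV}(\Omega)$ (resp. ${}_{-1}I_x^{1-s}u^{(m)}\in\mathrm{BV}(\Omega)$). Conventions: the boundary terms at $x=\pm1$ are one-sided limits from inside $\Omega$. The integrals are Stieltjes integrals: ${}_x^RD_1^su^{(m)}(x)\,dx$ stands for the measure $-d({}_xI_1^{1-s}u^{(m)})$ and ${}_{-1}^{\ \ R}D_x^su^{(m)}(x)\,dx$ for $d({}_{-1}I_x^{1-s}u^{(m)})$ on $(-1,1)$ (ordinary Lebesgue integrals when the fractional integrals are absolutely continuous). *)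

(* Defs.v *)
From HB Require Import structures.
From mathcomp Require Import all_boot all_order all_algebra.
From mathcomp Require Import all_classical all_reals all_analysis.

Set Implicit Arguments.
Unset Strict Implicit.
Unset Printing Implicit Defensive.

Import Order.TTheory GRing.Theory Num.Theory.
Import numFieldNormedType.Exports.

Local Open Scope classical_set_scope.
Local Open Scope ring_scope.

(* Functions on Omega = (-1,1) are total functions
   R -> R of which only the restriction to Omega is ever used. *)

Definition Omega (R : realType) : set R := `]-1, 1[.

Definition Gamma (R : realType) (x : R) : R :=
  \int[lebesgue_measure]_(t in `]0, +oo[) (t `^ (x - 1) * expR (- t)).

Definition pochhammer (R : realType) (a : R) (j : nat) : R :=
  \prod_(i < j) (a + i%:R).

Definition hyp2F1 (R : realType) (a b c z : R) : R :=
  limn (series (fun j : nat =>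
    pochhammer a j * pochhammer b j / pochhammer c j * (z ^+ j / j`!%:R))).

Definition rG (R : realType) (lambda nu x : R) : R :=
  hyp2F1 (- nu) (nu + 2 * lambda) (lambda + 1 / 2) ((1 - x) / 2).

Definition lG (R : realType) (lambda nu x : R) : R :=
  (-1) ^ Num.floor nu *
  hyp2F1 (- nu) (nu + 2 * lambda) (lambda + 1 / 2) ((1 + x) / 2).

Definition omega (R : realType) (lambda x : R) : R :=
  (1 - x ^+ 2) `^ (lambda - 1 / 2).

Definition chebT (R : realType) (n : nat) (x : R) : R := cos (n%:R * acos x).

Definition cheb_coef (R : realType) (u : R -> R) (n : nat) : R :=
  2 / pi * \int[lebesgue_measure]_(x in @Omega R)
             (u x * (chebT n x / Num.sqrt (1 - x ^+ 2))).

(* Riemann-Liouville integrals of order 1 - s on (-1,1).  For integrable f they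
   are finite for almost every x only; elsewhere the value is junk. *)
Definition fracint_right (R : realType) (s : R) (f : R -> R) (x : R) : R :=
  (Gamma (1 - s))^-1 *
  \int[lebesgue_measure]_(y in `]x, 1[) (f y / (y - x) `^ s).

Definition fracint_left (R : realType) (s : R) (f : R -> R) (x : R) : R :=
  (Gamma (1 - s))^-1 *
  \int[lebesgue_measure]_(y in `]-1, x[) (f y / (x - y) `^ s).

Definition abs_continuous (R : realType) (a b : R) (f : R -> R) : Prop :=
  forall eps : R, 0 < eps -> exists2 delta : R, 0 < delta &
    forall (n : nat) (l r : 'I_n -> R),
      (forall i, [/\ a <= l i, l i <= r i & r i <= b]) ->
      trivIset [set: 'I_n] (fun i => `]l i, r i[%classic) ->
      \sum_(i < n) (r i - l i) < delta ->
      \sum_(i < n) `|f (r i) - f (l i)| < eps.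

(* BV(Omega), for functions defined almost everywhere: some representative has
   bounded variation.  The endpoint values of g are immaterial: a function of
   bounded variation on (-1,1) keeps this property for any values at -1, 1. *)
Definition BV_Omega (R : realType) (F : R -> R) : Prop :=
  exists2 g : R -> R, bounded_variation (-1) 1 g &
    {ae lebesgue_measure, forall x, Omega x -> F x = g x}.

(* u, u', ..., u^(m-1) exist on Omega and are (after giving them values at the
   endpoints) absolutely continuous on [-1,1]. *)
Definition AC_derivs (R : realType) (m : nat) (u : R -> R) : Prop :=
  (forall k : nat, (k.+1 < m)%N ->
     forall x, Omega x -> derivable (derive1n k u) x 1) /\
  (forall k : nat, (k < m)%N ->
     exists2 g : R -> R, abs_continuous (-1) 1 g &
       forall x, Omega x -> g x = derive1n k u x).

(* When u^(m-1) is absolutely continuous, derive1n m u is its derivative at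
   almost every point of Omega. *)
Definition W_plus (R : realType) (m : nat) (s : R) (u : R -> R) : Prop :=
  [/\ (@lebesgue_measure R).-integrable (@Omega R) (EFin \o u),
      AC_derivs m u & BV_Omega (fracint_right s (derive1n m u))].

Definition W_minus (R : realType) (m : nat) (s : R) (u : R -> R) : Prop :=
  [/\ (@lebesgue_measure R).-integrable (@Omega R) (EFin \o u),
      AC_derivs m u & BV_Omega (fracint_left s (derive1n m u))].

(* F = P - N almost everywhere on Omega, with P and N nondecreasing and
   right-continuous.  This fixes P - N on Omega, as the right-continuous
   representative of F, and hence the signed measure dF = dP - dN there. *)
Definition is_bv_decomp (R : realType) (F : R -> R)
    (PN : cumulative R R * cumulative R R) : Prop :=
  {ae lebesgue_measure, forall x, Omega x -> F x = PN.1 x - PN.2 x}.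

(* A decomposition as above; it exists when F is in BV(Omega), and otherwise
   the value (id, id) is junk. *)
Definition bv_decomp (R : realType) (F : R -> R) :
    cumulative R R * cumulative R R :=
  match pselect (exists PN, is_bv_decomp F PN) with
  | left e => projT1 (cid e)
  | right _ => (idfun : cumulative R R, idfun : cumulative R R)
  end.

Definition rc_repr (R : realType) (F : R -> R) (x : R) : R :=
  (bv_decomp F).1 x - (bv_decomp F).2 x.

(* \int_(-1)^1 h dF over the open interval: no mass is counted at -1, 1. *)
Definition stieltjes (R : realType) (F h : R -> R) : R :=
  \int[lebesgue_stieltjes_measure (bv_decomp F).1]_(x in @Omega R) h x -
  \int[lebesgue_stieltjes_measure (bv_decomp F).2]_(x in @Omega R) h x.

(* \int_(-1)^1 (D^s f)(x) h(x) dx, where (D^s f) dx is the measure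
   - d(I^(1-s) f) for the right-sided derivative and d(I^(1-s) f) for the
   left-sided one. *)
Definition int_RLderiv_right (R : realType) (s : R) (f h : R -> R) : R :=
  - stieltjes (fracint_right s f) h.

Definition int_RLderiv_left (R : realType) (s : R) (f h : R -> R) : R :=
  stieltjes (fracint_left s f) h.

Definition Csigma (R : realType) (sigma : R) : R :=
  (Num.sqrt pi * 2 `^ (sigma - 1) * Gamma (sigma + 1 / 2))^-1.

(* Main.v *)
Require Import Defs.
From HB Require Import structures.
From mathcomp Require Import all_boot all_order all_algebra.
From mathcomp Require Import all_classical all_reals all_analysis.
From mathcomp Require Import measurable_realfun ring lra.

Set Implicit Arguments.
Unset Strict Implicit.
Unset Printing Implicit Defensive.

Import Order.TTheory GRing.Theory Num.Theory.
Import numFieldNormedType.Exports.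

Local Open Scope classical_set_scope.
Local Open Scope ring_scope.

(** Write $K_a(x,y)=(x-y)_+^{a-1}/\Gamma(a)$ ([rlker]) and let $w_n$ be the
    Chebyshev polynomial times its weight ([chebw]), so that $\hat u_n^C$ is
    $2/\pi$ times the integral of $u\,w_n$.  The proof is a duality: $u$ is a
    potential of order $\sigma$ of a measure, and the potential operator is moved
    onto $w_n$ by Fubini's theorem.

    The left-sided case.  Let $f=u^{(m)}$ and $F={}_{-1}I_x^{1-s}f$, that is
    $F(x)=\int K_{1-s}(x,y)f(y)\,dy$ ([fracint_leftE]).  Since $F$ has bounded
    variation ([bv_decompP]), it is almost everywhere $A+dF((-1,x))$, with $A$ its
    limit at $-1$ ([ae_Stieltjes_potential_left]).  As $K_1(x,y)$ is the indicator of $y<x$, this says that the potential of order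
    $1-s$ of $f\,dy$ is the potential of order 1 of $\nu=A\delta_{-1}+dF$.  The
    kernels form a semigroup, $K_a*K_b=K_{a+b}$ ([integral_rlker_rlker], which is
    Euler's Beta integral); applying the order $s$ to both sides, the primitives
    of $f$ and of the potential of order $s$ of $\nu$ agree, and so $f$ is that
    potential almost everywhere ([Abel_inversion]).  Integrating $m$ times, $u$ is
    the potential of order $\sigma$ of $\nu$ plus a polynomial of degree less than
    $m$ ([iterated_primitive_potential]).  The polynomial is orthogonal to $T_n$
    ([moment_chebw]) because $n>m$, and Fubini's theorem gives
    $\int u\,w_n=\int h\,d\nu$ with $h(y)=\int K_\sigma(x,y)w_n(x)\,dx$
    ([fracheb], [integral_chebw_potential]).  The bound that justifies Fubini is
    where $\sigma>1/2$ is needed ([integral_rlker_chebw0]).  The mass of $\nu$ at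
    $-1$ produces the boundary term.

    It remains to identify $h$.  Expanding $w_n$ at $x=1$ in the kernels
    $K_{j+1/2}(1,x)$ ([chebw_series]) and integrating termwise gives a
    hypergeometric series for $h$ ([frachebE]), which Euler's transformation
    turns into ${}^rG_{n-\sigma}^{(\sigma)}\omega_\sigma$ up to the factor
    $2/\pi$ and $C_\sigma$ ([fracheb_rG]).  The expansion rests on that of
    $\cos(2nt)/\cos t$ in powers of $\sin^2t$ ([hyp2F1_cos]), a consequence of
    uniqueness for the harmonic oscillator, and Euler's transformation
    ([hyp2F1_Euler]) on the uniqueness of the regular solution of Gauss's
    equation ([Gauss_ODE_unique]).  The boundary value $h(-1)$ is a limit by Abel's theorem,
    the coefficients having eventually a constant sign ([cvg_fracheb_N1]).

    The right-sided case is the left-sided one for $u(-x)$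
    ([iterated_primitive_oppr], [integral_chebw_right]).

    Two facts of real analysis are proved on the way.  An absolutely continuous
    function is the primitive of its derivative ([abs_continuous_primitive]): its
    total variation is absolutely continuous, hence the corresponding Stieltjes
    measure is dominated by the Lebesgue measure, and the density given by the
    Radon-Nikodym theorem is the derivative by Lebesgue's differentiation
    theorem.  And since $u^{(m)}$ is only known to agree almost everywhere with a
    measurable function, integrals are compared without measurability
    ([ae_eq_Rintegral_any]). *)

(** * Lebesgue integrals under translations, reflections and dilations *)

Section LebesgueAffine.
Context {R : realType}.
Local Notation mu := (@lebesgue_measure R).
Local Open Scope ereal_scope.

Let translate (c : R) : R -> measurableTypeR R := fun x => (x + c)%R.
Let dilate (c : R) : R -> measurableTypeR R := fun x => (c * x)%R.

Let measurable_translate c : measurable_fun [set: R] (translate c).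
Proof. exact: measurable_realfun.measurable_funD. Qed.

Let measurable_dilate c : measurable_fun [set: R] (dilate c).
Proof. exact: measurable_realfun.measurable_funM. Qed.

Lemma ge0_integral_translate (f : R -> \bar R) (c : R) :
  measurable_fun [set: R] f -> (forall x, 0 <= f x) ->
  \int[mu]_x f (x + c)%R = \int[mu]_x f x.
Proof.
move=> mf f0; have mt := measurable_translate c.
transitivity (\int[pushforward mu (translate c)]_x f x).
  by rewrite ge0_integral_pushforward//= preimage_setT.
apply: eq_measure_integral => A mA _.
apply/esym/lebesgue_measure_unique => // _ [[a b]] _ <-.
rewrite [RHS](_ : _ = mu `](a - c)%R, (b - c)%R]); last first.
  congr (mu _); apply/seteqP; split=> x /=;
  by rewrite /translate !in_itv/= ltrBlDr lerBrDr.
rewrite !lebesgue_measure_itv/= !lte_fin ltrD2r; case: ifP => // _.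
by congr (_%:E); lra.
Qed.

Lemma ge0_integral_oppr (f : R -> \bar R) :
  measurable_fun [set: R] f -> (forall x, 0 <= f x) ->
  \int[mu]_x f (- x)%R = \int[mu]_x f x.
Proof.
move=> mf f0.
transitivity (\int[pushforward mu (-%R : _ -> measurableTypeR R)]_x f x).
  by rewrite ge0_integral_pushforward//= preimage_setT.
apply: eq_measure_integral => A mA _; exact: lebesgue_measureN.
Qed.

Lemma ge0_integral_dilate (f : R -> \bar R) (c : R) : (0 < c)%R ->
  measurable_fun [set: R] f -> (forall x, 0 <= f x) ->
  \int[mu]_x f x = c%:E * \int[mu]_x f (c * x)%R.
Proof.
move=> c0 mf f0; have mt := measurable_dilate c.
set nu := mscale (NngNum (ltW c0)) mu.
transitivity (\int[pushforward nu (dilate c)]_x f x).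
  apply: eq_measure_integral => A mA _.
  apply/lebesgue_measure_unique => // _ [[a b]] _ <-.
  rewrite [RHS](_ : _ = c%:E * mu `](a / c)%R, (b / c)%R]); last first.
    congr (_ * mu _); apply/seteqP; split=> x /=;
    by rewrite /dilate !in_itv/= ltr_pdivrMr// ler_pdivlMr// mulrC.
  rewrite !lebesgue_measure_itv/= !lte_fin ltr_pM2r ?invr_gt0//.
  case: ifP => _; last by rewrite mule0.
  by rewrite -!EFinB -EFinM; congr (_%:E); field; rewrite gt_eqF.
rewrite ge0_integral_pushforward//= preimage_setT ge0_integral_mscale//=.
exact: measurableT_comp.
Qed.

End LebesgueAffine.

(** * Fundamental theorem of calculus on an open interval *)

Section OpenFTC.
Context {R : realType}.
Local Notation mu := (@lebesgue_measure R).

Lemma is_derive_continuous (f : R -> R) (x df : R) :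
  is_derive x 1 f df -> {for x, continuous f}.
Proof. by move=> [dx _]; exact/differentiable_continuous/derivable1_diffP. Qed.

Lemma ge0_open_FTC (f F : R -> R) (a b A B : R) : a < b ->
  (forall x, a < x < b -> 0 <= f x) ->
  (forall x, a < x < b -> {for x, continuous f}) ->
  (forall x, a < x < b -> is_derive x 1 F (f x)) ->
  F x @[x --> a^'+] --> A -> F x @[x --> b^'-] --> B ->
  (\int[mu]_(x in `]a, b[) (f x)%:E = (B - A)%:E)%E.
Proof.
move=> ab f0 cf dF FA FB.
pose d n : R := (b - a) / n.+3%:R.
have d0 n : 0 < d n by rewrite divr_gt0 ?subr_gt0.
have d2 n : d n *+ 2 < b - a.
  rewrite /d -mulrnAl ltr_pdivrMr// -mulr_natr ltr_pM2l ?subr_gt0//.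
  by rewrite ltr_nat.
have dle m n : (m <= n)%N -> d n <= d m.
  move=> mn; rewrite /d ler_pM2l ?subr_gt0// lef_pV2 ?posrE ?ltr0n//.
  by rewrite ler_nat.
have dcvg : d @ \oo --> 0.
  rewrite -[X in _ --> X](mulr0 (b - a)); apply: cvgMr.
  have := @cvg_harmonic R; rewrite -(cvg_shiftn 2) /harmonic/=.
  by under eq_fun do rewrite addn2.
pose I n := `[a + d n, b - d n]%classic.
have Iab n x : x \in `[a + d n, b - d n] -> a < x < b.
  rewrite in_itv/= => /andP[h1 h2]; apply/andP; split.
    by rewrite (lt_le_trans _ h1)// ltrDl.
  by rewrite (le_lt_trans h2)// ltrBlDr ltrDl.
have UI : \bigcup_n I n = `]a, b[%classic.
  apply/seteqP; split=> x.
    by move=> [n _]/= /Iab; rewrite in_itv.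
  rewrite /= in_itv/= => /andP[ax xb].
  have : \forall n \near \oo, d n < Num.min (x - a) (b - x).
    by apply: (cvgr_lt 0) => //; rewrite lt_min !subr_gt0 ax.
  case=> N _ /(_ N (leqnn N)); rewrite lt_min => /andP[h1 h2].
  exists N => //; rewrite /I/= in_itv/=; apply/andP; split; lra.
have cfI n : {within I n, continuous f}.
  apply: continuous_in_subspaceT => x; rewrite inE => /Iab; exact: cf.
have mf : measurable_fun `]a, b[ f.
  apply: open_continuous_measurable_fun => // x; rewrite inE/= in_itv/=; exact: cf.
have cI : (\int[mu]_(x in I n) (f x)%:E)%E @[n --> \oo] -->
    (\int[mu]_(x in `]a, b[) (f x)%:E)%E.
  rewrite -UI; apply: ge0_nondecreasing_set_cvg_integral.
  - move=> m n mn; apply/subsetPset => x; rewrite /I/= !in_itv/=.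
    by have := dle _ _ mn => ? /andP[? ?]; apply/andP; split; lra.
  - by move=> n; exact: measurable_itv.
  - move=> n; apply/measurable_EFinP/measurable_funS; last exact: mf.
      exact: measurable_itv.
    by move=> x /Iab; rewrite /= in_itv.
  - by move=> n x /Iab/f0; rewrite lee_fin.
have EI n : (\int[mu]_(x in I n) (f x)%:E)%E = (F (b - d n) - F (a + d n))%:E.
  have lt : a + d n < b - d n by have := d2 n; rewrite mulr2n; lra.
  have cF x : x \in `[a + d n, b - d n] -> {for x, continuous F}.
    by move=> /Iab /dF; exact: is_derive_continuous.
  rewrite EFinB; apply: (@continuous_FTC2 R f F _ _ lt (cfI n)).
  - split.
    + by move=> x /subset_itv_oo_cc/Iab xab; have [] := dF _ xab.
    + by apply/cvg_at_right_filter/cF; rewrite in_itv/= lexx ltW.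
    + by apply/cvg_at_left_filter/cF; rewrite in_itv/= lexx ltW.
  - move=> x /subset_itv_oo_cc/Iab xab.
    by rewrite derive1E; have [_ ->] := dF _ xab.
have cvB : F (b - d n) @[n --> \oo] --> B.
  move/cvg_at_leftP : FB => /(_ (fun n => b - d n)); apply; split.
    by move=> n; rewrite ltrBlDr ltrDl.
  by rewrite -[X in _ --> X]subr0; apply: cvgB => //; exact: cvg_cst.
have cvA : F (a + d n) @[n --> \oo] --> A.
  move/cvg_at_rightP : FA => /(_ (fun n => a + d n)); apply; split.
    by move=> n; rewrite ltrDl.
  by rewrite -[X in _ --> X]addr0; apply: cvgD => //; exact: cvg_cst.
have cE : (F (b - d n) - F (a + d n))%:E @[n --> \oo] --> (B - A)%:E.
  by apply: cvg_EFin; [exact: nearW|exact: cvgB].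
move: cI; under eq_fun do rewrite EI; move=> cI.
exact: (cvg_unique _ cI cE).
Qed.

End OpenFTC.

(** * The Gamma function and convolutions of truncated powers *)

(** The truncated power $x_+^{a-1}$: divided by $\Gamma(a)$ it is the kernel of
    the Riemann-Liouville integral of order a. *)
Definition tpow {R : realType} (a x : R) : R := if 0 < x then x `^ (a - 1) else 0.

(** Locked, so that unification does not unfold the integral. *)
HB.lock Definition EulerGamma {R : realType} (x : R) : R := Gamma x.

Section GammaBeta.
Context {R : realType}.
Local Notation mu := (@lebesgue_measure R).
Implicit Types a b x y t : R.

Lemma tpow_ge0 a x : 0 <= tpow a x.
Proof. by rewrite /tpow; case: ifP => // _; exact: powR_ge0. Qed.

Lemma tpow_gt0 a x : 0 < x -> tpow a x = x `^ (a - 1).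
Proof. by rewrite /tpow => ->. Qed.

Lemma tpow_le0 a x : x <= 0 -> tpow a x = 0.
Proof. by rewrite /tpow ltNge => ->. Qed.

Lemma tpow1 x : tpow 1 x = (0 < x)%R%:R.
Proof. by rewrite /tpow subrr powRr0; case: ifP. Qed.

Lemma measurable_tpow a : measurable_fun [set: R] (tpow a).
Proof.
apply: measurable_fun_if => //=.
- exact: measurable_fun_ltr.
- by apply: measurable_funTS; exact: measurable_powR.
Qed.

Lemma measurable_tpow_sub a d (T : measurableType d) (f g : T -> R) :
  measurable_fun [set: T] f -> measurable_fun [set: T] g ->
  measurable_fun [set: T] (fun p => tpow a (f p - g p)).
Proof.
move=> mf mg; apply: measurableT_comp; first exact: measurable_tpow.
exact: measurable_realfun.measurable_funB.
Qed.

Lemma integral_tpow01 a : 0 < a ->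
  (\int[mu]_(x in `]0%R, 1%R[) (tpow a x)%:E = (a^-1)%:E)%E.
Proof.
move=> a0; rewrite -[X in _ = X%:E](subr0 a^-1).
rewrite [LHS](_ : _ = \int[mu]_(x in `]0%R, 1%R[) (x `^ (a - 1))%:E)%E; last first.
  by apply: eq_integral => x; rewrite inE/= in_itv/= => /andP[x0 _]; rewrite tpow_gt0.
apply: (@ge0_open_FTC R _ (fun x => a^-1 * x `^ a)).
- by [].
- by move=> x _; exact: powR_ge0.
- move=> x /andP[x0 _].
  exact: (is_derive_continuous (is_derive1_powR (a - 1) x0)).
- move=> x /andP[x0 _]; have dx := is_derive1_powR a x0.
  have := is_deriveZ a^-1 dx.
  by rewrite /GRing.scale/= mulrA mulVf ?gt_eqF// mul1r.
- rewrite -[X in _ --> X](mulr0 a^-1); apply: cvgMr; exact: powR_cvg0.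
- rewrite -[X in _ --> X](mulr1 a^-1); apply: cvgMr.
  suff : x `^ a @[x --> 1^'-] --> 1 `^ a by rewrite powR1.
  apply: cvg_at_left_filter.
  exact: (is_derive_continuous (is_derive1_powR a ltr01)).
Qed.

Local Open Scope ereal_scope.

(** Extended-valued, so that Tonelli's theorem applies to it before it is known
    to be finite. *)
Definition eGamma a : \bar R := \int[mu]_x (tpow a x * expR (- x))%:E.

Lemma measurable_Gamma_integrand a :
  measurable_fun [set: R] (fun x => tpow a x * expR (- x))%R.
Proof.
apply: measurable_realfun.measurable_funM; first exact: measurable_tpow.
by apply: measurableT_comp => //; exact: measurable_expR.
Qed.

Lemma eGamma_lty a : (0 < a)%R -> eGamma a < +oo.
Proof.
move=> a0; pose N := Num.bound a.
pose C : R := (2 * 2 ^+ N.+1 * N.+1`!%:R)%R.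
have C0 : (0 <= C)%R by apply: mulr_ge0 => //; apply: mulr_ge0 => //; exact: exprn_ge0.
pose g1 := (fun x => (tpow a x)%:E) \_ `]0%R, 1%R[.
pose g2 x := C%:E * (exponential_pdf 2^-1 x)%:E.
have mg1 : measurable_fun [set: R] g1.
  apply/(measurable_restrictT _ _).1 => //.
  apply: measurable_funTS; apply/measurable_EFinP. exact: measurable_tpow.
have mp : measurable_fun [set: R] (fun x => (exponential_pdf 2^-1 x)%:E).
  apply/measurable_EFinP; apply: measurable_exponential_pdf.
have mg2 : measurable_fun [set: R] g2 by exact: measurable_funeM.
have p0 x : 0 <= (exponential_pdf 2^-1 x : R)%:E.
  by rewrite lee_fin exponential_pdf_ge0// invr_ge0.
have g10 x : 0 <= g1 x.
  by rewrite /g1; apply: erestrict_ge0 => y _; rewrite lee_fin tpow_ge0.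
have g20 x : 0 <= g2 x by rewrite /g2 mule_ge0.
apply: (@le_lt_trans _ _ (\int[mu]_x (g1 x + g2 x))).
  apply: ge0_le_integral => //=.
  - by move=> x _; rewrite lee_fin mulr_ge0 ?tpow_ge0 ?expR_ge0.
  - by apply/measurable_EFinP; exact: measurable_Gamma_integrand.
  - exact: emeasurable_funD.
  move=> x _; have [x0|x0] := leP x 0%R.
    by rewrite tpow_le0// mul0r adde_ge0.
  have [x1|x1] := ltP x 1%R.
    rewrite -[X in X <= _]adde0; apply: leeD => //.
    rewrite /g1 patchE mem_set/=; last by rewrite in_itv/= x0.
    rewrite lee_fin ler_piMr ?tpow_ge0// -expR0 ler_expR; lra.
  rewrite -[X in X <= _]add0e; apply: leeD => //.
  rewrite /g2 exponential_pdfE; last exact: ltW.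
  rewrite -EFinM lee_fin tpow_gt0//.
  have h1 : (x `^ (a - 1) <= x ^+ N.+1)%R.
    rewrite -powR_mulrn; last exact: ltW.
    apply: ler_powR => //; rewrite -natr1.
    by have := archi_boundP (ltW a0); lra.
  have h2 : (x ^+ N.+1 <= 2 ^+ N.+1 * N.+1`!%:R * expR (x / 2))%R.
    have := @expR_ge1Dxn R (x / 2) N; rewrite divr_ge0 ?(ltW x0)// => /(_ isT) h.
    have {h} : ((x / 2) ^+ N.+1 / N.+1`!%:R <= expR (x / 2))%R by lra.
    rewrite ler_pdivrMr ?ltr0n ?fact_gt0// expr_div_n ler_pdivrMr ?exprn_gt0//.
    by move=> h; rewrite (_ : (_ * _ * _ = expR (x / 2) * N.+1`!%:R * 2 ^+ N.+1)%R)//; ring.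
  have -> : (C * (2^-1 * expR (- 2^-1 * x)) = 2 ^+ N.+1 * N.+1`!%:R * expR (x / 2) * expR (- x))%R.
    rewrite -mulrA -expRD /C; have -> : (x / 2 + - x = - 2^-1 * x)%R by lra.
    by field.
  by rewrite ler_pM2r ?expR_gt0// (le_trans h1).
rewrite ge0_integralD//; apply: lte_add_pinfty.
  by rewrite /g1 -integral_mkcond integral_tpow01// ltry.
rewrite /g2 ge0_integralZl//.
by rewrite integral_exponential_pdf ?invr_gt0// mule1 ltry.
Qed.

Lemma eGamma_gt0 a : 0 < eGamma a.
Proof.
pose c : R := (Num.min 1 (2 `^ (a - 1)) * expR (- 2))%R.
have c0 : (0 < c)%R by rewrite mulr_gt0 ?expR_gt0// lt_min ltr01 powR_gt0.
have mG := measurable_Gamma_integrand a.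
apply: (@lt_le_trans _ _ (\int[mu]_(x in `]1%R, 2%R[) c%:E)).
  rewrite integral_cst//= lebesgue_measure_itv/= lte_fin ltr1n/=.
  by rewrite -EFinB -EFinM lte_fin mulr_gt0//; lra.
apply: (@le_trans _ _ (\int[mu]_(x in `]1%R, 2%R[) (tpow a x * expR (- x))%:E)).
  apply: ge0_le_integral => //=.
  - by move=> x _; rewrite lee_fin ltW.
  - by apply/measurable_EFinP; exact: measurable_funTS.
  move=> x; rewrite in_itv/= => /andP[x1 x2]; have x0 : (0 < x)%R by lra.
  rewrite lee_fin tpow_gt0//; apply: ler_pM.
  - by rewrite le_min ler01 powR_ge0.
  - exact: expR_ge0.
  - rewrite ge_min; have [a1|a1] := leP 1%R a.
      apply/orP; left; rewrite -[X in (X <= _)%R](powRr0 x); apply: ler_powR; lra.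
    apply/orP; right; have -> : (a - 1 = - (1 - a))%R by ring.
    rewrite !powRN lef_pV2 ?posrE ?powR_gt0//.
    by apply: ge0_ler_powR; rewrite ?nnegrE; lra.
  - by rewrite ler_expR; lra.
apply: ge0_subset_integral => //=.
- by apply/measurable_EFinP.
- by move=> x _; rewrite lee_fin mulr_ge0 ?tpow_ge0 ?expR_ge0.
Qed.

Lemma eGammaE a : (0 < a)%R -> eGamma a = (EulerGamma a)%:E.
Proof.
move=> a0; rewrite EulerGamma.unlock /Gamma /Rintegral.
have -> : \int[mu]_(t in `]0%R, +oo[) (t `^ (a - 1) * expR (- t))%:E = eGamma a.
  rewrite integral_mkcond; apply: eq_integral => x _.
  rewrite patchE; case: ifPn; rewrite ?inE ?notin_setE/= in_itv/= andbT.
    by move=> x0; rewrite tpow_gt0.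
  by move/negP; rewrite -leNgt => x0; rewrite tpow_le0 ?mul0r.
by rewrite fineK// ge0_fin_numE ?eGamma_lty// ltW// eGamma_gt0.
Qed.

Lemma Gamma_gt0 a : (0 < a)%R -> (0 < EulerGamma a)%R.
Proof. by move=> a0; rewrite -lte_fin -eGammaE// eGamma_gt0. Qed.

Let conv a b t := \int[mu]_x (tpow a x * tpow b (t - x))%:E.

Let measurable_conv_integrand a b t :
  measurable_fun [set: R] (fun x => (tpow a x * tpow b (t - x))%:E).
Proof.
apply/measurable_EFinP; apply: measurable_realfun.measurable_funM.
  exact: measurable_tpow.
exact: measurable_tpow_sub.
Qed.

Let conv_integrand_ge0 a b t x : 0 <= (tpow a x * tpow b (t - x))%:E.
Proof. by rewrite lee_fin mulr_ge0 ?tpow_ge0. Qed.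

(** The substitution x = ty: only the value of the convolution at 1, the Beta
    integral, remains to be found. *)
Let conv_homogeneous a b t : conv a b t = (tpow (a + b) t)%:E * conv a b 1.
Proof.
have [t0|t0] := leP t 0%R.
  rewrite (tpow_le0 _ t0) mul0e /conv integral0_eq// => x _.
  have [x0|x0] := leP x 0%R; first by rewrite tpow_le0// mul0r.
  by rewrite [tpow b _]tpow_le0 ?mulr0//; lra.
have -> : conv a b t = t%:E * \int[mu]_x (tpow a (t * x) * tpow b (t - t * x))%:E.
  exact: (ge0_integral_dilate t0 (measurable_conv_integrand a b t)).
under eq_integral => x _.
  have -> : (tpow a (t * x) * tpow b (t - t * x) =
      t `^ (a - 1) * t `^ (b - 1) * (tpow a x * tpow b (1 - x)))%R.
    have [x0|x0] := leP x 0%R.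
      by rewrite !(@tpow_le0 a) ?mul0r ?mulr0//; nra.
    have [x1|x1] := leP 1%R x.
      by rewrite !(@tpow_le0 b) ?mulr0//; nra.
    have -> : (t - t * x = t * (1 - x))%R by ring.
    rewrite !tpow_gt0 ?mulr_gt0 ?subr_gt0//.
    rewrite !powRM ?subr_ge0 ?(ltW t0) ?(ltW x0) ?(ltW x1)//; ring.
  rewrite EFinM; over.
rewrite ge0_integralZl//; [|exact: measurable_conv_integrand|by rewrite lee_fin mulr_ge0 ?powR_ge0].
rewrite muleA -EFinM; congr (_%:E * _).
rewrite tpow_gt0//; have -> : (a + b - 1 = 1 + ((a - 1) + (b - 1)))%R by ring.
by rewrite !powRD ?(gt_eqF t0) ?implybT// powRr1// ltW.
Qed.

(** Tonelli's theorem for the product of two Gamma integrals, sliced along the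
    lines where the sum of the variables is constant. *)
Let Gamma_mul a b : (0 < a)%R -> (0 < b)%R ->
  conv a b 1 * eGamma (a + b) = eGamma a * eGamma b.
Proof.
move=> a0 b0.
pose f (p : R * R) := (tpow a p.1 * tpow b (p.2 - p.1) * expR (- p.2))%:E.
have mf : measurable_fun [set: R * R] f.
  apply/measurable_EFinP; apply: measurable_realfun.measurable_funM.
    apply: measurable_realfun.measurable_funM.
      by apply: measurableT_comp => //; exact: measurable_tpow.
    exact: measurable_tpow_sub.
  apply: measurableT_comp; first exact: measurable_expR.
  exact: measurableT_comp.
have f0 p : 0 <= f p by rewrite lee_fin !mulr_ge0 ?tpow_ge0 ?expR_ge0.
have := @fubini_tonelli _ _ _ _ _ mu mu f mf f0.
pose g c x := (tpow c x * expR (- x))%:E.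
have mg c : measurable_fun [set: R] (g c).
  by apply/measurable_EFinP; exact: measurable_Gamma_integrand.
have g0 c x : 0 <= g c x by rewrite lee_fin mulr_ge0 ?tpow_ge0 ?expR_ge0.
have mgx x : measurable_fun [set: R] (fun y => g b (y - x)%R).
  by apply: measurableT_comp; [exact: mg|exact: measurable_realfun.measurable_funB].
have -> : \int[mu]_x \int[mu]_y f (x, y) = eGamma a * eGamma b.
  transitivity (\int[mu]_x (g a x * eGamma b)).
    apply: eq_integral => x _.
    transitivity (\int[mu]_y (g a x * g b (y - x)%R)).
      apply: eq_integral => y _; rewrite /g -EFinM /f/=; congr (_%:E).
      have -> : (expR (- y) = expR (- x) * expR (- (y - x)))%R.
        by rewrite -expRD; congr expR; ring.
      ring.
    rewrite (ge0_integralZl mu measurableT (mgx x) (fun y _ => g0 b (y - x)%R) (g0 a x)).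
    by congr (_ * _); exact: (ge0_integral_translate (- x) (mg b) (g0 b)).
  exact: (ge0_integralZr mu measurableT (mg a) (fun x _ => g0 a x) (ltW (eGamma_gt0 b))).
move=> ->; rewrite muleC.
have c0 : 0 <= conv a b 1 by apply: integral_ge0 => x _; exact: conv_integrand_ge0.
transitivity (\int[mu]_t (g (a + b)%R t * conv a b 1)).
  exact/esym/(ge0_integralZr mu measurableT (mg _) (fun x _ => g0 _ x) c0).
apply: eq_integral => t _; rewrite /g EFinM muleAC -conv_homogeneous.
have e0 : 0 <= (expR (- t))%:E by rewrite lee_fin expR_ge0.
rewrite -(ge0_integralZr mu measurableT (measurable_conv_integrand a b t)
  (fun x _ => conv_integrand_ge0 a b t x) e0).
by apply: eq_integral => x _; rewrite -EFinM.
Qed.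

(** Truncated powers, normalised by the Gamma function, form a convolution
    semigroup: this is Euler's formula for the Beta integral. Everything said
    below about Riemann-Liouville integrals rests on this identity. *)
Lemma tpow_convolution a b x y : (0 < a)%R -> (0 < b)%R ->
  \int[mu]_t (tpow a (x - t) / EulerGamma a * (tpow b (t - y) / EulerGamma b))%:E =
  (tpow (a + b) (x - y) / EulerGamma (a + b))%:E.
Proof.
move=> a0 b0; have ab0 : (0 < b + a)%R by exact: addr_gt0.
have := Gamma_mul b0 a0; rewrite (eGammaE a0) (eGammaE b0) (eGammaE ab0).
have := Gamma_gt0 ab0; have := Gamma_gt0 b0; have := Gamma_gt0 a0.
rewrite (addrC b).
move: (EulerGamma a) (EulerGamma b) (EulerGamma (a + b)) => ga gb gab ga0 gb0 gab0 H.
have {}H : conv b a 1 = (ga * gb / gab)%:E.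
  have : conv b a 1 * gab%:E * (gab^-1)%:E = gb%:E * ga%:E * (gab^-1)%:E by rewrite H.
  by rewrite -muleA -!EFinM mulfV ?gt_eqF// mule1 (mulrC gb).
transitivity (((ga * gb)^-1)%:E * conv b a (x - y)).
  have mc : measurable_fun [set: R] (fun t => (tpow b (t - y) * tpow a (x - y - (t - y)))%:E).
    apply: (measurableT_comp (measurable_conv_integrand b a (x - y))).
    exact: measurable_realfun.measurable_funB.
  rewrite -[conv b a _](ge0_integral_translate (- y) (measurable_conv_integrand b a (x - y)))//.
  have G0 : 0 <= ((ga * gb)^-1)%:E by rewrite lee_fin invr_ge0 mulr_ge0// ltW.
  rewrite -(ge0_integralZl mu measurableT mc (fun t _ => conv_integrand_ge0 _ _ _ _) G0).
  apply: eq_integral => t _; rewrite -EFinM; congr (_%:E).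
  have -> : (x - y - (t - y) = x - t)%R by ring.
  by field; rewrite !gt_eqF.
rewrite conv_homogeneous H -!EFinM (addrC b); congr (_%:E).
by field; rewrite !gt_eqF.
Qed.

End GammaBeta.

(** * Chebyshev polynomials and the arcsine weight *)

Section ChebyshevWeight.
Context {R : realType}.
Local Notation mu := (@lebesgue_measure R).
Implicit Types x : R.

Lemma OmegaE x : Omega x <-> -1 < x < 1.
Proof. by rewrite /Omega/= in_itv. Qed.

Lemma measurable_Omega : measurable (@Omega R : set (measurableTypeR R)).
Proof. exact: measurable_itv. Qed.

Lemma cvg_acos1 : acos x @[x --> (1 : R)^'-] --> (0 : R).
Proof.
apply/cvgrPdist_lt => e e0; pose d : R := Num.min e (pi / 2).
have pi0 := pi_gt0 R.
have d0 : 0 < d by rewrite lt_min e0/= divr_gt0.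
have dpi : d <= pi by rewrite ge_min; apply/orP; right; lra.
have cd : Num.max (-1) (cos d) < 1.
  rewrite gt_max; apply/andP; split; first lra.
  by rewrite -(cos0 R) ltr_cos ?in_itv/= ?lexx ?d0 ?dpi ?(ltW d0) ?(ltW pi0). 
near=> x; rewrite sub0r normrN.
have x1 : x < 1 by near: x; exact: nbhs_left_lt.
have : Num.max (-1) (cos d) < x by near: x; exact: nbhs_left_gt.
rewrite gt_max => /andP[xm1 xd].
have xI : -1 <= x <= 1 by rewrite !ltW.
rewrite ger0_norm ?acos_ge0//; apply: (@lt_le_trans _ _ d); last by rewrite ge_min lexx.
rewrite -ltr_cos ?in_itv/= ?(ltW d0)// ?acos_ge0 ?acos_lepi//.
by rewrite acosK ?in_itv.
Unshelve. all: by end_near. Qed.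

Lemma cvg_acosN1 : acos x @[x --> (-1 : R)^'+] --> (pi : R).
Proof.
apply/cvg_at_rightNP => /=; rewrite opprK.
rewrite -[X in _ --> X]subr0.
have h : (pi - acos x) @[x --> (1 : R)^'-] --> (pi - 0 : R).
  by apply: cvgB; [exact: cvg_cst|exact: cvg_acos1].
apply: cvg_trans h; apply: near_eq_cvg; near=> x => /=.
rewrite acosN//; apply/andP; split.
  by near: x; apply: nbhs_left_ge; lra.
by apply/ltW; near: x; exact: nbhs_left_lt.
Unshelve. all: by end_near. Qed.

(** The weight is included so that $\hat u_n^C$ is $2/\pi$ times the Lebesgue
    integral of $u$ against this function. *)
Definition chebw (n : nat) x := chebT n x / Num.sqrt (1 - x ^+ 2).

Lemma sqrt_gt0_Omega x : Omega x -> 0 < Num.sqrt (1 - x ^+ 2).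
Proof. by move=> /OmegaE/andP[? ?]; rewrite sqrtr_gt0; nra. Qed.

Lemma chebT0 x : chebT 0 x = 1. Proof. by rewrite /chebT mul0r cos0. Qed.

Lemma normr_chebw n x : Omega x -> `|chebw n x| <= chebw 0 x.
Proof.
move=> xO; have s0 := sqrt_gt0_Omega xO.
rewrite /chebw chebT0 normrM normfV (gtr0_norm s0) ler_pM2r ?invr_gt0//.
exact: cos_max.
Qed.

Lemma is_derive_acos_Omega x : Omega x ->
  is_derive x 1 (@acos R) (- (Num.sqrt (1 - x ^+ 2))^-1).
Proof. by move=> /OmegaE xO; exact: is_derive1_acos. Qed.

Lemma continuous_chebw n x : Omega x -> {for x, continuous (chebw n)}.
Proof.
move=> xO; have s0 := sqrt_gt0_Omega xO.
apply: cvgM.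
  apply: (@continuous_comp _ _ _ (fun x => n%:R * acos x) (@cos R)); last exact: continuous_cos.
  apply: cvgMr; exact: (is_derive_continuous (is_derive_acos_Omega xO)).
apply: cvgV; first by rewrite gt_eqF.
apply: (@continuous_comp _ _ _ (fun x : R => 1 - x ^+ 2) Num.sqrt); last exact: sqrt_continuous.
by apply: cvgB; [exact: cvg_cst|exact: exprn_continuous].
Qed.

Lemma measurable_chebw n : measurable_fun (@Omega R) (chebw n).
Proof.
apply: open_continuous_measurable_fun; first exact: interval_open.
by move=> x; rewrite inE => xO; exact: continuous_chebw.
Qed.

Lemma integral_arcsine : (\int[mu]_(x in @Omega R) (chebw 0 x)%:E = (pi : R)%:E)%E.
Proof.
rewrite -[X in _ = X%:E](opprK pi) -[X in _ = X%:E]add0r.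
apply: (@ge0_open_FTC R _ (fun x => - acos x)); first by lra.
- by move=> x /OmegaE xO; rewrite (le_trans _ (normr_chebw 0 xO)).
- by move=> x /OmegaE; exact: continuous_chebw.
- move=> x /OmegaE xO; have := is_deriveN (is_derive_acos_Omega xO).
  by rewrite opprK /chebw chebT0 mul1r.
- by apply: cvgN; exact: cvg_acosN1.
- by rewrite -oppr0; apply: cvgN; exact: cvg_acos1.
Qed.

Lemma integrable_chebw n : mu.-integrable (@Omega R) (EFin \o chebw n).
Proof.
apply/integrableP; split; first by apply/measurable_EFinP; exact: measurable_chebw.
apply: (@le_lt_trans _ _ (\int[mu]_(x in @Omega R) (chebw 0 x)%:E)%E).
  apply: (ge0_le_integral mu measurable_Omega) => //=.
  - by apply/measurable_EFinP; apply: measurableT_comp => //; exact: measurable_chebw.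
  - by apply/measurable_EFinP; exact: measurable_chebw.
  - by move=> x xO; rewrite lee_fin normr_chebw.
by rewrite integral_arcsine ltry.
Qed.

Lemma sin_nat_pi n : sin (n%:R * pi) = 0 :> R.
Proof.
elim: n => [|n IH]; first by rewrite mul0r sin0.
by rewrite -natr1 mulrDl mul1r sinDpi IH oppr0.
Qed.

Lemma cos_nat_pi n : cos (n%:R * pi) = (-1) ^+ n :> R.
Proof.
elim: n => [|n IH]; first by rewrite mul0r cos0.
by rewrite -natr1 mulrDl mul1r cosDpi IH exprS mulN1r.
Qed.

Lemma chebwN n x : Omega x -> chebw n (- x) = (-1) ^+ n * chebw n x.
Proof.
move=> /OmegaE xO; rewrite /chebw sqrrN /chebT acosN; last by lra.
by rewrite mulrBr cosB sin_nat_pi cos_nat_pi mul0r addr0 mulrA.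
Qed.

Lemma integral_chebw n : (0 < n)%N -> (\int[mu]_(x in @Omega R) (chebw n x)%:E = 0)%E.
Proof.
move=> n0; have nn0 : n%:R != 0 :> R by rewrite pnatr_eq0 -lt0n.
have : (\int[mu]_(x in @Omega R) (chebw 0 x + chebw n x)%:E = (pi : R)%:E)%E.
  rewrite -[X in _ = X%:E](opprK pi) -[X in _ = X%:E]add0r.
  pose S x := n%:R^-1 * sin (n%:R * acos x).
  have S0 : 0 = - 0 - n%:R^-1 * sin (n%:R * 0) :> R by rewrite mulr0 sin0; ring.
  have Spi : - pi = - pi - n%:R^-1 * sin (n%:R * pi) :> R.
    by rewrite sin_nat_pi; ring.
  apply: (@ge0_open_FTC R _ (fun x => - acos x - S x)); first by lra.
  - by move=> x /OmegaE xO; have := normr_chebw n xO; rewrite ler_norml; lra.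
  - by move=> x /OmegaE xO; apply: cvgD; exact: continuous_chebw.
  - move=> x /OmegaE xO; have da := is_derive_acos_Omega xO.
    have ds : is_derive x 1 S (- chebw n x).
      pose g y : R := n%:R * acos y.
      have dg : is_derive x 1 g (n%:R * - (Num.sqrt (1 - x ^+ 2))^-1) := is_deriveZ n%:R da.
      have dsg := @is_derive1_comp R (@sin R) g x _ _ (is_derive_sin (g x)) dg.
      apply: (is_derive_eq (is_deriveZ n%:R^-1 dsg)).
      rewrite /GRing.scale/= /chebw /chebT /g.
      by field; rewrite nn0 gt_eqF ?sqrt_gt0_Omega//; apply/OmegaE.
    have := is_deriveB (is_deriveN da) ds.
    by rewrite !opprK /chebw chebT0 mul1r.
  - rewrite [X in _ --> X]Spi; apply: cvgB; first by apply: cvgN; exact: cvg_acosN1.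
    apply: cvgMr; apply: (@cvg_comp _ _ _ (fun x => n%:R * acos x) (@sin R)).
      by apply: cvgMr; exact: cvg_acosN1.
    exact: continuous_sin.
  - rewrite [X in _ --> X]S0; apply: cvgB; first by apply: cvgN; exact: cvg_acos1.
    apply: cvgMr; apply: (@cvg_comp _ _ _ (fun x => n%:R * acos x) (@sin R)).
      by apply: cvgMr; exact: cvg_acos1.
    exact: continuous_sin.
have := integralD_EFin measurable_Omega (integrable_chebw 0) (integrable_chebw n).
rewrite /= => ->; rewrite integral_arcsine.
have := integrable_fin_num measurable_Omega (integrable_chebw n).
case: (\int[mu]_(x in _) (chebw n x)%:E)%E => // r _ [] H; congr (_%:E); lra.
Qed.

Lemma chebT_rec n x : -1 <= x <= 1 ->
  x * chebT n.+1 x = (chebT n.+2 x + chebT n x) / 2.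
Proof.
move=> xI; rewrite /chebT -{1}[x]acosK ?in_itv//; set t := acos x.
have -> : n.+2%:R * t = n.+1%:R * t + t by rewrite -[n.+2%:R]natr1; ring.
have -> : n%:R * t = n.+1%:R * t - t by rewrite -natr1; ring.
by rewrite cosD cosB; field.
Qed.

Lemma integrable_moment_chebw i n :
  mu.-integrable (@Omega R) (EFin \o (fun x => (1 + x) ^+ i * chebw n x)).
Proof.
have h : mu.-integrable (@Omega R) (EFin \o (fun x => 2 ^+ i * chebw 0 x)).
  exact: (integrableZl measurable_Omega (2 ^+ i) (integrable_chebw 0)).
apply: (le_integrable measurable_Omega _ _ h) => //.
  apply/measurable_EFinP; apply: measurable_realfun.measurable_funM; last exact: measurable_chebw.
  by apply/measurable_funTS/measurable_funX/measurable_realfun.measurable_funD.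
move=> x xO /=; rewrite lee_fin normrM [leRHS]normrM; apply: ler_pM => //.
  move/OmegaE: xO => /andP[? ?]; rewrite !ger0_norm ?exprn_ge0//; last lra.
  by apply: lerXn2r; rewrite ?nnegrE//; lra.
by rewrite (le_trans (normr_chebw n xO))// ler_norm.
Qed.

(** Orthogonality of $T_n$ to polynomials of smaller degree, by induction on the
    degree through the three-term recurrence. *)
Lemma moment_chebw i n : (i < n)%N ->
  (\int[mu]_(x in @Omega R) ((1 + x) ^+ i * chebw n x)%:E = 0)%E.
Proof.
elim: i n => [|i IH] [//|n] ltin.
  rewrite -[RHS](@integral_chebw n.+1)//.
  by apply: eq_integral => x _; rewrite expr0 mul1r.
pose g k x := (1 + x) ^+ i * chebw k x.
have E x : x \in @Omega R -> ((1 + x) ^+ i.+1 * chebw n.+1 x)%:E =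
    ((g n.+1 x)%:E + (2^-1)%:E * ((g n.+2 x)%:E + (g n x)%:E))%E.
  rewrite inE => xO.
  transitivity (g n.+1 x + 2^-1 * (g n.+2 x + g n x))%:E; last by [].
  congr (_%:E).
  rewrite /g /chebw exprS.
  have /(chebT_rec n) H : -1 <= x <= 1 by move/OmegaE : xO; lra.
  rewrite (_ : (1 + x) * _ * _ = (1 + x) ^+ i * ((chebT n.+1 x + x * chebT n.+1 x) / Num.sqrt (1 - x ^+ 2))); last by ring.
  by rewrite H; field; rewrite gt_eqF// sqrt_gt0_Omega.
transitivity (\int[mu]_(x in @Omega R)
    ((g n.+1 x)%:E + (2^-1)%:E * ((g n.+2 x)%:E + (g n x)%:E)))%E.
  exact: eq_integral.
have ig k := integrable_moment_chebw i k.
have mO := measurable_Omega.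
rewrite integralD//; [|by apply: ig|]; last first.
  by apply: integrableZl => //; apply: integrableD => //; exact: ig.
rewrite integralZl//; last by apply: integrableD => //; exact: ig.
rewrite integralD//; [|by apply: ig|by apply: ig].
have ltin' : (i < n)%N by [].
rewrite /g (IH n.+1) ?(IH n.+2) ?(IH n)//; first by rewrite !add0e mule0.
- exact/leqW/leqW.
- exact: leqW.
Qed.

End ChebyshevWeight.

(** * Riemann-Liouville kernels *)

(** The kernel of the Riemann-Liouville integral of order [a] from the left,
    $\frac{(x-y)_+^{a-1}}{\Gamma(a)}$. *)
HB.lock Definition rlker {R : realType} (a x y : R) : R := tpow a (x - y) / EulerGamma a.

Section RLKernel.
Context {R : realType}.
Local Notation mu := (@lebesgue_measure R).
Implicit Types a b x y t : R.

Lemma rlkerE a x y : y < x -> rlker a x y = (x - y) `^ (a - 1) / EulerGamma a.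
Proof. by move=> yx; rewrite rlker.unlock tpow_gt0// subr_gt0. Qed.

Lemma rlker0 a x y : x <= y -> rlker a x y = 0.
Proof. by move=> yx; rewrite rlker.unlock tpow_le0 ?mul0r// subr_le0. Qed.

Lemma rlker_ge0 a x y : 0 < a -> 0 <= rlker a x y.
Proof.
move=> a0; rewrite rlker.unlock; apply: mulr_ge0; first exact: tpow_ge0.
by rewrite invr_ge0; apply/ltW/Gamma_gt0.
Qed.

Lemma measurable_rlker a d (T : measurableType d) (f g : T -> R) :
  measurable_fun [set: T] f -> measurable_fun [set: T] g ->
  measurable_fun [set: T] (fun p => rlker a (f p) (g p)).
Proof.
move=> mf mg; rewrite rlker.unlock; apply: measurable_realfun.measurable_funM => //.
exact: measurable_tpow_sub.
Qed.

Lemma integral_rlker_rlker a b x y : 0 < a -> 0 < b ->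
  (\int[mu]_t (rlker a x t * rlker b t y)%:E = (rlker (a + b) x y)%:E)%E.
Proof. by move=> a0 b0; rewrite rlker.unlock; exact: tpow_convolution. Qed.

Lemma Gamma1 : EulerGamma 1 = 1 :> R.
Proof.
apply: EFin_inj; rewrite -eGammaE// -(integral_exponential_pdf (@ltr01 R)).
rewrite /eGamma -[RHS](@integral_setD1 _ _ 0)//=.
- rewrite -[LHS](@integral_setD1 _ _ 0)//=.
  + apply: eq_integral => x; rewrite inE/= => -[_ /eqP x0]; congr (_%:E).
    have [x1|x1] := ltP 0 x.
      by rewrite tpow1 x1 mul1r exponential_pdfE ?ltW// mul1r mulN1r.
    by rewrite tpow_le0// mul0r lt0_exponential_pdf// lt_neqAle x0.
  + by apply: measurableD.
  + apply: measurable_funTS; apply/measurable_EFinP; exact: measurable_Gamma_integrand.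
- by apply: measurableD.
- apply: measurable_funTS; apply/measurable_EFinP; exact: measurable_exponential_pdf.
Qed.

Lemma rlker1 x y : rlker 1 x y = (y < x)%R%:R.
Proof. by rewrite rlker.unlock Gamma1 divr1 tpow1 subr_gt0. Qed.

Lemma GammaS a : 0 < a -> EulerGamma (a + 1) = a * EulerGamma a.
Proof.
move=> a0; have Ga0 := Gamma_gt0 a0.
have Ga1 : 0 < EulerGamma (a + 1) by apply: Gamma_gt0; lra.
have := @integral_rlker_rlker 1 a 1 0 ltr01 a0.
rewrite (addrC 1) [X in _ = X%:E -> _]rlkerE// subr0 powR1 => H.
have : (\int[mu]_t (rlker 1 1 t * rlker a t 0)%:E = (a^-1 / EulerGamma a)%:E)%E.
  transitivity (\int[mu]_(t in `]0%R, 1%R[) ((EulerGamma a)^-1%:E * (tpow a t)%:E))%E.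
    rewrite [RHS]integral_mkcond; apply: eq_integral => t _.
    rewrite patchE rlker1; case: ifPn; rewrite ?inE ?notin_setE/= in_itv/=.
      by move=> /andP[t0 ->]; rewrite mul1r rlker.unlock subr0 mulrC.
    move/negP; rewrite negb_and -!leNgt => /orP[t0|t1].
      by rewrite rlker0// mulr0.
    by rewrite ltNge t1 mul0r.
  move: (EulerGamma a) Ga0 => g g0.
  have G0 : (0 <= (g^-1)%:E)%E by rewrite lee_fin invr_ge0 ltW.
  rewrite (ge0_integralZl mu _ _ _ G0).
  - by rewrite integral_tpow01// -EFinM mulrC.
  - exact: measurable_itv.
  - by apply: measurable_funTS; apply/measurable_EFinP; exact: measurable_tpow.
  - by move=> t _; rewrite lee_fin tpow_ge0.
rewrite H => -[]; move: (EulerGamma a) (EulerGamma (a + 1)) Ga0 Ga1 => g g1 g0 g10 E.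
have : a * g * g1 * (1 / g1) = a * g * g1 * (a^-1 / g) by rewrite E.
rewrite (_ : _ * (1 / g1) = a * g); last by field; rewrite gt_eqF.
by rewrite (_ : _ * (a^-1 / g) = g1); last by field; rewrite !gt_eqF.
Qed.

Lemma Gamma_natD a j : 0 < a -> EulerGamma (a + j%:R) = pochhammer a j * EulerGamma a.
Proof.
move=> a0; elim: j => [|j IH]; first by rewrite addr0 /pochhammer big_ord0 mul1r.
rewrite -natr1 addrA GammaS; last by rewrite ltr_wpDr.
by rewrite IH /pochhammer big_ord_recr/=; ring.
Qed.

Lemma powR_Nhalf t : 0 < t -> t `^ (1 / 2 - 1) = (Num.sqrt t)^-1.
Proof.
move=> t0; rewrite -powR12_sqrt ?ltW// -powRN; congr (_ `^ _); lra.
Qed.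

Lemma rlker_half_mul t : Omega t ->
  rlker (1 / 2) 1 t * rlker (1 / 2) t (-1) = chebw 0 t / (EulerGamma (1 / 2)) ^+ 2.
Proof.
move=> /OmegaE/andP[tN1 t1]; rewrite !rlkerE// !powR_Nhalf; [|lra|lra].
rewrite /chebw chebT0 (_ : 1 - t ^+ 2 = (1 - t) * (t - -1)); last by ring.
rewrite sqrtrM ?subr_ge0 ?ltW// invfM expr2 invfM; ring.
Qed.

(** $\Gamma(1/2)^2$ is the Beta integral B(1/2,1/2), an arcsine integral. *)
Lemma Gamma_half : EulerGamma (1 / 2) = Num.sqrt pi :> R.
Proof.
have h0 : 0 < 1 / 2 :> R by lra.
have G0 := Gamma_gt0 h0.
have := @integral_rlker_rlker (1 / 2) (1 / 2) 1 (-1) h0 h0.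
rewrite (_ : 1 / 2 + 1 / 2 = 1 :> R); last by field.
rewrite rlker1 (_ : -1 < 1 :> R)/=; last by lra.
have -> : (\int[mu]_t (rlker (1 / 2) 1 t * rlker (1 / 2) t (-1))%:E =
    ((EulerGamma (1 / 2)) ^- 2 * pi : R)%:E)%E.
  transitivity (\int[mu]_(t in @Omega R) (((EulerGamma (1 / 2)) ^- 2)%:E * (chebw 0 t)%:E))%E.
    rewrite [RHS]integral_mkcond; apply: eq_integral => t _.
    rewrite patchE; case: ifPn; rewrite ?inE ?notin_setE.
      by move=> tO; rewrite rlker_half_mul// mulrC.
    move=> tO; have [t1|t1] := leP 1 t; first by rewrite rlker0// mul0r.
    have [t2|t2] := leP t (-1); first by rewrite (rlker0 _ t2)// mulr0.
    by exfalso; apply: tO; apply/OmegaE; rewrite t1 t2.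
  have G2 : (0 <= ((EulerGamma (1 / 2)) ^- 2 : R)%:E)%E by rewrite lee_fin invr_ge0 sqr_ge0.
  rewrite (ge0_integralZl mu measurable_Omega _ _ G2).
  - by rewrite integral_arcsine.
  - by apply/measurable_EFinP; exact: measurable_chebw.
  - by move=> t tO; rewrite lee_fin (le_trans _ (normr_chebw 0 tO)).
move: (EulerGamma (1 / 2)) G0 => g g0 -[] E.
have : g ^+ 2 * (g ^- 2 * pi) = g ^+ 2 by rewrite E mulr1.
rewrite mulrA mulfV ?mul1r ?expf_neq0 ?gt_eqF// => ->.
by rewrite sqrtr_sqr gtr0_norm.
Qed.

End RLKernel.

(** * Hypergeometric series *)

Section Hypergeometric.
Context {R : realType}.
Implicit Types a b c z : R.

(** D'Alembert's ratio test, for a ratio bounded by some q < 1 from index N on. *)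
Lemma ratio_test (u : R^nat) (q : R) (N : nat) : 0 < q < 1 ->
  (forall j, (N <= j)%N -> `|u j.+1| <= q * `|u j|) -> cvgn (series u).
Proof.
move=> /andP[q0 q1] uq; apply: normed_cvg.
pose v j := `|u j| / q ^+ j.
have v0 j : 0 <= v j by rewrite divr_ge0// exprn_ge0// ltW.
have vN j : (N <= j)%N -> v j.+1 <= v j.
  move=> /uq h; rewrite /v exprS invfM mulrA ler_pM2r ?invr_gt0 ?exprn_gt0//.
  by rewrite ler_pdivrMr// mulrC.
have vle j : (N <= j)%N -> v j <= v N.
  elim: j => [|j IH]; first by rewrite leqn0 => /eqP ->.
  rewrite leq_eqVlt => /orP[/eqP -> //|]; rewrite ltnS => Nj.
  exact: le_trans (vN _ Nj) (IH Nj).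
pose M := \sum_(i < N.+1) v i.
have vM j : v j <= M.
  have [jN|/ltnW Nj] := leqP j N.
    by rewrite /M (bigD1 (Ordinal (jN : (j < N.+1)%N)))//= lerDl sumr_ge0.
  apply: le_trans (vle _ Nj) _.
  by rewrite /M (bigD1 ord_max)//= lerDl sumr_ge0.
apply: (@series_le_cvg R _ (geometric M q)); first by move=> j /=.
- by move=> j; apply: geometric_ge0; [exact: sumr_ge0|exact: ltW].
- by move=> j /=; have := vM j; rewrite /v ler_pdivrMr ?exprn_gt0.
- by apply: is_cvg_geometric_series; rewrite gtr0_norm.
Qed.

Definition hcoef a b c (j : nat) : R :=
  pochhammer a j * pochhammer b j / pochhammer c j / j`!%:R.

Lemma hyp2F1E a b c z : hyp2F1 a b c z = limn (pseries (hcoef a b c) z).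
Proof.
rewrite /hyp2F1 /pseries; congr (limn (series _)); apply/funext => j.
by rewrite /hcoef mulrA mulrAC.
Qed.

Lemma pochhammerS a j : pochhammer a j.+1 = pochhammer a j * (a + j%:R).
Proof. by rewrite /pochhammer big_ord_recr. Qed.

Lemma pochhammerSl a j : pochhammer a j.+1 = a * pochhammer (a + 1) j.
Proof.
rewrite /pochhammer big_ord_recl/= addr0; congr (_ * _).
by apply: eq_bigr => i _; rewrite /bump/= natrD; ring.
Qed.

Lemma pochhammer_gt0 c j : 0 < c -> 0 < pochhammer c j.
Proof. by move=> c0; apply: prodr_gt0 => i _; rewrite ltr_wpDr. Qed.

Lemma hcoefS a b c j : 0 < c -> hcoef a b c j.+1 =
  hcoef a b c j * ((a + j%:R) * (b + j%:R) / ((c + j%:R) * j.+1%:R)).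
Proof.
move=> c0; rewrite /hcoef !pochhammerS factS natrM.
have := pochhammer_gt0 j c0; have : 0 < c + j%:R by rewrite ltr_wpDr.
have : 0 < j`!%:R :> R by rewrite ltr0n fact_gt0.
have : 0 < j.+1%:R :> R by [].
move: (j`!%:R) (j.+1%:R) (c + j%:R) (pochhammer c j) => f s cj pc f0 s0 cj0 pc0.
by field; rewrite !gt_eqF.
Qed.

Lemma cvg_hyp a b c z : 0 < c -> `|z| < 1 -> cvgn (pseries (hcoef a b c) z).
Proof.
move=> c0; set x := `|z| => z1; have x0 : 0 <= x by exact: normr_ge0.
pose d := (1 - x) / 8; have d0 : 0 < d by rewrite /d; lra.
pose N := (Num.bound ((`|a| + `|b|) / d)).
apply: (@ratio_test _ ((1 + x) / 2) N); first by apply/andP; split; lra.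
move=> j Nj /=; rewrite hcoefS// exprS.
have j0 : 0 <= j%:R :> R by [].
have dj : `|a| + `|b| <= d * j%:R.
  rewrite mulrC -ler_pdivrMr//.
  apply: le_trans (ltW (archi_boundP _)) _; first by rewrite divr_ge0 ?addr_ge0// ltW.
  by rewrite ler_nat.
have cj : 0 < c + j%:R by rewrite ltr_wpDr.
rewrite [X in `|X|](_ : _ = (hcoef a b c j * z ^+ j) *
  (z * ((a + j%:R) * (b + j%:R) / ((c + j%:R) * j.+1%:R)))); last by ring.
rewrite normrM mulrC ler_wpM2r// normrM -/x normrM normfV.
rewrite (gtr0_norm (mulr_gt0 cj (ltr0Sn _ _))) normrM.
have h1 : `|a + j%:R| <= (1 + d) * (c + j%:R).
  apply: le_trans (ler_normD _ _) _; rewrite [ `|j%:R| ]ger0_norm//.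
  by have := normr_ge0 b; nra.
have h2 : `|b + j%:R| <= (1 + d) * j.+1%:R.
  apply: le_trans (ler_normD _ _) _; rewrite [ `|j%:R| ]ger0_norm// -natr1.
  by have := normr_ge0 a; nra.
have h3 : `|a + j%:R| * `|b + j%:R| / ((c + j%:R) * j.+1%:R) <= (1 + d) ^+ 2.
  rewrite ler_pdivrMr ?mulr_gt0// expr2 mulrACA.
  by apply: ler_pM.
apply: le_trans (ler_wpM2l x0 h3) _; rewrite /d.
nra.
Qed.

Lemma hcoef_diffs a b c : 0 < c ->
  pseries_diffs (hcoef a b c) = fun j => a * b / c * hcoef (a + 1) (b + 1) (c + 1) j.
Proof.
move=> c0; apply/funext => j; rewrite /pseries_diffs /hcoef !pochhammerSl factS natrM.
have := @pochhammer_gt0 (c + 1) j (addr_gt0 c0 ltr01).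
have : 0 < j`!%:R :> R by rewrite ltr0n fact_gt0.
have : 0 < j.+1%:R :> R by [].
move: (j`!%:R) (j.+1%:R) (pochhammer (c + 1) j) => f s pc f0 s0 pc0.
by field; rewrite !gt_eqF.
Qed.

Lemma cvg_pseriesZ (f : R^nat) (k z l : R) : pseries f z @ \oo --> l ->
  pseries (fun j => k * f j) z @ \oo --> k * l.
Proof.
move=> h; rewrite /pseries (_ : [series _]_i = (fun n => k * pseries f z n)).
  exact: cvgMr.
apply/funext => n; rewrite /pseries /series/= mulr_sumr.
by apply: eq_bigr => i _; rewrite mulrA.
Qed.

Lemma hcvg a b c z : 0 < c -> `|z| < 1 ->
  pseries (hcoef a b c) z @ \oo --> hyp2F1 a b c z.
Proof. by move=> c0 z1; rewrite hyp2F1E; exact: cvg_hyp. Qed.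

Lemma hcvg_diffs a b c z : 0 < c -> `|z| < 1 ->
  pseries (pseries_diffs (hcoef a b c)) z @ \oo -->
  a * b / c * hyp2F1 (a + 1) (b + 1) (c + 1) z.
Proof.
move=> c0 z1; rewrite hcoef_diffs//; apply/cvg_pseriesZ/hcvg => //.
by rewrite addr_gt0.
Qed.

Definition hyp_d1 a b c z := a * b / c * hyp2F1 (a + 1) (b + 1) (c + 1) z.
Definition hyp_d2 a b c z := a * b / c * hyp_d1 (a + 1) (b + 1) (c + 1) z.

Lemma hcvg_diffs2 a b c z : 0 < c -> `|z| < 1 ->
  pseries (pseries_diffs (pseries_diffs (hcoef a b c))) z @ \oo --> hyp_d2 a b c z.
Proof.
move=> c0 z1; have c1 : 0 < c + 1 by rewrite addr_gt0.
rewrite hcoef_diffs// (_ : pseries_diffs _ =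
  fun j => a * b / c * pseries_diffs (hcoef (a + 1) (b + 1) (c + 1)) j).
  by apply/cvg_pseriesZ/hcvg_diffs.
by apply/funext => j; rewrite /pseries_diffs mulrCA.
Qed.

Lemma is_derive_hyp a b c z : 0 < c -> `|z| < 1 ->
  is_derive z 1 (hyp2F1 a b c) (hyp_d1 a b c z).
Proof.
move=> c0 z1; pose K := (1 + `|z|) / 2.
have K0 : 0 < K by rewrite /K; have := normr_ge0 z; lra.
have K1 : `|K| < 1 by rewrite gtr0_norm// /K; lra.
have zK : `|z| < `|K| by rewrite (gtr0_norm K0) /K; lra.
rewrite (_ : hyp2F1 a b c = fun x => limn (pseries (hcoef a b c) x)); last first.
  by apply/funext => x; rewrite hyp2F1E.
have -> : hyp_d1 a b c z = limn (pseries (pseries_diffs (hcoef a b c)) z).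
  by apply/esym/cvg_lim => //; exact: hcvg_diffs.
apply: (@pseries_snd_diffs R _ K) => //.
- exact: cvg_hyp.
- by apply: cvgP; exact: hcvg_diffs.
- by apply: cvgP; exact: hcvg_diffs2.
Qed.

Lemma is_derive_hyp_d1 a b c z : 0 < c -> `|z| < 1 ->
  is_derive z 1 (hyp_d1 a b c) (hyp_d2 a b c z).
Proof.
move=> c0 z1; have c1 : 0 < c + 1 by rewrite addr_gt0.
exact: (is_deriveZ (a * b / c) (is_derive_hyp (a + 1) (b + 1) c1 z1)).
Qed.

Lemma cvg_pseries_theta (f : R^nat) (z l : R) :
  pseries (pseries_diffs f) z @ \oo --> l ->
  pseries (fun j => j%:R * f j) z @ \oo --> z * l.
Proof.
move=> h; have := pseries_diffs_equiv (cvgP _ h).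
rewrite (cvg_lim _ h)// => {}h.
rewrite (_ : pseries _ z = fun n => z * series (fun i => i%:R * f i * z ^+ i.-1) n).
  exact: cvgMr.
apply/funext => n; rewrite /pseries /series/= mulr_sumr.
apply: eq_bigr => -[|i] _; first by rewrite !mul0r mulr0.
by rewrite /= exprS; ring.
Qed.

Lemma cvg_pseriesD (f g : R^nat) (z l k : R) :
  pseries f z @ \oo --> l -> pseries g z @ \oo --> k ->
  pseries (fun j => f j + g j) z @ \oo --> l + k.
Proof.
move=> hf hg; rewrite (_ : pseries _ z = pseries f z \+ pseries g z); first exact: cvgD.
apply/funext => n; rewrite /pseries /series/= -big_split/=.
by apply: eq_bigr => i _; rewrite mulrDl.
Qed.

(** Gauss's differential equation, read off the coefficients. *)
Lemma hyp_ODE a b c z : 0 < c -> `|z| < 1 ->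
  z * (1 - z) * hyp_d2 a b c z + (c - (a + b + 1) * z) * hyp_d1 a b c z
  - a * b * hyp2F1 a b c z = 0.
Proof.
move=> c0 z1; set f := hcoef a b c.
have A0 := @hcvg a b c z c0 z1; have A1 := @hcvg_diffs a b c z c0 z1.
have A2 := @hcvg_diffs2 a b c z c0 z1; rewrite -/(hyp_d1 a b c z) in A1.
have B1 := cvg_pseries_theta A1.
have B2 := cvg_pseries_theta A2.
have B3 : pseries (fun j => j%:R * ((j%:R - 1) * f j)) z @ \oo --> z * (z * hyp_d2 a b c z).
  apply: cvg_pseries_theta.
  rewrite (_ : pseries_diffs _ = fun j => j%:R * pseries_diffs f j)//.
  by apply/funext => j; rewrite /pseries_diffs -natr1; ring.
have := cvg_pseriesD B2 (cvg_pseriesD (cvg_pseriesZ (k := -1) B3) (cvg_pseriesD (cvg_pseriesZ (k := c) A1)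
  (cvg_pseriesD (cvg_pseriesZ (k := - (a + b + 1)) B1) (cvg_pseriesZ (k := - (a * b)) A0)))).
rewrite (_ : pseries _ z = fun=> 0); last first.
  apply/funext => n; rewrite /pseries /series/= big1// => j _.
  rewrite -/f [X in X * _](_ : _ = 0) ?mul0r// /pseries_diffs /f hcoefS//.
  have : c + j%:R != 0 by rewrite gt_eqF// ltr_wpDr.
  by rewrite -natr1 => cj; field; rewrite cj natr1 pnatr_eq0.
move=> /(cvg_lim (@Rhausdorff R)); rewrite lim_cst; last exact: Rhausdorff.
by move=> H; rewrite [RHS]H; ring.
Qed.

Lemma hyp0 a b c : hyp2F1 a b c 0 = 1.
Proof.
rewrite hyp2F1E; apply/cvg_lim => //; rewrite -(cvg_shiftS (pseries _ 0)) /=.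
rewrite (_ : (fun n => _) = fun=> 1); first exact: cvg_cst.
apply/funext => n; rewrite /pseries /series/= big_nat_recl//= big1 ?addr0.
  by rewrite /hcoef /pochhammer !big_ord0 expr0 fact0; field.
by move=> i _; rewrite expr0n mulr0.
Qed.

End Hypergeometric.

(** * Two hypergeometric identities proved through differential equations *)

Section HypergeometricIdentities.
Context {R : realType}.
Implicit Types (a b c e p r z : R).

Lemma is_derive_nincr (f f' : R -> R) (x y : R) : x <= y ->
  (forall t, x <= t <= y -> is_derive t 1 f (f' t)) ->
  (forall t, x <= t <= y -> f' t <= 0) -> f y <= f x.
Proof.
move=> xy df f'0.
have inI (t : R) : t \in `]x, y[ -> x <= t <= y.
  by rewrite in_itv/= => /andP[? ?]; rewrite !ltW.
apply: (@ler0_derive1_le_cc R f x y).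
- by move=> t /inI/df [].
- by move=> t /inI tI; rewrite derive1E; have [_ ->] := df _ tI; exact: f'0.
- apply: continuous_in_subspaceT => t; rewrite inE/= in_itv/= => /df.
  exact: is_derive_continuous.
- by rewrite in_itv/= lexx xy.
- by rewrite in_itv/= lexx xy.
- by [].
Qed.

Lemma is_deriveM1 (f g : R -> R) (x df dg : R) :
  is_derive x 1 f df -> is_derive x 1 g dg ->
  is_derive x 1 (fun t => f t * g t) (f x * dg + g x * df).
Proof. by move=> hf hg; exact: (is_deriveM hf hg). Qed.

(** Uniqueness at the regular singular point 0 of Gauss's equation: the energy
    $zD'^2+D^2$ satisfies a Gronwall inequality up to 0, since the singular
    coefficient has the good sign when c > 1/2. *)
Lemma Gauss_ODE_unique (D D1 D2 : R -> R) c e p r : 1 / 2 < c -> 0 <= r < 1 ->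
  (forall z, 0 <= z <= r -> is_derive z 1 D (D1 z)) ->
  (forall z, 0 <= z <= r -> is_derive z 1 D1 (D2 z)) ->
  (forall z, 0 <= z <= r ->
    z * (1 - z) * D2 z + (c - e * z) * D1 z - p * D z = 0) ->
  D 0 = 0 -> D r = 0.
Proof.
move=> c12 /andP[r0 r1] dD dD1 ode D0.
pose K := (1 - r)^-1; have K0 : 0 < K by rewrite invr_gt0; lra.
pose M := `|p| * K + 1; have M0 : 0 < M by rewrite ltr_wpDl// mulr_ge0// ltW.
(* The second summand absorbs the mixed term in D * D1 by completing the
   square, which uses 2c - 1 > 0. *)
pose C := 2 * `|c - e| * K + M ^+ 2 / (2 * c - 1).
pose E z := z * (D1 z * D1 z) + D z * D z.
pose E' z := D1 z * D1 z + 2 * z * D1 z * D2 z + 2 * D z * D1 z.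
have dE (z : R) : 0 <= z <= r -> is_derive z 1 E (E' z).
  move=> zr; have hD := dD _ zr; have hD1 := dD1 _ zr.
  have hz := is_derive_id z (1 : R).
  have h := is_deriveD (is_deriveM1 hz (is_deriveM1 hD1 hD1)) (is_deriveM1 hD hD).
  by apply: (is_derive_eq h); rewrite /E'; ring.
have leE (z : R) : 0 <= z <= r -> E' z <= C * E z.
  move=> /[dup] zr /andP[z0 zler].
  have z1 : 0 < 1 - z by lra.
  pose k := (1 - z)^-1; have k0 : 0 < k by rewrite invr_gt0.
  have kK : k <= K by rewrite lef_pV2 ?posrE; lra.
  have zD2 : z * D2 z = p * k * D z - (c + (c - e) * (z * k)) * D1 z.
    apply: (@mulfI _ (1 - z)); first by rewrite gt_eqF.
    transitivity (p * D z - (c - e * z) * D1 z); first by apply/eqP; rewrite -subr_eq0 -(ode z zr); apply/eqP; ring.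
    by rewrite /k; field; rewrite gt_eqF.
  have -> : E' z = (1 - 2 * c) * (D1 z * D1 z) - 2 * (c - e) * k * (z * (D1 z * D1 z))
       + 2 * (p * k + 1) * D z * D1 z.
    transitivity (D1 z * D1 z + 2 * D1 z * (z * D2 z) + 2 * D z * D1 z).
      by rewrite /E'; ring.
    by rewrite zD2; ring.
  set t := p * k + 1; set d := D z; set d1 := D1 z; rewrite /E -/d -/d1.
  have tM : t ^+ 2 <= M ^+ 2.
    rewrite -[leLHS]real_normK ?num_real// lerXn2r ?nnegrE ?(ltW M0)//.
    apply: le_trans (ler_normD _ _) _; rewrite normr1 lerD2r normrM.
    by rewrite ler_wpM2l// gtr0_norm.
  have c1 : 0 < 2 * c - 1 by lra.
  have sq : (1 - 2 * c) * (d1 * d1) + 2 * t * d * d1 <= M ^+ 2 / (2 * c - 1) * (d * d).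
    apply: (@le_trans _ _ (t ^+ 2 / (2 * c - 1) * (d * d))); last first.
      by rewrite ler_wpM2r ?ler_wpM2r ?invr_ge0 ?(ltW c1)// -expr2 sqr_ge0.
    rewrite -subr_ge0 (_ : _ - _ = ((2 * c - 1) * d1 - t * d) ^+ 2 / (2 * c - 1)).
      by rewrite divr_ge0 ?sqr_ge0 ?ltW.
    by field; rewrite gt_eqF.
  have w0 : 0 <= z * (d1 * d1) by rewrite mulr_ge0// -expr2 sqr_ge0.
  have q0 : 0 <= d * d by rewrite -expr2 sqr_ge0.
  have ck : - (2 * (c - e) * k) <= 2 * `|c - e| * K.
    apply: (@le_trans _ _ (2 * `|c - e| * k)).
      by rewrite -mulNr ler_wpM2r ?(ltW k0)// -mulrN ler_wpM2l// -normrN ler_norm.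
    by rewrite ler_wpM2l// mulr_ge0.
  have H1 := ler_wpM2r w0 ck.
  have H2 : 0 <= 2 * `|c - e| * K * (d * d).
    by rewrite mulr_ge0// mulr_ge0 ?(ltW K0)// mulr_ge0.
  have H3 : 0 <= M ^+ 2 / (2 * c - 1) * (z * (d1 * d1)).
    by rewrite mulr_ge0// divr_ge0 ?sqr_ge0 ?ltW.
  rewrite /C; lra.
pose G z := expR (- C * z) * E z.
have : G r <= G 0.
  apply: (@is_derive_nincr G (fun z => expR (- C * z) * (E' z - C * E z)) 0 r r0).
    move=> z zr; have hE := dE _ zr.
    have he : is_derive z 1 (fun z => expR (- C * z)) (expR (- C * z) * - C).
      have hz : is_derive z 1 (fun z => - C * z) (- C).
        apply: (is_derive_eq (is_deriveZ (- C) (is_derive_id z (1 : R)))).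
        by rewrite /GRing.scale/= mulr1.
      exact: (@is_derive1_comp R (@expR R) (fun z => - C * z) z _ _ (is_derive_expR _) hz).
    by apply: (is_derive_eq (is_deriveM1 he hE)); ring.
  move=> z zr; rewrite mulr_ge0_le0 ?expR_ge0// subr_le0; exact: leE.
rewrite /G /E D0 !mul0r addr0 mulr0 pmulr_rle0 ?expR_gt0// => Er.
have w0 : 0 <= r * (D1 r * D1 r) by rewrite mulr_ge0// -expr2 sqr_ge0.
have q0 : 0 <= D r * D r by rewrite -expr2 sqr_ge0.
by apply/eqP; rewrite -sqrf_eq0 expr2; apply/eqP; lra.
Qed.

(** Euler's transformation: the right-hand side satisfies the same equation of
    Gauss as the left-hand side, and both are 1 at 0. *)
Lemma hyp2F1_Euler a b c z : 1 / 2 < c -> 0 <= z < 1 ->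
  hyp2F1 a b c z = (1 - z) `^ (c - a - b) * hyp2F1 (c - a) (c - b) c z.
Proof.
move=> c12 zr; have c0 : 0 < c by lra.
set g := c - a - b; set a' := c - a; set b' := c - b.
pose pw (k t : R) := (1 - t) `^ k.
pose pw1 t := - g * pw (g - 1) t.
pose pw2 t := g * (g - 1) * pw (g - 2) t.
pose D t := hyp2F1 a b c t - pw g t * hyp2F1 a' b' c t.
pose D1 t := hyp_d1 a b c t - (pw g t * hyp_d1 a' b' c t + hyp2F1 a' b' c t * pw1 t).
pose D2 t := hyp_d2 a b c t - ((pw g t * hyp_d2 a' b' c t + hyp_d1 a' b' c t * pw1 t)
   + (hyp2F1 a' b' c t * pw2 t + pw1 t * hyp_d1 a' b' c t)).
have dpw (k t : R) : t < 1 -> is_derive t 1 (pw k) (- k * pw (k - 1) t).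
  move=> t1; have t0 : 0 < 1 - t by lra.
  have hz : is_derive t 1 (fun t => 1 - t) (-1 : R).
    apply: (is_derive_eq (is_deriveB (is_derive_cst (1 : R) t 1) (is_derive_id t (1 : R)))).
    by rewrite sub0r.
  apply: (is_derive_eq (@is_derive1_comp R (@powR R ^~ k) (fun t => 1 - t) t _ _
    (is_derive1_powR k t0) hz)).
  by rewrite /pw; ring.
have tlt (t : R) : 0 <= t <= z -> `|t| < 1 /\ t < 1.
  by move=> /andP[t0 tz]; rewrite ger0_norm//; split; lra.
suff : D z = 0 by move/eqP; rewrite subr_eq0 => /eqP.
apply: (@Gauss_ODE_unique D D1 D2 c (a + b + 1) (a * b) z c12 zr).
- move=> t /tlt[tn t1]; have h := is_derive_hyp a b c0 tn.
  have h' := is_derive_hyp a' b' c0 tn.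
  exact: (is_deriveB h (is_deriveM1 (dpw g t t1) h')).
- move=> t /tlt[tn t1]; have h := is_derive_hyp_d1 a b c0 tn.
  have h1 := is_derive_hyp_d1 a' b' c0 tn; have h' := is_derive_hyp a' b' c0 tn.
  have hp : is_derive t 1 pw1 (pw2 t).
    apply: (is_derive_eq (is_deriveZ (- g) (dpw (g - 1) t t1))).
    rewrite /pw2 /GRing.scale/= (_ : g - 1 - 1 = g - 2); last by ring.
    by ring.
  exact: (is_deriveB h (is_deriveD (is_deriveM1 (dpw g t t1) h1) (is_deriveM1 h' hp))).
- move=> t /tlt[tn t1]; have t0 : 0 < 1 - t by lra.
  have o1 := hyp_ODE a b c0 tn; have o2 := hyp_ODE a' b' c0 tn.
  pose P := pw (g - 2) t.
  have e0 : pw g t = P * (1 - t) ^+ 2.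
    rewrite /P /pw -powR_mulrn ?ltW// -powRD ?(gt_eqF t0) ?implybT//; congr (_ `^ _); ring.
  have e1 : pw (g - 1) t = P * (1 - t).
    rewrite /P /pw -[X in _ * X]powRr1 ?ltW// -powRD ?(gt_eqF t0) ?implybT//; congr (_ `^ _); ring.
  rewrite /D2 /D1 /D /pw1 /pw2 e0 e1 -/P.
  move: o1 o2; rewrite /a' /b' /g.
  move: (hyp_d2 a b c t) (hyp_d1 a b c t) (hyp2F1 a b c t).
  move: (hyp_d2 (c - a) (c - b) c t) (hyp_d1 (c - a) (c - b) c t) (hyp2F1 (c - a) (c - b) c t).
  move=> f2 f1 f g2 g1 g0 o1 o2.
  transitivity ((t * (1 - t) * g2 + (c - (a + b + 1) * t) * g1 - a * b * g0)
    - P * (1 - t) ^+ 2 * (t * (1 - t) * f2 + (c - (c - a + (c - b) + 1) * t) * f1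
       - (c - a) * (c - b) * f)).
    by ring.
  by rewrite o1 o2 mulr0 subr0.
- by rewrite /D !hyp0 /pw subr0 powR1 mul1r subrr.
Qed.

(** With z = sin^2 t, Gauss's equation says that the left-hand side solves the
    harmonic oscillator of frequency 2n; the energy of the difference of the two
    sides is constant, hence 0. *)
Lemma hyp2F1_cos (n : nat) (x : R) : (0 < n)%N -> 0 <= x < pi / 2 ->
  hyp2F1 (n%:R + 1 / 2) (1 / 2 - n%:R) (1 / 2) (sin x ^+ 2) * cos x = cos (2 * n%:R * x).
Proof.
move=> n0 /andP[x0 xpi]; set a := n%:R + 1 / 2; set b := 1 / 2 - n%:R.
have nR0 : 0 < n%:R :> R by rewrite ltr0n.
pose c : R := 1 / 2; have c0 : 0 < c by rewrite /c; lra.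
pose nu : R := 2 * n%:R; pose z t : R := sin t * sin t.
pose F t := hyp2F1 a b c (z t); pose F1 t := hyp_d1 a b c (z t).
pose D t := F t * cos t - cos (nu * t).
pose D1 t := (F1 t * (sin t * cos t * 2)) * cos t - F t * sin t + nu * sin (nu * t).
have zlt (t : R) : 0 <= t <= x -> `|z t| < 1.
  move=> tx; have ct : 0 < cos t by apply: cos_gt0_pihalf; have := pi_gt0 R; lra.
  rewrite ger0_norm ?/z -expr2 ?sqr_ge0// sin2cos2.
  by have := exprn_gt0 2 ct; lra.
have dnu (t : R) : is_derive t 1 (fun t => nu * t) nu.
  apply: (is_derive_eq (is_deriveZ nu (is_derive_id t (1 : R)))).
  by rewrite /GRing.scale/= mulr1.
have dcnu (t : R) : is_derive t 1 (fun t => cos (nu * t)) (- sin (nu * t) * nu).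
  exact: (@is_derive1_comp R (@cos R) _ t _ _ (is_derive_cos _) (dnu t)).
have dsnu (t : R) : is_derive t 1 (fun t => sin (nu * t)) (cos (nu * t) * nu).
  exact: (@is_derive1_comp R (@sin R) _ t _ _ (is_derive_sin _) (dnu t)).
have dz (t : R) : is_derive t 1 z (sin t * cos t + sin t * cos t).
  exact: (is_deriveM1 (is_derive_sin t) (is_derive_sin t)).
have dF (t : R) : 0 <= t <= x -> is_derive t 1 F (F1 t * (sin t * cos t + sin t * cos t)).
  move=> tx.
  exact: (@is_derive1_comp R (hyp2F1 a b c) z t _ _ (is_derive_hyp a b c0 (zlt t tx)) (dz t)).
have dF1 (t : R) : 0 <= t <= x ->
    is_derive t 1 F1 (hyp_d2 a b c (z t) * (sin t * cos t + sin t * cos t)).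
  move=> tx.
  exact: (@is_derive1_comp R (hyp_d1 a b c) z t _ _ (is_derive_hyp_d1 a b c0 (zlt t tx)) (dz t)).
have dD (t : R) : 0 <= t <= x -> is_derive t 1 D (D1 t).
  move=> tx; apply: (is_derive_eq (is_deriveB (is_deriveM1 (dF t tx) (is_derive_cos t)) (dcnu t))).
  by rewrite /D1; ring.
have dD1 (t : R) : 0 <= t <= x -> is_derive t 1 D1 (- nu ^+ 2 * D t).
  move=> tx; have dsc := is_deriveM1 (is_derive_sin t) (is_derive_cos t).
  have dsc2 := is_deriveM1 dsc (is_derive_cst (2 : R) t 1).
  have d1 := is_deriveM1 (is_deriveM1 (dF1 t tx) dsc2) (is_derive_cos t).
  have d2 := is_deriveB d1 (is_deriveM1 (dF t tx) (is_derive_sin t)).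
  apply: (is_derive_eq (is_deriveD d2 (is_deriveZ nu (dsnu t)))).
  have := hyp_ODE a b c0 (zlt t tx); rewrite /D /D1 /F1 /F /GRing.scale/=.
  have := cos2Dsin2 t; rewrite /z /nu /a /b /c.
  move: (hyp_d2 _ _ _ _) (hyp_d1 _ _ _ _) (hyp2F1 _ _ _ _) (cos (_ * t)).
  move: (sin t) (cos t) => S C f2 f1 f k CS o.
  have C2 : C ^+ 2 = 1 - S * S by rewrite -CS; ring.
  rewrite -C2 in o; apply/eqP; rewrite -subr_eq0; apply/eqP.
  transitivity (4 * C * (S * S * C ^+ 2 * f2 +
    (1 / 2 - (n%:R + 1 / 2 + (1 / 2 - n%:R) + 1) * (S * S)) * f1 -
    (n%:R + 1 / 2) * (1 / 2 - n%:R) * f) + 2 * C * f1 * (C ^+ 2 + S ^+ 2 - 1)).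
    by field.
  by rewrite o CS; ring.
pose E t := D1 t * D1 t + nu ^+ 2 * (D t * D t).
have : E x <= E 0.
  apply: (@is_derive_nincr E (fun=> 0) 0 x x0); last by move=> t _; exact: lexx.
  move=> t tx; have h := is_deriveD (is_deriveM1 (dD1 t tx) (dD1 t tx))
    (is_deriveZ (nu ^+ 2) (is_deriveM1 (dD t tx) (dD t tx))).
  by apply: (is_derive_eq h); rewrite /GRing.scale/=; ring.
have D0 : D 0 = 0 by rewrite /D /F /z mulr0 sin0 cos0 mulr0 hyp0 mulr1 subrr.
have D10 : D1 0 = 0 by rewrite /D1 mulr0 sin0; ring.
rewrite /E D0 D10 !mulr0 addr0 => E0.
have nu0 : 0 < nu ^+ 2 by rewrite exprn_gt0// mulr_gt0.
have d2 : 0 <= D x ^+ 2 by exact: sqr_ge0.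
have : D x = 0.
  apply/eqP; rewrite -sqrf_eq0 eq_le d2 andbT -(pmulr_rle0 _ nu0) expr2.
  by apply: le_trans E0; rewrite lerDr -expr2 sqr_ge0.
by move/eqP; rewrite subr_eq0 => /eqP <-; rewrite /F /z -expr2.
Qed.

(** The previous identity at t = acos x / 2, where sin^2 t = (1 - x) / 2. *)
Lemma chebwE (n : nat) (x : R) : (0 < n)%N -> Omega x ->
  chebw n x = 2 `^ (- (1 / 2)) * (1 - x) `^ (1 / 2 - 1) *
    hyp2F1 (n%:R + 1 / 2) (1 / 2 - n%:R) (1 / 2) ((1 - x) / 2).
Proof.
move=> n0 xO; have /OmegaE/andP[xN1 x1] := xO.
pose t := acos x / 2.
have a0 : 0 < acos x by apply: acos_gt0; rewrite x1 ltW.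
have api : acos x < pi by apply: acos_ltpi; rewrite xN1 ltW.
have xE : x = cos (t *+ 2) by rewrite -mulr_natr /t divfK// acosK// in_itv/= !ltW.
have tI : 0 <= t < pi / 2 by rewrite /t; lra.
have ct0 : 0 < cos t by apply: cos_gt0_pihalf; have := pi_gt0 R; lra.
have s2 : sin t ^+ 2 = (1 - x) / 2.
  by rewrite sin2cos2 xE cos_mulr2n mulr2n; field.
have c2 : cos t = Num.sqrt ((1 + x) / 2).
  have -> : (1 + x) / 2 = cos t ^+ 2 by rewrite xE cos_mulr2n mulr2n; field.
  by rewrite sqrtr_sqr gtr0_norm.
have := hyp2F1_cos n0 tI; rewrite s2 (_ : 2 * n%:R * t = n%:R * acos x); last first.
  by rewrite /t; field.
rewrite /chebw /chebT => <-; set F := hyp2F1 _ _ _ _; rewrite c2.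
have -> : (2 : R) `^ (- (1 / 2)) = (Num.sqrt 2)^-1.
  by rewrite powRN -powR12_sqrt// (_ : 1 / 2 = 2^-1 :> R)//; lra.
rewrite powR_Nhalf; last by lra.
rewrite (_ : 1 - x ^+ 2 = (1 + x) * (1 - x)); last by ring.
rewrite !sqrtrM ?sqrtrV; try lra.
have : 0 < Num.sqrt (1 + x) by rewrite sqrtr_gt0; lra.
have : 0 < Num.sqrt (1 - x) by rewrite sqrtr_gt0; lra.
have : 0 < Num.sqrt 2 :> R by rewrite sqrtr_gt0.
move: (Num.sqrt (1 + x)) (Num.sqrt (1 - x)) (Num.sqrt 2) => p q r r0 q0 p0.
by field; rewrite !gt_eqF.
Qed.

End HypergeometricIdentities.

(** * The fractional integral of the weighted Chebyshev polynomial *)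

Section FractionalChebyshev.
Context {R : realType}.
Local Notation mu := (@lebesgue_measure R).
Implicit Types (s x y : R) (n : nat).

(** The right-sided Riemann-Liouville integral of order [s] of [chebw n]. *)
Definition fracheb n s y : R :=
  \int[mu]_(x in @Omega R) (rlker s x y * chebw n x).

Lemma chebw0_le x : Omega x ->
  chebw 0 x <= (Num.sqrt (1 - x))^-1 + (Num.sqrt (1 + x))^-1.
Proof.
move=> /OmegaE/andP[xN1 x1]; rewrite /chebw chebT0 mul1r.
rewrite (_ : 1 - x ^+ 2 = (1 - x) * (1 + x)); last by ring.
rewrite sqrtrM; last by lra.
have p0 : 0 < Num.sqrt (1 - x) by rewrite sqrtr_gt0; lra.
have q0 : 0 < Num.sqrt (1 + x) by rewrite sqrtr_gt0; lra.
have sum2 : Num.sqrt (1 - x) ^+ 2 + Num.sqrt (1 + x) ^+ 2 = 2.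
  by rewrite !sqr_sqrtr; lra.
move: (Num.sqrt (1 - x)) (Num.sqrt (1 + x)) p0 q0 sum2 => p q p0 q0 sum2.
rewrite (_ : p^-1 + q^-1 = (p + q) * (p * q)^-1); last by field; rewrite !gt_eqF.
by rewrite ler_peMl ?invr_ge0 ?mulr_ge0 ?ltW//; nra.
Qed.

Lemma rlker_half1 x : x < 1 -> EulerGamma (1 / 2) * rlker (1 / 2) 1 x = (Num.sqrt (1 - x))^-1.
Proof.
move=> x1; rewrite rlkerE// powR_Nhalf ?subr_gt0//.
have := @Gamma_gt0 R (1 / 2); rewrite (_ : 0 < 1 / 2 :> R); last by lra.
move=> /(_ isT); move: (EulerGamma (1 / 2)) => g g0.
by rewrite mulrCA mulfV ?mulr1// gt_eqF.
Qed.

Lemma rlker_halfN1 s x y : 1 / 2 < s -> -1 <= y -> y < x ->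
  rlker s x y * (Num.sqrt (1 + x))^-1 <=
  EulerGamma (s - 1 / 2) / EulerGamma s * rlker (s - 1 / 2) x y.
Proof.
move=> s12 yN1 yx; rewrite !rlkerE//.
have := @Gamma_gt0 R s; have := @Gamma_gt0 R (s - 1 / 2).
rewrite subr_gt0 s12 (_ : 0 < s); last by lra.
move=> /(_ isT) + /(_ isT); move: (EulerGamma (s - 1 / 2)) (EulerGamma s) => g g' g0 g'0.
have xy : 0 < x - y by rewrite subr_gt0.
have E : (x - y) `^ (s - 1 / 2 - 1) = (x - y) `^ (s - 1) * (Num.sqrt (x - y))^-1.
  rewrite -powR12_sqrt ?ltW// -powRN -powRD ?(gt_eqF xy) ?implybT//.
  by congr (_ `^ _); lra.
rewrite E (_ : g / g' * _ = (x - y) `^ (s - 1) / g' * (Num.sqrt (x - y))^-1).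
  apply: ler_wpM2l; first by rewrite divr_ge0 ?powR_ge0 ?ltW.
  by rewrite lef_pV2 ?posrE ?sqrtr_gt0 ?ler_sqrt; lra.
field; rewrite !gt_eqF// sqrtr_gt0//.
Qed.

Lemma measurable_rlker_l s y : measurable_fun [set: R] (fun x => rlker s x y).
Proof. exact: measurable_rlker. Qed.

Lemma measurable_rlker_r s x : measurable_fun [set: R] (fun y => rlker s x y).
Proof. exact: measurable_rlker. Qed.

Lemma measurable_rlker_chebw n s y :
  measurable_fun (@Omega R) (fun x => rlker s x y * chebw n x).
Proof.
apply: measurable_realfun.measurable_funM; last exact: measurable_chebw.
by apply: measurable_funTS; exact: measurable_rlker_l.
Qed.

Lemma integral_rlker_rlker_Omega a b x y : 0 < a -> 0 < b -> x <= 1 -> -1 <= y ->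
  (\int[mu]_(t in @Omega R) (rlker a x t * rlker b t y)%:E = (rlker (a + b) x y)%:E)%E.
Proof.
move=> a0 b0 x1 yN1; rewrite -integral_rlker_rlker// integral_mkcond.
apply: eq_integral => t _; rewrite patchE; case: ifPn => //; rewrite notin_setE => tO.
have [xt|tx] := leP x t; first by rewrite (rlker0 _ xt) mul0r.
have [ty|yt] := leP t y; first by rewrite (rlker0 _ ty)// mulr0.
by exfalso; apply: tO; apply/OmegaE; rewrite (le_lt_trans yN1)// (lt_le_trans tx).
Qed.

Definition fracheb_bound s : R :=
  (EulerGamma (1 / 2) + EulerGamma (s - 1 / 2) / EulerGamma s) * (2 `^ (s - 1 / 2) / EulerGamma (s + 1 / 2)).

(** The weight behaves like $(1-x)^{-1/2}$ and $(1+x)^{-1/2}$ at the endpoints;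
    the condition s > 1/2 makes the kernel absorb the second singularity. *)
Lemma integral_rlker_chebw0 s y : 1 / 2 < s -> -1 <= y ->
  (\int[mu]_(x in @Omega R) (rlker s x y * chebw 0 x)%:E <= (fracheb_bound s)%:E)%E.
Proof.
move=> s12 yN1; have s0 : 0 < s by lra.
have s20 : 0 < s - 1 / 2 by lra.
have h0 : 0 < 1 / 2 :> R by lra.
have s120 : 0 < s + 1 / 2 by lra.
have G1 := Gamma_gt0 h0; have G2 := Gamma_gt0 s20; have G3 := Gamma_gt0 s0.
have G4 := Gamma_gt0 s120.
pose k : R := EulerGamma (s - 1 / 2) / EulerGamma s.
have k0 : 0 <= k := divr_ge0 (ltW G2) (ltW G3).
pose f1 x := ((rlker (1 / 2) 1 x * rlker s x y)%:E : \bar R).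
pose f2 x := ((rlker 1 1 x * rlker (s - 1 / 2) x y)%:E : \bar R).
have mf1 : measurable_fun (@Omega R) f1.
  apply/measurable_EFinP; apply: measurable_realfun.measurable_funM; apply: measurable_funTS.
    exact: measurable_rlker_r.
  exact: measurable_rlker_l.
have mf2 : measurable_fun (@Omega R) f2.
  apply/measurable_EFinP; apply: measurable_realfun.measurable_funM; apply: measurable_funTS.
    exact: measurable_rlker_r.
  exact: measurable_rlker_l.
have f10 x : (0 <= f1 x)%E by rewrite lee_fin mulr_ge0 ?rlker_ge0.
have f20 x : (0 <= f2 x)%E by rewrite lee_fin mulr_ge0 ?rlker_ge0.
have G1e : (0 <= (EulerGamma (1 / 2) : R)%:E)%E by rewrite lee_fin; exact: (ltW G1).
have k0e : (0 <= k%:E)%E by rewrite lee_fin.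
apply: (@le_trans _ _ (\int[mu]_(x in @Omega R)
   ((EulerGamma (1 / 2))%:E * f1 x + k%:E * f2 x))%E).
  apply: (ge0_le_integral mu measurable_Omega).
  - move=> x xO; rewrite lee_fin mulr_ge0 ?rlker_ge0//.
    exact: le_trans (normr_chebw 0 xO).
  - by apply/measurable_EFinP; exact: measurable_rlker_chebw.
  - by apply: emeasurable_funD; exact: measurable_funeM.
  move=> x xO; have /OmegaE/andP[xN1 x1] := xO.
  rewrite -!EFinM -EFinD lee_fin.
  have [xy|yx] := leP x y; first by rewrite !(rlker0 _ xy) mul0r !mulr0 addr0.
  apply: le_trans (ler_wpM2l (rlker_ge0 _ _ s0) (chebw0_le xO)) _.
  rewrite mulrDr mulrA rlker_half1// [X in _ <= X + _]mulrC lerD2l.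
  by rewrite rlker1 x1 (mul1r (rlker (s - 1 / 2) x y)); exact: rlker_halfN1.
have -> : (\int[mu]_(x in @Omega R) ((EulerGamma (1 / 2))%:E * f1 x + k%:E * f2 x) =
   ((EulerGamma (1 / 2) + k) * rlker (s + 1 / 2) 1 y)%:E)%E.
  rewrite (ge0_integralD mu measurable_Omega).
  - rewrite (ge0_integralZl mu measurable_Omega mf1 (fun x _ => f10 x) G1e).
    rewrite (ge0_integralZl mu measurable_Omega mf2 (fun x _ => f20 x) k0e).
    rewrite !integral_rlker_rlker_Omega// -!EFinM -EFinD; congr (_%:E).
    by rewrite (addrC (1 / 2)) (_ : 1 + (s - 1 / 2) = s + 1 / 2) ?mulrDl//; lra.
  - by move=> x _; rewrite mule_ge0.
  - exact: measurable_funeM.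
  - by move=> x _; rewrite mule_ge0.
  - exact: measurable_funeM.
rewrite lee_fin /fracheb_bound -/k; apply: ler_wpM2l; first exact: (addr_ge0 (ltW G1) k0).
have [y1|y1] := leP 1 y; first by rewrite rlker0//; exact: (divr_ge0 (powR_ge0 _ _) (ltW G4)).
rewrite rlkerE// (_ : s + 1 / 2 - 1 = s - 1 / 2); last by lra.
rewrite ler_wpM2r ?invr_ge0 ?(ltW G4)//.
by apply: ge0_ler_powR; rewrite ?nnegrE; lra.
Qed.

Lemma integrable_rlker_chebw n s y : 1 / 2 < s -> -1 <= y ->
  mu.-integrable (@Omega R) (EFin \o (fun x => rlker s x y * chebw n x)).
Proof.
move=> s12 yN1; have s0 : 0 < s by lra.
apply/integrableP; split; first by apply/measurable_EFinP; exact: measurable_rlker_chebw.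
apply: le_lt_trans (ltry (fracheb_bound s)); apply: le_trans (integral_rlker_chebw0 s12 yN1).
apply: (ge0_le_integral mu measurable_Omega).
- by move=> x _; exact: abse_ge0.
- apply: measurableT_comp => //; apply/measurable_EFinP; exact: measurable_rlker_chebw.
- by apply/measurable_EFinP; exact: measurable_rlker_chebw.
move=> x xO; rewrite /= lee_fin normrM ger0_norm ?rlker_ge0// ler_wpM2l ?rlker_ge0//.
exact: normr_chebw.
Qed.

End FractionalChebyshev.

Section FractionalChebyshevSeries.
Context {R : realType}.
Local Notation mu := (@lebesgue_measure R).
Variables (n : nat) (n0 : (0 < n)%N).
Implicit Types (s x y z : R) (j N : nat).

(** Coefficients of [chebw n] on the kernels [rlker (j + 1/2) 1]. *)
Let A j : R := 2 `^ (- (1 / 2)) * hcoef (n%:R + 1 / 2) (1 / 2 - n%:R) (1 / 2) j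
  / 2 ^+ j * EulerGamma (j%:R + 1 / 2).

Let half_gt0 : 0 < 1 / 2 :> R. Proof. by lra. Qed.

(** Each term is a kernel, so that fractional integration acts termwise by the
    semigroup law. *)
Lemma chebw_series x : Omega x ->
  series (fun j => A j * rlker (j%:R + 1 / 2) 1 x) @ \oo --> chebw n x.
Proof.
move=> xO; have /OmegaE/andP[xN1 x1] := xO; rewrite (chebwE n0 xO).
have z1 : `|(1 - x) / 2| < 1 by rewrite ger0_norm; lra.
have x0 : 0 < 1 - x by lra.
have := @hcvg R (n%:R + 1 / 2) (1 / 2 - n%:R) (1 / 2) _ half_gt0 z1.
set F := hyp2F1 _ _ _ _ => h; set k := _ * _ `^ (1 / 2 - 1).
rewrite (_ : series _ = fun N => k * pseries (hcoef (n%:R + 1 / 2) (1 / 2 - n%:R) (1 / 2)) ((1 - x) / 2) N).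
  exact: cvgMr.
apply/funext => N; rewrite /pseries /series/= mulr_sumr; apply: eq_bigr => j _.
rewrite rlkerE// /A /k.
have -> : (1 - x) `^ (j%:R + 1 / 2 - 1) = (1 - x) `^ (1 / 2 - 1) * (1 - x) ^+ j.
  rewrite -powR_mulrn ?ltW// -powRD ?(gt_eqF x0) ?implybT//; congr (_ `^ _); ring.
have : 0 < EulerGamma (j%:R + 1 / 2) :> R by apply: Gamma_gt0; rewrite ltr_wpDl.
rewrite expr_div_n; have : 0 < 2 ^+ j :> R by rewrite exprn_gt0.
move: (EulerGamma _) (2 ^+ j) (hcoef _ _ _ _) => g p hc p0 g0.
by field; rewrite !gt_eqF.
Qed.

(** From [n] on all new factors are positive; the first [n] are negative. *)
Lemma pochhammer_sign j : (n <= j)%N -> 0 < (-1) ^+ n * pochhammer (1 / 2 - n%:R : R) j.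
Proof.
have base k : (k <= n)%N -> 0 < (-1) ^+ k * pochhammer (1 / 2 - n%:R : R) k.
  elim: k => [|k IH] kn; first by rewrite /pochhammer big_ord0 mul1r.
  rewrite pochhammerS exprS (_ : _ * _ = (-1) ^+ k * pochhammer (1 / 2 - n%:R) k *
    - (1 / 2 - n%:R + k%:R)); last by ring.
  rewrite mulr_gt0 ?IH//; first exact: ltnW.
  have : k%:R + 1 <= n%:R :> R by rewrite natr1 ler_nat.
  by lra.
elim: j => [|j IH]; first by rewrite leqNgt n0.
rewrite leq_eqVlt => /orP[/eqP <-|]; first exact: base.
rewrite ltnS => nj; rewrite pochhammerS mulrA mulr_gt0 ?IH//.
have : n%:R <= j%:R :> R by rewrite ler_nat.
by lra.
Qed.

Let hcoef_sign c j : 0 < c -> (n <= j)%N ->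
  0 <= (-1) ^+ n * hcoef (n%:R + 1 / 2) (1 / 2 - n%:R) c j :> R.
Proof.
move=> c0 nj; rewrite /hcoef.
have p1 : 0 < pochhammer (n%:R + 1 / 2 : R) j by apply: pochhammer_gt0; rewrite ltr_wpDl.
have p2 := pochhammer_sign nj; have p3 : 0 < pochhammer c j := pochhammer_gt0 j c0.
rewrite !mulrA [X in X / _ / _]mulrAC.
apply: mulr_ge0; last by rewrite invr_ge0.
apply: mulr_ge0; last by rewrite invr_ge0 ltW.
exact: mulr_ge0 (ltW p2) (ltW p1).
Qed.

Let A_sign j : (n <= j)%N -> 0 <= (-1) ^+ n * A j.
Proof.
move=> nj; rewrite /A; have := hcoef_sign half_gt0 nj.
have : 0 <= (2 ^+ j)^-1 :> R by rewrite invr_ge0 exprn_ge0.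
have : 0 <= EulerGamma (j%:R + 1 / 2) :> R by apply/ltW/Gamma_gt0; rewrite ltr_wpDl.
have : 0 <= 2 `^ (- (1 / 2)) :> R by exact: powR_ge0.
move: (2 `^ _) (EulerGamma _) (2 ^+ j)^-1 (hcoef _ _ _ _) => t g p h t0 g0 p0 h0.
rewrite [X in 0 <= X](_ : _ = t * ((-1) ^+ n * h) * p * g); last by ring.
by apply: mulr_ge0 => //; apply: mulr_ge0 => //; exact: mulr_ge0.
Qed.

Let S N x : R := \sum_(0 <= j < N) A j * rlker (j%:R + 1 / 2) 1 x.
Let B x : R := \sum_(0 <= j < n) `|A j| * rlker (j%:R + 1 / 2) 1 x.


Let SB N x : (N <= n)%N -> `|S N x| <= B x.
Proof.
move=> Nn; apply: le_trans (ler_norm_sum _ _ _) _.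
rewrite /B (big_cat_nat (leq0n N) Nn)//= -[leLHS]addr0; apply: lerD.
  by apply: ler_sum => j _; rewrite normrM [X in _ * X]ger0_norm ?rlker_ge0.
by apply: sumr_ge0 => j _; rewrite mulr_ge0 ?rlker_ge0.
Qed.

(** All partial sums of the series are dominated, because its terms have a
    constant sign from the n-th one on. *)
Let S_dominated N x : Omega x -> `|S N x| <= chebw 0 x + 2 * B x.
Proof.
move=> xO; have w0 : 0 <= chebw 0 x := le_trans (normr_ge0 _) (normr_chebw 0 xO).
have B0 : 0 <= B x := le_trans (normr_ge0 _) (SB x (leqnn n)).
have [Nn|/ltnW nN] := leqP N n; first by have := SB x Nn; lra.
pose e : R := (-1) ^+ n.
have en : `|e| = 1 by rewrite normrX normrN1 expr1n.
pose T M := \sum_(n <= j < M) (e * A j) * rlker (j%:R + 1 / 2) 1 x.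
have TE M : (n <= M)%N -> T M = e * (S M x - S n x).
  move=> nM; rewrite /S (big_cat_nat (leq0n n) nM)//= [_ + _ - _]addrAC subrr add0r mulr_sumr.
  by apply: eq_bigr => j _; rewrite mulrA.
have T0 M : 0 <= T M.
  rewrite /T big_nat_cond; apply: sumr_ge0 => j /andP[/andP[nj _] _].
  by rewrite mulr_ge0 ?rlker_ge0// A_sign.
have Tle : T N <= e * (chebw n x - S n x).
  have cT : e * (S M x - S n x) @[M --> \oo] --> e * (chebw n x - S n x).
    by apply: cvgMr; apply: cvgB; [exact: chebw_series|exact: cvg_cst].
  rewrite -(cvg_lim (@Rhausdorff R) cT); apply: limr_ge; first exact: (cvgP _ cT).
  near=> M; have NM : (N <= M)%N by near: M; exact: nbhs_infty_ge.
  rewrite -TE ?(leq_trans nN)// /T (big_cat_nat nN NM)/= lerDl.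
  rewrite big_nat_cond; apply: sumr_ge0 => j /andP[/andP[Nj _] _].
  by rewrite mulr_ge0 ?rlker_ge0// A_sign// (leq_trans nN).
have H1 : `|T N| = `|S N x - S n x| by rewrite TE// normrM en mul1r.
have H2 : T N <= `|chebw n x - S n x|.
  by apply: le_trans Tle _; rewrite -[leRHS]mul1r -en -normrM ler_norm.
have := normr_chebw n xO; have := SB x (leqnn n).
have := ler_normB (chebw n x) (S n x); have := ler_normD (S N x - S n x) (S n x).
rewrite subrK; move: H1; rewrite ger0_norm//; lra.
Unshelve. all: by end_near. Qed.

Lemma fracheb_series s y : 1 / 2 < s -> -1 <= y ->
  series (fun j => A j * rlker (j%:R + 1 / 2 + s) 1 y) @ \oo --> fracheb n s y.
Proof.
move=> s12 yN1; have s0 : 0 < s by lra.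
have mO := @measurable_Omega R.
have mr a : measurable_fun (@Omega R) (rlker a 1).
  by apply: measurable_funTS; exact: measurable_rlker_r.
have ml : measurable_fun (@Omega R) (fun x => rlker s x y).
  by apply: measurable_funTS; exact: measurable_rlker_l.
have it (c : R) j : mu.-integrable (@Omega R)
    (fun x => (c * (rlker (j%:R + 1 / 2) 1 x * rlker s x y))%:E).
  have := @integrableZl _ _ _ mu _ mO c
    (fun x => (rlker (j%:R + 1 / 2) 1 x * rlker s x y)%:E).
  apply; apply/integrableP; split.
    by apply/measurable_EFinP; apply: measurable_realfun.measurable_funM; [exact: mr|exact: ml].
  under eq_integral => x _ do rewrite gee0_abs ?lee_fin ?mulr_ge0 ?rlker_ge0//.
  by rewrite integral_rlker_rlker_Omega// ltry.
pose f_ N x := (rlker s x y * S N x)%:E.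
pose g x := (rlker s x y * (chebw 0 x + 2 * B x))%:E.
have iS (a : nat -> R) N : mu.-integrable (@Omega R) (fun x =>
    (rlker s x y * \sum_(0 <= j < N) a j * rlker (j%:R + 1 / 2) 1 x)%:E).
  rewrite (_ : (fun x => _) = fun x => (\sum_(0 <= j < N)
    (a j * (rlker (j%:R + 1 / 2) 1 x * rlker s x y))%:E)%E).
    by apply: integrable_sum => // j _; exact: it.
  apply/funext => x; rewrite sumEFin mulr_sumr; congr (_%:E).
  by apply: eq_bigr => j _; ring.
have ig : mu.-integrable (@Omega R) g.
  rewrite (_ : g = (fun x => (rlker s x y * chebw 0 x)%:E) \+
     (fun x => 2%:E * (rlker s x y * B x)%:E))%E.
    apply: integrableD => //; first exact: integrable_rlker_chebw.
    by apply: integrableZl => //; exact: iS.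
  by apply/funext => x; rewrite /g -EFinM -EFinD; congr (_%:E); ring.
have : (\int[mu]_(x in @Omega R) f_ N x)%E @[N --> \oo] -->
    (\int[mu]_(x in @Omega R) (rlker s x y * chebw n x)%:E)%E.
  have D := @dominated_convergence _ _ R mu _ mO f_
    (fun x => (rlker s x y * chebw n x)%:E) g.
  apply D.
  - by move=> N; exact: (measurable_int mu (iS A N)).
  - by apply/measurable_EFinP; exact: measurable_rlker_chebw.
  - apply: aeW => x xO; apply: cvg_EFin; first exact: nearW.
    by apply: cvgMr; exact: chebw_series.
  - exact: ig.
  - apply: aeW => x N xO; rewrite /f_ /g lee_fin normrM ger0_norm ?rlker_ge0//.
    by rewrite ler_wpM2l ?rlker_ge0// S_dominated.
have E N : (\int[mu]_(x in @Omega R) f_ N x = (\sum_(0 <= j < N) A j * rlker (j%:R + 1 / 2 + s) 1 y)%:E)%E.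
  transitivity (\int[mu]_(x in @Omega R) (\sum_(0 <= j < N)
    (A j * (rlker (j%:R + 1 / 2) 1 x * rlker s x y))%:E))%E.
    apply: eq_integral => x _; rewrite /f_ /S sumEFin mulr_sumr; congr (_%:E).
    by apply: eq_bigr => j _; ring.
  rewrite integral_sum//.
  rewrite -sumEFin; apply: eq_bigr => j _.
  have i1 : mu.-integrable (@Omega R) (fun x => (rlker (j%:R + 1 / 2) 1 x * rlker s x y)%:E).
    by apply: eq_integrable (it 1 j) => // x _; rewrite mul1r.
  transitivity ((A j)%:E * \int[mu]_(x in @Omega R) (rlker (j%:R + 1 / 2) 1 x * rlker s x y)%:E)%E.
    by rewrite -integralZl.
  by rewrite integral_rlker_rlker_Omega.
have -> : (\int[mu]_(x in @Omega R) (rlker s x y * chebw n x)%:E = (fracheb n s y)%:E)%E.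
  rewrite /fracheb /Rintegral fineK//; apply: integrable_fin_num => //.
  exact: integrable_rlker_chebw.
under eq_fun do rewrite E.
by move/fine_cvgP => [_].
Qed.

Let scale s y : R := 2 `^ (- (1 / 2)) * Num.sqrt pi * (1 - y) `^ (s - 1 / 2) / EulerGamma (s + 1 / 2).
Let H s := hcoef (n%:R + 1 / 2) (1 / 2 - n%:R) (s + 1 / 2).

Let scale_neq0 s y : 1 / 2 < s -> y < 1 -> scale s y != 0.
Proof.
move=> s12 y1; have g0 : 0 < EulerGamma (s + 1 / 2) by apply: Gamma_gt0; lra.
rewrite gt_eqF// /scale divr_gt0// mulr_gt0 ?powR_gt0 ?subr_gt0// mulr_gt0 ?powR_gt0//.
by rewrite sqrtr_gt0 pi_gt0.
Qed.

Lemma fracheb_hcoef s y : 1 / 2 < s -> -1 <= y < 1 ->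
  pseries (H s) ((1 - y) / 2) @ \oo --> fracheb n s y / scale s y.
Proof.
move=> s12 /andP[yN1 y1]; have k0 := scale_neq0 s12 y1.
have y0 : 0 < 1 - y by lra.
have s0 : 0 < s + 1 / 2 by lra.
rewrite (_ : pseries _ _ = fun N => (scale s y)^-1 *
    series (fun j => A j * rlker (j%:R + 1 / 2 + s) 1 y) N).
  by rewrite [X in _ --> X]mulrC; apply: cvgMr; exact: fracheb_series.
apply/funext => N; rewrite /pseries /series/= mulr_sumr; apply: eq_bigr => j _.
rewrite rlkerE// /A /H /hcoef [j%:R + 1 / 2]addrC Gamma_natD// Gamma_half.
rewrite (_ : 1 / 2 + j%:R + s = s + 1 / 2 + j%:R); last by ring.
rewrite (Gamma_natD j s0) (_ : s + 1 / 2 + j%:R - 1 = s - 1 / 2 + j%:R); last by lra.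
have -> : (1 - y) `^ (s - 1 / 2 + j%:R) = (1 - y) `^ (s - 1 / 2) * (1 - y) ^+ j.
  by rewrite -powR_mulrn ?ltW// -powRD// (gt_eqF y0) implybT.
move: k0; rewrite /scale.
have := pochhammer_gt0 j s0; have := @pochhammer_gt0 R (1 / 2) j half_gt0.
have := Gamma_gt0 s0; have : 0 < (1 - y) `^ (s - 1 / 2) by rewrite powR_gt0.
have : 0 < Num.sqrt pi :> R by rewrite sqrtr_gt0 pi_gt0.
have : 0 < 2 `^ (- (1 / 2)) :> R by rewrite powR_gt0.
have : 0 < 2 ^+ j :> R by rewrite exprn_gt0.
have : 0 < j`!%:R :> R by rewrite ltr0n fact_gt0.
rewrite expr_div_n.
move: (2 `^ _) (Num.sqrt pi) ((1 - y) `^ _) (EulerGamma _) (2 ^+ j) (j`!%:R) ((1 - y) ^+ j).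
move: (@pochhammer R (1 / 2) j) (pochhammer (s + 1 / 2) j) (@pochhammer R _ j) (@pochhammer R _ j).
move=> p1 p2 p3 p4 t q w g d f v f0 d0 t0 q0 w0 g0 p10 p20 _.
by field; rewrite !gt_eqF.
Qed.

Lemma frachebE s y : 1 / 2 < s -> -1 <= y < 1 -> fracheb n s y =
  scale s y * hyp2F1 (n%:R + 1 / 2) (1 / 2 - n%:R) (s + 1 / 2) ((1 - y) / 2).
Proof.
move=> s12 yI; have h := fracheb_hcoef s12 yI.
rewrite hyp2F1E (cvg_lim (@Rhausdorff R) h) mulrC divfK//.
by apply: scale_neq0 => //; have /andP[] := yI.
Qed.

(** The boundary value at -1: Abel's limit theorem for a power series whose
    coefficients have a constant sign from some index on. *)
Lemma cvg_pseries_at1 s : 1 / 2 < s ->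
  hyp2F1 (n%:R + 1 / 2) (1 / 2 - n%:R) (s + 1 / 2) z @[z --> (1 : R)^'-] -->
  hyp2F1 (n%:R + 1 / 2) (1 / 2 - n%:R) (s + 1 / 2) (1 : R).
Proof.
move=> s12; have c0 : 0 < s + 1 / 2 by lra.
set F := hyp2F1 _ _ _; pose e : R := (-1) ^+ n.
have ee : e * e = 1 by rewrite -expr2 -exprM mulnC exprM sqrrN expr1n expr1n.
have en : `|e| = 1 by rewrite normrX normrN1 expr1n.
have cF z : 0 <= z <= 1 -> pseries (H s) z @ \oo --> F z.
  move=> /andP[z0]; rewrite le_eqVlt => /predU1P[->|z1]; last first.
    by apply: hcvg => //; rewrite ger0_norm.
  have yI : -1 <= (-1 : R) < 1 by apply/andP; split; lra.
  have := fracheb_hcoef s12 yI; rewrite (_ : (1 - -1) / 2 = 1 :> R); last by field.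
  by move=> h; rewrite /F hyp2F1E (cvg_lim (@Rhausdorff R) h).
have Hs j : (n <= j)%N -> 0 <= e * H s j by move=> nj; exact: hcoef_sign.
pose T M z := e * (F z - pseries (H s) z M).
have Tle M z : (n <= M)%N -> 0 <= z <= 1 -> 0 <= T M z <= T M 1.
  move=> nM zI; have /andP[z0 z1] := zI.
  have oneI : 0 <= (1 : R) <= 1 by apply/andP; split; lra.
  have cT x : 0 <= x <= 1 -> e * (pseries (H s) x N - pseries (H s) x M) @[N --> \oo] --> T M x.
    by move=> xI; apply: cvgMr; apply: cvgB; [exact: cF|exact: cvg_cst].
  have E N x : (M <= N)%N -> e * (pseries (H s) x N - pseries (H s) x M) =
      \sum_(M <= j < N) (e * H s j) * x ^+ j.
    move=> MN; rewrite /pseries /series/= (big_cat_nat (leq0n M) MN)/= [_ + _ - _]addrAC subrr add0r.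
    by rewrite mulr_sumr; apply: eq_bigr => j _; rewrite mulrA.
  apply/andP; split.
    rewrite -(cvg_lim (@Rhausdorff R) (cT z zI)); apply: limr_ge; first exact: cvgP (cT z zI).
    near=> N; have MN : (M <= N)%N by near: N; exact: nbhs_infty_ge.
    rewrite E// big_nat_cond; apply: sumr_ge0 => j /andP[/andP[Mj _] _].
    by rewrite mulr_ge0 ?exprn_ge0// Hs// (leq_trans nM).
  apply: (ler_cvg_to (cT z zI) (cT 1 oneI)).
  near=> N; have MN : (M <= N)%N by near: N; exact: nbhs_infty_ge.
  rewrite !E//; apply: ler_sum_nat => j /andP[Mj _].
  by rewrite expr1n ler_wpM2l ?Hs ?(leq_trans nM)// exprn_ile1.
apply/cvgrPdist_lt => eps eps0.
have [M nM TM] : exists2 M, (n <= M)%N & `|T M 1| < eps / 3.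
  have e3 : 0 < eps / 3 by lra.
  have oneI : 0 <= (1 : R) <= 1 by apply/andP; split; lra.
  have /cvgrPdist_lt/(_ _ e3)[M0 _ h] := cF 1 oneI.
  exists (maxn n M0); first exact: leq_maxl.
  by rewrite /T normrM en mul1r; apply: h => /=; exact: leq_maxr.
have cP k : pseries (H s) z k @[z --> (1 : R)^'-] --> pseries (H s) 1 k.
  elim: k => [|k IH].
    rewrite (_ : (fun z => _) = cst (pseries (H s) 1 0)); first exact: cvg_cst.
    by apply/funext => z; rewrite /pseries /series/= !big_geq.
  rewrite (_ : (fun z => _) = fun z => pseries (H s) z k + H s k * z ^+ k); last first.
    by apply/funext => z; rewrite /pseries /series/= big_nat_recr.
  rewrite (_ : pseries (H s) 1 k.+1 = pseries (H s) 1 k + H s k * 1 ^+ k); last first.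
    by rewrite /pseries /series/= big_nat_recr.
  apply: cvgD; first exact: IH.
  apply: cvgMr; apply: cvg_at_left_filter; exact: exprn_continuous.
have e3 : 0 < eps / 3 by lra.
have /cvgrPdist_lt/(_ _ e3) h := cP M.
near=> z.
have zI : 0 <= z <= 1.
  apply/andP; split; first by near: z; apply: nbhs_left_ge; lra.
  by apply/ltW; near: z; exact: nbhs_left_lt.
have hz : `|pseries (H s) 1 M - pseries (H s) z M| < eps / 3 by near: z.
have /andP[Tz0 Tz1] := Tle M z nM zI.
have T1 : T M 1 < eps / 3 by exact: le_lt_trans (ler_norm _) TM.
have E x : F x = pseries (H s) x M + e * T M x by rewrite /T mulrA ee mul1r; ring.
rewrite !E (_ : _ - _ = (pseries (H s) 1 M - pseries (H s) z M) + e * (T M 1 - T M z)); last by ring.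
apply: le_lt_trans (ler_normD _ _) _; rewrite normrM en mul1r.
have : `|T M 1 - T M z| <= eps / 3 by rewrite ler_norml; lra.
lra.
Unshelve. all: by end_near. Qed.

(** This is where the boundary term of the final formula gets its value. *)
Lemma cvg_fracheb_N1 s : 1 / 2 < s ->
  fracheb n s y @[y --> (-1 : R)^'+] --> fracheb n s (-1).
Proof.
move=> s12; apply/cvg_at_rightP => u [uN1 cu].
have u1 : \forall k \near \oo, u k < 1.
  by apply: (cvgr_lt (-1 : R)) => //; lra.
have yI : -1 <= (-1 : R) < 1 by apply/andP; split; lra.
rewrite (frachebE s12 yI) (_ : (1 - -1) / 2 = 1 :> R); last by field.
have h : scale s (u k) * hyp2F1 (n%:R + 1 / 2) (1 / 2 - n%:R) (s + 1 / 2) ((1 - u k) / 2)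
    @[k --> \oo] --> scale s (-1) * hyp2F1 (n%:R + 1 / 2) (1 / 2 - n%:R) (s + 1 / 2) 1.
  apply: cvgM.
    rewrite /scale; apply: cvgMl; apply: cvgMr.
    have c1 : 1 - u k @[k --> \oo] --> (1 - -1 : R) by apply: cvgB => //; exact: cvg_cst.
    have c2 : {for (1 - -1 : R), continuous (@powR R ^~ (s - 1 / 2))}.
      by apply: is_derive_continuous; apply: is_derive1_powR; lra.
    exact: (cvg_comp _ _ c1 c2).
  have /cvg_at_leftP := cvg_pseries_at1 s12.
  move=> /(_ (fun k => (1 - u k) / 2)); apply; split.
    by move=> k; have := uN1 k; lra.
  rewrite [X in _ --> X](_ : (1 : R) = (1 - -1) / 2); last by field.
  by apply: cvgMl; apply: cvgB => //; exact: cvg_cst.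
apply: cvg_trans h; apply: near_eq_cvg; near=> k.
rewrite frachebE//; apply/andP; split; first exact/ltW/uN1.
by near: k.
Unshelve. all: by end_near. Qed.

(** Up to the constant, the fractional integral is the weighted Gegenbauer
    function: the two series are related by Euler's transformation. *)
Lemma fracheb_rG s y : 1 / 2 < s -> Omega y ->
  2 / pi * fracheb n s y = Csigma s * (rG s (n%:R - s) y * omega s y).
Proof.
move=> s12 yO; have /OmegaE/andP[yN1 y1] := yO.
have yI : -1 <= y < 1 by rewrite ltW.
have zI : 0 <= (1 - y) / 2 < 1 by lra.
have c12 : 1 / 2 < s + 1 / 2 by lra.
rewrite (frachebE s12 yI) (hyp2F1_Euler _ _ c12 zI) /scale /Csigma /rG /omega.
have -> : Gamma (s + 1 / 2) = EulerGamma (s + 1 / 2) by rewrite EulerGamma.unlock.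
have -> : s + 1 / 2 - (n%:R + 1 / 2) = - (n%:R - s) by ring.
have -> : s + 1 / 2 - (1 / 2 - n%:R) = n%:R - s + 2 * s by ring.
have -> : - (n%:R - s) - (1 / 2 - n%:R) = s - 1 / 2 by ring.
set F := hyp2F1 _ _ _ _.
have -> : 1 - y ^+ 2 = (1 - y) * (1 - (1 - y) / 2) * 2 by field.
rewrite !powRM; try lra; last by apply: mulr_ge0; lra.
have -> : (2 : R) `^ (- (1 / 2)) = 2 `^ (s - 1 / 2) / (2 * 2 `^ (s - 1)).
  have t0 : 0 < 2 :> R by [].
  have -> : (2 : R) `^ (s - 1 / 2) = 2 `^ (- (1 / 2)) * 2 `^ 1 * 2 `^ (s - 1).
    by rewrite -!powRD ?(gt_eqF t0) ?implybT//; congr (_ `^ _); lra.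
  rewrite powRr1; last exact: ltW.
  by rewrite -[_ * 2 * _]mulrA mulfK// mulf_neq0// gt_eqF// powR_gt0.
have g0 : 0 < EulerGamma (s + 1 / 2) by apply: Gamma_gt0; lra.
have pi0 : 0 < Num.sqrt pi :> R by rewrite sqrtr_gt0 pi_gt0.
have -> : pi = Num.sqrt pi ^+ 2 :> R by rewrite sqr_sqrtr// pi_ge0.
have : 0 < 2 `^ (s - 1) :> R by rewrite powR_gt0.
rewrite [Num.sqrt (_ ^+ 2)]sqrtr_sqr (gtr0_norm pi0).
move: (Num.sqrt pi) (EulerGamma _) (2 `^ (s - 1)) (2 `^ _) pi0 g0 => p g q r p0 g0 q0.
by field; rewrite !gt_eqF.
Qed.

End FractionalChebyshevSeries.

(** * Almost everywhere arguments on the interval *)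

Section NonMeasurable.
Local Open Scope ereal_scope.
Context d (T : measurableType d) (R : realType) (m : {measure set T -> \bar R}).
Implicit Types f g : T -> \bar R.
Import HBNNSimple.

(** The integral of a nonnegative function, measurable or not, is the supremum of
    the integrals of the simple functions below it, and cutting a simple function
    off on a negligible set keeps its integral.  This is needed because a
    derivative that exists almost everywhere is only known to agree almost
    everywhere with a measurable function. *)
Lemma ge0_ae_le_integral f g : (forall x, 0 <= f x) -> (forall x, 0 <= g x) ->
  {ae m, forall x, f x <= g x} -> \int[m]_x f x <= \int[m]_x g x.
Proof.
move=> f0 g0 [N [mN N0 fgN]]; rewrite !ge0_integralTE//.
apply: ge_ereal_sup => _ [h hf <-].
pose k : {nnsfun T >-> R} := proj_nnsfun h (measurableC mN).
have -> : sintegral m h = sintegral m k.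
  rewrite -!integralT_nnsfun; apply: ge0_ae_eq_integral => //.
  - by apply/measurable_EFinP; exact: measurable_funPT.
  - by apply/measurable_EFinP; exact: measurable_funPT.
  - by move=> x _; rewrite lee_fin.
  - by move=> x _; rewrite lee_fin.
  exists N; split => // x /= kh; apply: contrapT => xN; apply: kh => _.
  by rewrite mindicE mem_set// mulr1.
apply: ereal_sup_ubound; exists k => // x /=; rewrite mindicE.
have [xN|xN] := pselect (N x).
  by rewrite memNset ?mulr0//=; apply.
rewrite mem_set// mulr1; apply: le_trans (hf x) _.
by apply: contrapT => fg; apply: xN; apply: fgN.
Qed.

Lemma ae_eq_integral_any (D : set T) f g :
  {ae m, forall x, D x -> f x = g x} -> \int[m]_(x in D) f x = \int[m]_(x in D) g x.
Proof.
move=> fg; rewrite integral_mkcond [RHS]integral_mkcond.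
have {}fg : {ae m, forall x, (f \_ D) x = (g \_ D) x}.
  apply: filterS fg => x fgx; rewrite !patchE.
  by case: ifPn => // /set_mem; exact: fgx.
rewrite integralE [RHS]integralE; congr (_ - _); apply/eqP; rewrite eq_le.
  by apply/andP; split; apply: ge0_ae_le_integral => //; apply: filterS fg => x fgx;
    rewrite !funeposE fgx.
by apply/andP; split; apply: ge0_ae_le_integral => //; apply: filterS fg => x fgx;
  rewrite !funenegE fgx.
Qed.

Lemma ae_eq_Rintegral_any (D : set T) (f g : T -> R) :
  {ae m, forall x, D x -> f x = g x} ->
  (\int[m]_(x in D) f x)%R = (\int[m]_(x in D) g x)%R.
Proof.
move=> fg; congr fine; apply: ae_eq_integral_any.
by apply: filterS fg => x fgx Dx; rewrite fgx.
Qed.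

End NonMeasurable.

#[export] Instance ae_filter_lebesgue (R : realType) :
  Filter (almost_everywhere (@lebesgue_measure R)).
Proof. exact: ae_filter_ringOfSetsType. Qed.

Section Primitive.
Context {R : realType}.
Local Notation mu := (@lebesgue_measure R).
Implicit Types (f : R -> R) (x : R).

Lemma rlker1_primitive f x : mu.-integrable (@Omega R) (EFin \o f) -> x < 1 ->
  \int[mu]_(t in @Omega R) (rlker 1 x t * f t) = \int[mu]_(t in `]-1, x]) (f \_ (@Omega R)) t.
Proof.
move=> fi x1; have sub : `]-1, x[ `<=` @Omega R.
  by move=> t/=; rewrite in_itv/= => /andP[tN1 tx]; apply/OmegaE; rewrite tN1 (lt_trans tx).
rewrite -Rintegral_itv_bndo_bndc; last first.
  apply: (@eq_integrable _ _ _ mu _ _ (EFin \o f)) => //.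
    by move=> t /set_mem tx /=; rewrite patchE mem_set//; exact: sub.
  by apply: (integrableS (@measurable_Omega R) _ sub fi).
rewrite /Rintegral integral_mkcond [in RHS]integral_mkcond; congr fine.
apply: eq_integral => t _; rewrite !patchE rlker1 /=.
have [/set_mem tO|/negP tO] := boolP (t \in @Omega R); last first.
  by rewrite memNset// => tx; apply: tO; apply/mem_set; exact: sub.
have /OmegaE/andP[tN1 t1] := tO; case: ltP => tx.
  by rewrite mem_set ?mul1r ?patchE ?mem_set//= in_itv/= tN1.
by rewrite memNset ?mul0r//= in_itv/= tN1/= ltNge tx.
Qed.

(** Lebesgue's differentiation theorem, with the primitive written as a potential
    of order 1. *)
Lemma ae_derive_primitive f : mu.-integrable (@Omega R) (EFin \o f) ->
  {ae mu, forall x, Omega x ->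
    is_derive x 1 (fun z => \int[mu]_(t in @Omega R) (rlker 1 z t * f t)) (f x)}.
Proof.
move=> fi; have mO := @measurable_Omega R.
have H := lebesgue_differentiation (integrable_locally_restrict mO fi).
apply: filterS H => x lx xO; have /OmegaE/andP[xN1 x1] := xO.
have fi1 : mu.-integrable `]-1, 1] (EFin \o f \_ (@Omega R)).
  apply: (@integrableS _ _ _ mu setT) => //.
  by rewrite -restrict_EFin; apply/integrable_restrict; rewrite ?setTI.
have [|dF FE] := @FTC1_lebesgue_pt _ _ (BRight (-1)) x 1 x1 fi1 _ lx.
  exact: xN1.
have near_x : \forall z \near x, \int[mu]_(t in @Omega R) (rlker 1 z t * f t) =
    \int[mu]_(t in `]-1, z]) (f \_ (@Omega R)) t.
  near=> z; apply: rlker1_primitive => //; near: z; exact: lt_nbhsl.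
have := DeriveDef dF erefl; rewrite -derive1E FE patchE mem_set// => h.
by apply: near_eq_is_derive h; near=> z; apply: esym; near: z.
Unshelve. all: by end_near. Qed.

Lemma ae_eq0_primitive f : mu.-integrable (@Omega R) (EFin \o f) ->
  (forall x, Omega x -> \int[mu]_(t in @Omega R) (rlker 1 x t * f t) = 0) ->
  {ae mu, forall x, Omega x -> f x = 0}.
Proof.
move=> fi F0; apply: filterS (ae_derive_primitive fi) => x dF xO.
have /OmegaE/andP[xN1 x1] := xO; have [_ <-] := dF xO.
have h : \forall z \near x, \int[mu]_(t in @Omega R) (rlker 1 z t * f t) = cst 0 z.
  near=> z; apply: F0; apply/OmegaE; apply/andP; split.
    by near: z; exact: lt_nbhsr.
  by near: z; exact: lt_nbhsl.
by rewrite (near_eq_derive _ h)// derive_cst.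
Unshelve. all: by end_near. Qed.

End Primitive.

(** * Duality for Riemann-Liouville potentials *)

Section Duality.
Context {R : realType}.
Local Notation mu := (@lebesgue_measure R).
Implicit Types (a b c s t x y : R) (f g phi Phi : R -> R) (L : (R -> R) -> R).

(** A functional [L] is thought of as integration against a signed measure on
    [-1,1), and [L (rlker a t)] as its potential of order [a].  The property is
    Fubini's theorem for the kernels; only the values of [phi] on [-1,1)
    count. *)
Definition duality L : Prop := forall a Phi phi C, 0 < a ->
  measurable_fun (@Omega R) Phi ->
  (forall y, -1 <= y < 1 ->
    (\int[mu]_(t in @Omega R) (`|Phi t| * rlker a t y)%:E <= C%:E)%E) ->
  (forall y, -1 <= y < 1 -> phi y = \int[mu]_(t in @Omega R) (Phi t * rlker a t y)) ->
  mu.-integrable (@Omega R) (EFin \o (fun t => Phi t * L (rlker a t))) /\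
  \int[mu]_(t in @Omega R) (Phi t * L (rlker a t)) = L phi.

Lemma dualityD L1 L2 : duality L1 -> duality L2 -> duality (fun phi => L1 phi + L2 phi).
Proof.
move=> d1 d2 a Phi phi C a0 mP bP phiE.
have [i1 <-] := d1 a Phi phi C a0 mP bP phiE; have [i2 <-] := d2 a Phi phi C a0 mP bP phiE.
have E t : Phi t * (L1 (rlker a t) + L2 (rlker a t)) =
  Phi t * L1 (rlker a t) + Phi t * L2 (rlker a t) by rewrite mulrDr.
split; last by under eq_Rintegral => t _ do rewrite E; rewrite (RintegralD (@measurable_Omega R) i1 i2).
rewrite (_ : _ \o _ = fun t => ((Phi t * L1 (rlker a t))%:E +
  (Phi t * L2 (rlker a t))%:E)%E); first exact: (integrableD (@measurable_Omega R) i1 i2).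
by apply/funext => t /=; rewrite E EFinD.
Qed.

Lemma dualityZ c L : duality L -> duality (fun phi => c * L phi).
Proof.
move=> d a Phi phi C a0 mP bP phiE; have [i <-] := d a Phi phi C a0 mP bP phiE.
have E t : Phi t * (c * L (rlker a t)) = c * (Phi t * L (rlker a t)) by rewrite mulrCA.
split; last by under eq_Rintegral => t _ do rewrite E; rewrite (RintegralZl c (@measurable_Omega R) i).
rewrite (_ : _ \o _ = fun t => (c%:E * (Phi t * L (rlker a t))%:E)%E).
  exact: (integrableZl (@measurable_Omega R) c i).
by apply/funext => t /=; rewrite E EFinM.
Qed.

Lemma dualityN L : duality L -> duality (fun phi => - L phi).
Proof. by move=> /(@dualityZ (-1)); under eq_fun do rewrite mulN1r. Qed.

Lemma measurable_weighted_rlker a Phi y : measurable_fun (@Omega R) Phi ->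
  measurable_fun (@Omega R) (fun t => Phi t * rlker a t y).
Proof.
move=> mP; apply: measurable_realfun.measurable_funM => //.
by apply: measurable_funTS; exact: measurable_rlker_l.
Qed.

Lemma integrable_weighted_rlker a Phi y C : 0 < a -> measurable_fun (@Omega R) Phi ->
  (\int[mu]_(t in @Omega R) (`|Phi t| * rlker a t y)%:E <= C%:E)%E ->
  mu.-integrable (@Omega R) (EFin \o (fun t => Phi t * rlker a t y)).
Proof.
move=> a0 mP bP; apply/integrableP; split.
  by apply/measurable_EFinP; exact: measurable_weighted_rlker.
apply: le_lt_trans (ltry C); apply: le_trans bP.
rewrite le_eqVlt; apply/orP; left; apply/eqP; apply: eq_integral => t _ /=.
by rewrite normrM [X in _ * X]ger0_norm// rlker_ge0.
Qed.

Lemma duality_dirac y : -1 <= y < 1 -> duality (fun phi => phi y).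
Proof.
move=> yI a Phi phi C a0 mP bP phiE; split; last by rewrite phiE.
exact: integrable_weighted_rlker (bP y yI).
Qed.

Section Measure.
Variables (d : measure_display) (T : measurableType d).
Variables (m : {sigma_finite_measure set T -> \bar R}).
Variables (D : set T) (mD : measurable D).
Variables (h : T -> R) (mh : measurable_fun [set: T] h).
Variables (hD : forall z, D z -> -1 <= h z < 1).
Variables (g : T -> R) (gi : m.-integrable D (EFin \o g)).

Let gD : T -> R := g \_ D.

Let mgD : measurable_fun [set: T] gD.
Proof.
apply/(measurable_restrictT g mD); have := measurable_int m gi.
by move/measurable_EFinP.
Qed.

Let pot a t : R := \int[m]_(z in D) (rlker a t (h z) * g z).

Let potE a t : pot a t = fine (\int[m]_z (rlker a t (h z) * gD z)%:E)%E.
Proof.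
rewrite /pot /Rintegral integral_mkcond; congr fine; apply: eq_integral => z _.
by rewrite /gD !patchE; case: ifP => // _; rewrite mulr0.
Qed.

Let measurable_pot a : measurable_fun [set: measurableTypeR R] (pot a).
Proof.
pose k (p : measurableTypeR R * T) := (rlker a p.1 (h p.2) * gD p.2)%:E.
have mk : measurable_fun setT k.
  apply/measurable_EFinP; apply: measurable_realfun.measurable_funM.
    by apply: measurable_rlker; [exact: measurable_fst|exact: (measurableT_comp mh measurable_snd)].
  exact: (measurableT_comp mgD measurable_snd).
rewrite (_ : pot a = fun t => fine (\int[m]_z k (t, z))%E); last first.
  by apply/funext => t; rewrite potE.
apply: (measurableT_comp (fine_measurable measurableT)).
rewrite (_ : (fun t => _) = (fun t => \int[m]_z k^\+ (t, z)) \- (fun t => \int[m]_z k^\- (t, z)))%E.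
  apply: emeasurable_funB.
    apply: (@measurable_fun_fubini_tonelli_F _ _ _ _ _ m (k^\+)%E) => //.
    exact: measurable_funepos.
  apply: (@measurable_fun_fubini_tonelli_F _ _ _ _ _ m (k^\-)%E) => //.
  exact: measurable_funeneg.
apply/funext => t; rewrite integralE; congr (_ - _)%E; apply: eq_integral => z _.
  by rewrite !funeposE.
by rewrite !funenegE.
Qed.

(** Fubini's theorem on the product of the Lebesgue measure and [m]: the bound on
    the potentials makes the kernel integrable.  The map [h] serves to push [m]
    forward, in particular to reflect it. *)
Lemma duality_measure : duality (fun phi => \int[m]_(z in D) (phi (h z) * g z)).
Proof.
move=> a Phi phi C a0 mP bP phiE.
have mO := @measurable_Omega R.
pose P : R -> R := Phi \_ (@Omega R).
have mPO : measurable_fun [set: measurableTypeR R] P by apply/(measurable_restrictT Phi mO).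
pose H (p : measurableTypeR R * T) := (P p.1 * rlker a p.1 (h p.2) * gD p.2)%:E.
have mH : measurable_fun setT H.
  apply/measurable_EFinP; apply: measurable_realfun.measurable_funM.
    apply: measurable_realfun.measurable_funM.
      exact: (measurableT_comp mPO measurable_fst).
    by apply: measurable_rlker; [exact: measurable_fst|exact: (measurableT_comp mh measurable_snd)].
  exact: (measurableT_comp mgD measurable_snd).
have iPk z : D z -> mu.-integrable (@Omega R) (EFin \o (fun t => Phi t * rlker a t (h z))).
  by move=> /hD zI; apply: integrable_weighted_rlker (bP (h z) zI).
have GE z : (\int[mu]_t H (t, z) = ((fun z => (phi (h z) * g z)%:E) \_ D) z)%E.
  rewrite patchE; case: ifPn => [/set_mem zD|zD]; last first.
    by apply: integral0_eq => t _; rewrite /H /= /gD patchE (negbTE zD) mulr0.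
  have -> : (phi (h z) * g z)%:E = (\int[mu]_(t in @Omega R) (Phi t * rlker a t (h z))%:E * (g z)%:E)%E.
    rewrite phiE ?hD// EFinM /Rintegral fineK//.
    by apply: integrable_fin_num => //; exact: iPk.
  rewrite muleC -integralZl//; last exact: iPk.
  rewrite [RHS]integral_mkcond; apply: eq_integral => t _; rewrite /H /= /gD /P !patchE.
  by rewrite (mem_set zD); case: ifP => _; rewrite ?mul0r// -EFinM mulrC.
have iH : (mu \x m)%E.-integrable setT H.
  apply/(integrable21ltyP _ _ mH).
  apply: (@le_lt_trans _ _ (\int[m]_(z in D) (C%:E * `|(g z)%:E|))%E).
    rewrite [leRHS]integral_mkcond; apply: ge0_le_integral => //.
    - by move=> z _; apply: integral_ge0.
    - apply: (@measurable_fun_fubini_tonelli_G _ _ _ _ _ mu (abse \o H)).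
        exact: measurableT_comp.
      by move=> p; exact: abse_ge0.
    - apply: (measurable_restrictT (fun z => C%:E * `|(g z)%:E|)%E mD).1; apply: measurable_funeM.
      apply: measurableT_comp => //; exact: (measurable_int m gi).
    move=> z _; rewrite patchE; case: ifPn => [/set_mem zD|zD]; last first.
      by rewrite integral0_eq// => t _; rewrite /H /= /gD patchE (negbTE zD) mulr0 normr0.
    rewrite muleC; apply: le_trans (lee_wpmul2l (abse_ge0 _) (bP (h z) (hD zD))).
    rewrite -(ge0_integralZl mu mO).
    - rewrite [leRHS]integral_mkcond le_eqVlt; apply/orP; left; apply/eqP.
      apply: eq_integral => t _; rewrite /H /= /gD /P !patchE (mem_set zD).
      case: ifP => _; last by rewrite !mul0r normr0.
      by rewrite !normrM (ger0_norm (rlker_ge0 _ _ a0)) -EFinM mulrC.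
    - apply/measurable_EFinP; apply: measurable_weighted_rlker.
      exact: measurableT_comp.
    - by move=> t _; rewrite lee_fin mulr_ge0 ?rlker_ge0.
    - exact: abse_ge0.
  have iC : m.-integrable D (fun z => C%:E * `|(g z)%:E|)%E.
    by apply: integrableZl => //; exact: integrable_abse.
  by rewrite -(fineK (integrable_fin_num mD iC)) ltry.
pose F t := (\int[m]_z H (t, z))%E.
have iF : mu.-integrable setT F := integrable_fubini_F iH.
have FE : {ae mu, forall t, Omega t -> (Phi t * pot a t)%:E = F t}.
  apply: filterS (ae_integrable1 iH) => t iHt tO; rewrite /F.
  have HE z : H (t, z) = ((Phi t)%:E * (rlker a t (h z) * gD z)%:E)%E.
    by rewrite /H /= /P patchE (mem_set tO) -EFinM mulrA.
  under eq_integral do rewrite HE.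
  have [->|P0] := eqVneq (Phi t) 0.
    by rewrite mul0r integral0_eq// => z _; rewrite mul0e.
  have ik : m.-integrable setT (fun z => (rlker a t (h z) * gD z)%:E).
    have := integrableZl measurableT (Phi t)^-1 iHt.
    apply: eq_integrable => // z _; rewrite HE -!EFinM mulrA mulVf// mul1r//.
  rewrite integralZl// EFinM potE fineK//; exact: integrable_fin_num.
have F0 t : ~ Omega t -> F t = 0%E.
  move=> tO; apply: integral0_eq => z _; rewrite /H /= /P patchE memNset//.
  by rewrite !mul0r.
have mPp : measurable_fun (@Omega R) (fun t => Phi t * pot a t).
  apply: measurable_realfun.measurable_funM => //.
  by apply: measurable_funTS; exact: measurable_pot.
have iFO := integrableS measurableT mO (@subsetT _ _) iF.
have E : (\int[mu]_(t in @Omega R) (Phi t * pot a t)%:E = \int[mu]_t F t)%E.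
  rewrite (ae_eq_integral_any FE) integral_mkcond; apply: eq_integral => t _.
  by rewrite patchE; case: ifPn => // /negP tO; rewrite F0// => tO'; apply: tO; exact: mem_set.
split.
  apply/integrableP; split; first by apply/measurable_EFinP.
  rewrite (_ : (\int[mu]_(x in _) _)%E = (\int[mu]_(t in @Omega R) `|F t|)%E).
    by have /integrableP[_] := iFO.
  by apply: ae_eq_integral_any; apply: filterS FE => t FEt tO; rewrite /= -FEt.
rewrite /Rintegral E /F (Fubini iH); congr fine; rewrite [RHS]integral_mkcond.
by apply: eq_integral => z _; rewrite GE.
Qed.

End Measure.
End Duality.

Section Abel.
Context {R : realType}.
Local Notation mu := (@lebesgue_measure R).
Implicit Types (a b c s t x y : R) (f g u phi : R -> R) (L : (R -> R) -> R).

Lemma rlker_le a x y : 1 <= a -> x <= 1 -> -1 <= y ->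
  rlker a x y <= 2 `^ (a - 1) / EulerGamma a.
Proof.
move=> a1 x1 yN1; have a0 : 0 < a by lra.
have G0 := Gamma_gt0 a0.
have [xy|yx] := leP x y.
  by rewrite rlker0//; apply: divr_ge0; [exact: powR_ge0|exact: ltW].
rewrite rlkerE// ler_wpM2r ?invr_ge0 ?(ltW G0)//.
by apply: ge0_ler_powR; rewrite ?nnegrE; lra.
Qed.

(** Composition of potentials: the semigroup law of the kernels, transported by
    duality. *)
Lemma duality_rlker L a b x : duality L -> 0 < a -> 0 < b -> 1 <= b + a -> x <= 1 ->
  mu.-integrable (@Omega R) (EFin \o (fun t => rlker b x t * L (rlker a t))) /\
  \int[mu]_(t in @Omega R) (rlker b x t * L (rlker a t)) = L (rlker (b + a) x).
Proof.
move=> dL a0 b0 ab1 x1; have k_ge0 t := rlker_ge0 x t b0.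
apply: (dL a _ _ (2 `^ (b + a - 1) / EulerGamma (b + a)) a0).
- by apply: measurable_funTS; exact: measurable_rlker_r.
- move=> y /andP[yN1 y1]; under eq_integral do rewrite (ger0_norm (k_ge0 _)).
  by rewrite integral_rlker_rlker_Omega// lee_fin rlker_le.
by move=> y /andP[yN1 y1]; rewrite /Rintegral integral_rlker_rlker_Omega.
Qed.

Lemma rlker11 t : t < 1 -> rlker 1 1 t = 1 :> R.
Proof. by move=> t1; rewrite rlker1 t1. Qed.

Lemma integrable_potential L a : duality L -> 0 < a ->
  mu.-integrable (@Omega R) (EFin \o (fun t => L (rlker a t))).
Proof.
move=> dL a0; have ab1 : 1 <= 1 + a by lra.
have [i _] := duality_rlker dL a0 ltr01 ab1 (lexx (1 : R)).
apply: eq_integrable i => //; first exact: measurable_Omega.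
by move=> t /set_mem/OmegaE/andP[_ t1]; rewrite /= rlker11// mul1r.
Qed.

Lemma duality_fun f : mu.-integrable (@Omega R) (EFin \o f) ->
  duality (fun phi => \int[mu]_(y in @Omega R) (phi y * f y)).
Proof.
move=> fi; have OI y : Omega y -> -1 <= y < 1.
  by move=> /OmegaE/andP[yN1 y1]; rewrite ltW.
exact: (duality_measure (@measurable_Omega R) (h := idfun) (@measurable_id _ _ _) OI fi).
Qed.

Lemma integrable_rlker1 x f : mu.-integrable (@Omega R) (EFin \o f) ->
  mu.-integrable (@Omega R) (EFin \o (fun t => rlker 1 x t * f t)).
Proof.
move=> fi; apply: (le_integrable (@measurable_Omega R) _ _ fi).
  apply/measurable_EFinP; apply: measurable_realfun.measurable_funM.
    by apply: measurable_funTS; exact: measurable_rlker_r.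
  by have /measurable_EFinP := measurable_int mu fi.
move=> t _; rewrite /= lee_fin normrM rlker1.
by case: (t < x); rewrite ?normr1 ?mul1r// normr0 mul0r.
Qed.

(** Abel's integral equation: applying the potential of order [s] to both sides
    turns the hypothesis into the equality of two primitives. *)
Lemma Abel_inversion s f L : 0 < s -> s < 1 -> duality L ->
  mu.-integrable (@Omega R) (EFin \o f) ->
  {ae mu, forall x, Omega x ->
    \int[mu]_(y in @Omega R) (rlker (1 - s) x y * f y) = L (rlker 1 x)} ->
  {ae mu, forall x, Omega x -> f x = L (rlker s x)}.
Proof.
move=> s0 s1 dL fi fL; have mO := @measurable_Omega R.
have s'0 : 0 < 1 - s by lra.
have ip := integrable_potential dL s0.
have i0 : mu.-integrable (@Omega R) (EFin \o (fun t => f t - L (rlker s t))).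
  by have := integrableB mO fi ip.
have F0 x : Omega x -> \int[mu]_(t in @Omega R) (rlker 1 x t * (f t - L (rlker s t))) = 0.
  move=> /OmegaE/andP[xN1 /ltW x1].
  have e1 : s + (1 - s) = 1 by ring.
  have [] := duality_rlker (duality_fun fi) s'0 s0 _ x1; first by rewrite e1.
  rewrite e1 => _.
  rewrite (@ae_eq_Rintegral_any _ _ _ mu _ _ (fun t => rlker s x t * L (rlker 1 t))); last first.
    by apply: filterS fL => t + tO => /(_ tO) ->.
  have [|_ ->] := duality_rlker dL ltr01 s0 _ x1; first by lra.
  rewrite addrC => E.
  have [|j1 E1] := duality_rlker dL s0 ltr01 _ x1; first by lra.
  have j2 := integrable_rlker1 x fi.
  under eq_Rintegral do rewrite mulrBr.
  by rewrite (RintegralB mO j2 j1) E1 -E subrr.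
by apply: filterS (ae_eq0_primitive i0 F0) => x h xO; apply/subr0_eq/h.
Qed.

(** The constants of integration are left free: they form a polynomial of degree
    less than [m], which is orthogonal to the Chebyshev polynomials in question. *)
Fixpoint iterated_primitive (m : nat) u f : Prop :=
  if m is m'.+1 then exists u1 c, [/\ mu.-integrable (@Omega R) (EFin \o u1),
    {ae mu, forall x, Omega x -> u x = c + \int[mu]_(t in @Omega R) (rlker 1 x t * u1 t)} &
    iterated_primitive m' u1 f]
  else {ae mu, forall x, Omega x -> u x = f x}.

Lemma Rintegral_lincomb (F : nat -> R -> R) (c : nat -> R) (k : nat) :
  (forall i, (i < k)%N -> mu.-integrable (@Omega R) (EFin \o F i)) ->
  mu.-integrable (@Omega R) (EFin \o (fun t => \sum_(i < k) c i * F i t)) /\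
  \int[mu]_(t in @Omega R) (\sum_(i < k) c i * F i t) =
    \sum_(i < k) c i * \int[mu]_(t in @Omega R) F i t.
Proof.
have mO := @measurable_Omega R.
elim: k => [_|k IH iF].
  split; last by under eq_Rintegral do rewrite big_ord0; rewrite big_ord0 /Rintegral integral0.
  by apply: eq_integrable (integrable0 mu _) => // t _; rewrite /= big_ord0.
have [|i1 E1] := IH; first by move=> i ik; apply: iF; rewrite ltnS ltnW.
have i2 : mu.-integrable (@Omega R) (EFin \o (fun t => c k * F k t)).
  have := integrableZl mO (c k) (iF k (ltnSn k)).
  by apply: eq_integrable => // t _; rewrite /= EFinM.
split.
  have := integrableD mO i1 i2.
  by apply: eq_integrable => // t _; rewrite /= big_ord_recr.
under eq_Rintegral do rewrite big_ord_recr/=.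
rewrite (RintegralD mO i1 i2) E1 big_ord_recr/=; congr (_ + _).
by rewrite (RintegralZl _ mO (iF k (ltnSn k))).
Qed.

Lemma iterated_primitive_potential m s u f L : 0 < s -> duality L ->
  {ae mu, forall x, Omega x -> f x = L (rlker s x)} -> iterated_primitive m u f ->
  exists c : nat -> R, {ae mu, forall x, Omega x ->
    u x = \sum_(i < m) c i * rlker (i%:R + 1) x (-1) + L (rlker (m%:R + s) x)}.
Proof.
move=> s0 dL fL; elim: m u => [u uf|m IH u [u1 [c [u1i uE /IH[c1 u1E]]]]].
  exists (fun=> 0); apply: filterS2 uf fL => x uf fL xO.
  by rewrite big_ord0 !add0r uf// fL.
(* One more integration raises every order by 1; the new constant is the
   coefficient of the potential of order 1. *)
exists (fun i => if i is j.+1 then c1 j else c); apply: filterS uE => x uE xO.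
have NI : -1 <= (-1 : R) < 1 by apply/andP; split; lra.
have dN := duality_dirac NI.
have /OmegaE/andP[xN1 /ltW x1] := xO.
have ij (i : nat) : 0 < i%:R + 1 :> R by rewrite ltr_wpDl.
have h (i : nat) := @duality_rlker _ (i%:R + 1) 1 x dN (ij i) ltr01.
have m0 : 0 < m%:R + s by rewrite ltr_wpDl.
have [|j1 E1] := duality_rlker dL m0 ltr01 _ x1; first by lra.
pose F (i : nat) t := rlker 1 x t * rlker (i%:R + 1) t (-1).
have ge1 (i : nat) : 1 <= 1 + (i%:R + 1) :> R by rewrite lerDl ltW.
have [|j2 E2] := @Rintegral_lincomb F c1 m.
  by move=> i _; have [] := h i (ge1 i) x1.
rewrite uE// big_ord_recl/= add0r rlker1 xN1 mulr1 -addrA; congr (_ + _).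
rewrite (@ae_eq_Rintegral_any _ _ _ mu _ _
  (fun t => \sum_(i < m) c1 i * F i t + rlker 1 x t * L (rlker (m%:R + s) t))); last first.
  apply: filterS u1E => t + tO => /(_ tO) ->; rewrite mulrDr mulr_sumr; congr (_ + _).
  by apply: eq_bigr => i _; rewrite mulrCA.
rewrite (RintegralD (@measurable_Omega R) j2 j1) E1 E2; congr (_ + L (rlker _ x)); last first.
  by rewrite -natr1; ring.
apply: eq_bigr => i _; congr (_ * _); have [_ ->] := h i (ge1 i) x1.
by rewrite /bump leq0n add1n -natr1 addrC.
Qed.

(** The Chebyshev polynomial is orthogonal to polynomials of lower degree, so
    only the potential contributes, and duality moves it onto [chebw n]. *)
Lemma integral_chebw_potential n m s u f L : (m < n)%N -> 0 < s -> 1 / 2 < m%:R + s ->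
  duality L -> {ae mu, forall x, Omega x -> f x = L (rlker s x)} ->
  iterated_primitive m u f ->
  \int[mu]_(x in @Omega R) (u x * chebw n x) = L (fracheb n (m%:R + s)).
Proof.
move=> mn s0 ms12 dL fL /(iterated_primitive_potential s0 dL fL)[c uE].
have mO := @measurable_Omega R; set a := m%:R + s.
have a0 : 0 < a by rewrite /a; lra.
have NI : -1 <= (-1 : R) < 1 by apply/andP; split; lra.
have [|||i1 E1] := @dL a (chebw n) (fracheb n a) (fracheb_bound a) a0.
- exact: measurable_chebw.
- move=> y /andP[yN1 y1]; apply: le_trans (integral_rlker_chebw0 ms12 yN1).
  apply: (ge0_le_integral mu mO).
  + by move=> t _; rewrite lee_fin mulr_ge0 ?rlker_ge0.
  + apply/measurable_EFinP; apply: measurable_weighted_rlker.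
    apply: measurableT_comp => //; exact: measurable_chebw.
  + by apply/measurable_EFinP; exact: measurable_rlker_chebw.
  by move=> t tO; rewrite lee_fin mulrC ler_wpM2l ?rlker_ge0 ?normr_chebw.
- by move=> y _; rewrite /fracheb; under eq_Rintegral do rewrite mulrC.
have ij (i : nat) : 1 / 2 < i%:R + 1 :> R.
  by apply: (@lt_le_trans _ _ 1); [lra|rewrite lerDr].
have [|i2 E2] := @Rintegral_lincomb (fun i x => rlker (i%:R + 1) x (-1) * chebw n x) c m.
  by move=> i _; apply: integrable_rlker_chebw.
rewrite (@ae_eq_Rintegral_any _ _ _ mu _ _ (fun x =>
  \sum_(i < m) c i * (rlker (i%:R + 1) x (-1) * chebw n x) + chebw n x * L (rlker a x))); last first.
  apply: filterS uE => x + xO => /(_ xO) ->; rewrite mulrDl mulr_suml [L _ * _]mulrC; congr (_ + _).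
  by apply: eq_bigr => i _; rewrite mulrA.
rewrite (RintegralD mO i2 i1) E1 E2 big1 ?add0r// => i _.
have G0 : 0 < EulerGamma (i%:R + 1) :> R by apply: Gamma_gt0; have := ij i; lra.
have im : mu.-integrable (@Omega R) (EFin \o (fun x => (1 + x) ^+ i * chebw n x)).
  exact: integrable_moment_chebw.
rewrite (_ : Rintegral _ _ _ = (EulerGamma (i%:R + 1))^-1 *
  \int[mu]_(x in @Omega R) ((1 + x) ^+ i * chebw n x)); last first.
  rewrite -(RintegralZl _ mO im); apply: eq_Rintegral => x /set_mem/OmegaE/andP[xN1 _].
  rewrite rlkerE// addrK opprK powR_mulrn; last by lra.
  by rewrite [x + 1]addrC mulrA [_ / _]mulrC.
by rewrite /Rintegral moment_chebw ?mulr0// (ltn_trans _ mn).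
Qed.

End Abel.

(** * Absolute continuity *)

Section SeparatedIntervals.
Context {R : realType}.
Implicit Types (p q : R * R) (y z : seq (R * R)) (f g : R -> R) (s : seq R).

(** An interval is coded by the pair of its right and left endpoints, in this
    order, as in [variation_zip]. *)
Definition ordered_itv p := p.2 <= p.1.

Definition apart p q := (p.1 <= q.2) || (q.1 <= p.2).

Definition nonoverlapping z := all ordered_itv z && pairwise apart z.

Definition inside (a b : R) z := all (fun p => (a <= p.2) && (p.1 <= b)) z.

Definition total_length z : R := \sum_(p <- z) (p.1 - p.2).

Lemma apartC p q : apart p q = apart q p.
Proof. by rewrite /apart orbC. Qed.

Lemma path_lt_le a s : path <%R a s -> a <= last a s.
Proof.
elim: s a => //= x s IH a /andP[ax xs]; exact: le_trans (ltW ax) (IH _ xs).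
Qed.

Lemma zip_partition a b s : itv_partition a b s ->
  let z := zip s (a :: s) in
  [/\ nonoverlapping z, inside a b z & total_length z = b - a].
Proof.
elim: s a => [|x s IH] a /=.
  by move=> [_ /eqP <-]; rewrite /nonoverlapping /inside/= /total_length big_nil subrr.
move=> /[dup] /itv_partition_cons/IH /= [/andP[os ss] ins ls] [/= /andP[ax xs] /eqP sb].
have xb : x <= b by rewrite -sb; exact: path_lt_le.
rewrite /nonoverlapping /inside /total_length/= big_cons; split.
- rewrite os ss /ordered_itv/= ltW//= !andbT.
  by apply: sub_all ins => p /andP[xp _]; rewrite /apart/= xp.
- rewrite lexx xb/=; apply: sub_all ins => p /andP[xp ->].
  by rewrite (le_trans (ltW ax)).
move: ls; rewrite /total_length => ->. by rewrite addrC subrKA.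
Qed.

Lemma nonoverlapping_refine p y z : nonoverlapping (p :: z) -> nonoverlapping y ->
  inside p.2 p.1 y -> nonoverlapping (z ++ y).
Proof.
move=> /andP[/= /andP[op oz] /andP[pz sz]] /andP[oy sy] iy.
rewrite /nonoverlapping all_cat oz oy pairwise_cat sz sy !andbT/=.
apply/allrelP => q r qz ry; have /allP/(_ _ qz) := pz; have /allP/(_ _ ry)/andP[] := iy.
by rewrite /apart; lra.
Qed.

Lemma total_lengthD y z : total_length (y ++ z) = total_length y + total_length z.
Proof. by rewrite /total_length big_cat. Qed.

(** If every admissible family has small oscillation sum, then the sums of the
    total variations are small too: the total variation of one interval is a
    supremum over partitions, and a partition turns the family into another
    admissible one. *)
Lemma sum_total_variation_le (a b : R) f (eps delta : R) :
  (forall z, nonoverlapping z -> inside a b z -> total_length z < delta ->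
    \sum_(p <- z) `|f p.1 - f p.2| <= eps) ->
  forall z, nonoverlapping z -> inside a b z -> total_length z < delta ->
    (\sum_(p <- z) total_variation p.2 p.1 f <= eps%:E)%E.
Proof.
move=> H z; have K y : nonoverlapping (z ++ y) -> inside a b (z ++ y) ->
    total_length (z ++ y) < delta ->
    (\sum_(p <- z) total_variation p.2 p.1 f + (\sum_(p <- y) `|f p.1 - f p.2|)%:E <= eps%:E)%E.
  elim: z y => [|p z IH] y zs zi zl; first by rewrite big_nil add0e lee_fin H.
  have /andP[/andP[op _] _] := zs.
  set T := (\sum_(q <- z) total_variation q.2 q.1 f)%E.
  set S := \sum_(q <- y) `|f q.1 - f q.2|.
  have T0 : (0 <= T)%E.
    rewrite /T big_seq; apply: sume_ge0 => q qz; apply: total_variation_ge0.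
    by have /andP[/allP/(_ q)] := zs; rewrite inE mem_cat qz orbT => /(_ isT).
  have step s : itv_partition p.2 p.1 s -> (T + (S + variation p.2 p.1 f s)%:E <= eps%:E)%E.
    move=> sp; have [ss si sl] := zip_partition sp.
    rewrite (variation_zip _ sp) /S -big_cat/=; apply: IH; rewrite catA.
    - exact: nonoverlapping_refine zs ss si.
    - move: zi; rewrite /inside/= !all_cat => /andP[/andP[pa pb] ->]/=.
      by apply: sub_all si => q; lra.
    - move: zl; rewrite /= total_lengthD sl /total_length big_cons; lra.
  have [t Tt] : exists t : R, T = t%:E.
    have [s ps] : exists s, itv_partition p.2 p.1 s.
      have [e|ne] := eqVneq p.2 p.1; first by exists [::]; rewrite e; split => /=.
      by exists [:: p.1]; apply: itv_partition1; rewrite lt_neqAle ne.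
    exists (fine T); rewrite fineK// ge0_fin_numE//.
    apply: (@le_lt_trans _ _ eps%:E); last exact: ltry.
    apply: le_trans (step _ ps); rewrite leeDl// lee_fin addr_ge0 ?variation_ge0//.
    by apply: sumr_ge0.
  rewrite big_cons -/T Tt -addeA -EFinD.
  have : (total_variation p.2 p.1 f <= (eps - (t + S))%:E)%E.
    apply: ge_ereal_sup => _ [_ [s ps <-] <-]; have := step _ ps.
    by rewrite Tt -EFinD !lee_fin; lra.
  by move=> /(leeD2r (t + S)%:E) /le_trans -> //; rewrite -EFinD lee_fin; lra.
move=> zs zi zl; have := K [::]; rewrite cats0 big_nil adde0; exact.
Qed.

Lemma nonoverlapping_abs_continuous f : abs_continuous (-1) 1 f ->
  forall eps : R, 0 < eps -> exists2 delta : R, 0 < delta &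
    forall z, nonoverlapping z -> inside (-1) 1 z -> total_length z < delta ->
      \sum_(p <- z) `|f p.1 - f p.2| <= eps.
Proof.
move=> acf eps /acf[delta d0 H]; exists delta => // z /andP[oz sz] iz lz.
pose l (i : 'I_(size z)) := (nth (0, 0) z i).2; pose r (i : 'I_(size z)) := (nth (0, 0) z i).1.
rewrite (big_nth (0, 0)) big_mkord; apply/ltW/(H _ l r).
- move=> i; have zi : nth (0, 0) z i \in z by exact: mem_nth.
  have /allP/(_ _ zi)/andP[h1 h2] := iz; have /allP/(_ _ zi) h3 := oz.
  by split.
- move=> i j _ _ [x [/=]]; rewrite !in_itv/= => /andP[li ri] /andP[lj rj].
  apply/val_inj/eqP; rewrite -[_ == _]negbK; apply/negP => ij.
  have : apart (nth (0, 0) z i) (nth (0, 0) z j).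
    move/(pairwiseP (0, 0)): sz => sz; move: ij; rewrite neq_ltn => /orP[ij|ji].
      exact: sz (ltn_ord i) (ltn_ord j) ij.
    by rewrite apartC; exact: sz (ltn_ord j) (ltn_ord i) ji.
  by rewrite /apart -/(l i) -/(l j) -/(r i) -/(r j) leNgt (lt_trans lj ri) leNgt (lt_trans li rj).
- by move: lz; rewrite /total_length (big_nth (0, 0)) big_mkord.
Qed.

End SeparatedIntervals.

Section AbsolutelyContinuousMonotone.
Context {R : realType}.
Local Notation mu := (@lebesgue_measure R).
Implicit Types (f F psi : R -> R) (x y : R) (z : seq (R * R)).

Lemma cumulativeP F : nondecreasing F -> right_continuous F ->
  exists P : cumulative R R, P = F :> (R -> R).
Proof.
move=> nd rc.
by exists (HB.pack_for (cumulative R R) F (isCumulative.Build R _ R F nd rc)).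
Qed.

Lemma Stieltjes_itvoc (P : cumulative R R) x y : x <= y ->
  lebesgue_stieltjes_measure P (`]x, y]%classic : set R) = (P y - P x)%:E.
Proof.
move=> xy; rewrite /lebesgue_stieltjes_measure/= /measure_extension/=.
rewrite measurable_mu_extE/=; first by rewrite wlength_itv_bnd.
exact: is_ocitv.
Qed.

Lemma Stieltjes_Omega_lty (P : cumulative R R) :
  (lebesgue_stieltjes_measure P (@Omega R) < +oo)%E.
Proof.
apply: (@le_lt_trans _ _ (lebesgue_stieltjes_measure P `]-1, 1])); last first.
  by rewrite Stieltjes_itvoc ?ltry//; lra.
apply: le_measure; rewrite ?inE; [exact: measurable_Omega|exact: measurable_itv|].
by move=> x /OmegaE/andP[xN1 x1]; rewrite /= in_itv/= xN1 ltW.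
Qed.

(** Absolute continuity of a nondecreasing function.  It is required on the whole
    line because Stieltjes measures are built from functions on the line;
    functions on [-1,1] are extended by constants. *)
Definition ac_growth F := forall eps : R, 0 < eps -> exists2 delta : R, 0 < delta &
  forall z, nonoverlapping z -> total_length z < delta -> \sum_(p <- z) (F p.1 - F p.2) <= eps.

Lemma ac_growth_right_continuous F : nondecreasing F -> ac_growth F -> right_continuous F.
Proof.
move=> nd ac x; apply/cvgrPdist_lt => eps eps0.
have /ac[delta d0 H] : 0 < eps / 2 by lra.
near=> y.
have xy : x < y by near: y; exact: nbhs_right_gt.
have yd : y < x + delta by near: y; apply: nbhs_right_lt; rewrite ltrDl.
rewrite distrC ger0_norm ?subr_ge0 ?nd ?ltW//.
have := H [:: (y, x)]; rewrite /nonoverlapping /total_length /ordered_itv/= !big_seq1/=.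
rewrite (ltW xy) => /(_ isT).
have dy : y - x < delta by lra.
by move=> /(_ dy); lra.
Unshelve. all: by end_near. Qed.

Lemma open_interval_itvoo (I : set R) : open I -> is_interval I -> I `<=` @Omega R ->
  exists p, [/\ p.2 <= p.1, I = `]p.2, p.1[%classic & I !=set0 -> p.2 < p.1].
Proof.
move=> oI iI IO; have [I0|/set0P In] := eqVneq I set0.
  by exists (0, 0); split => //=; rewrite I0 ?set_itvoo0//; case.
have bI : has_lbound I by exists (-1) => x /IO/OmegaE/andP[/ltW].
have uI : has_ubound I by exists 1 => x /IO/OmegaE/andP[_ /ltW].
have E : I = `]inf I, sup I[%classic.
  by rewrite -interval_bounded_interior// (interior_id I).1.
have lt : inf I < sup I.
  by have [x] := In; rewrite {1}E /= in_itv/= => /andP[]; exact: lt_trans.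
by exists (sup I, inf I); split => //=; exact: ltW.
Qed.

(** A set of measure 0 has an open neighbourhood of small measure, which is a
    disjoint union of intervals of small total length; absolute continuity bounds
    the growth along any finitely many of them. *)
Lemma ac_growth_dominates (P : cumulative R R) (A : set R) : ac_growth P ->
  measurable (A : set (measurableTypeR R)) -> mu A = 0%E ->
  lebesgue_stieltjes_measure P (A `&` @Omega R) = 0%E.
Proof.
move=> ac mA A0; pose nu : {measure set (measurableTypeR R) -> \bar R} := lebesgue_stieltjes_measure P.
change (nu (A `&` @Omega R) = 0%E); have mO := @measurable_Omega R.
apply/eqP; rewrite eq_le measure_ge0 andbT; apply/lee_addgt0Pr => eps eps0; rewrite add0e.
have [delta d0 H] := ac eps eps0.
have Aoo : (mu A < +oo)%E by rewrite A0 ltry.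
have [U [oU AU Ud]] := lebesgue_regularity_outer mA Aoo d0.
pose V := U `&` @Omega R.
have oV : open V by apply: openI => //; exact: interval_open.
have mV : measurable (V : set (measurableTypeR R)) by exact: open_measurable.
have Vd : (mu V < delta%:E)%E.
  have mU : measurable (U : set (measurableTypeR R)) by exact: open_measurable.
  apply: (@le_lt_trans _ _ (mu U)); first by apply: le_measure; rewrite ?inE//; exact: subIsetl.
  have mUA : measurable (U `\` A : set (measurableTypeR R)) by exact: measurableD.
  apply: (@le_lt_trans _ _ (mu (U `\` A) + 0)%E); last by rewrite adde0; exact: Ud.
  rewrite -[X in (_ <= _ + X)%E]A0 -[X in (mu X <= _)%E](setDKU AU).
  exact: measureU2.
apply: (@le_trans _ _ (nu V)).
  apply: le_measure; rewrite ?inE//; first exact: measurableI.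
  exact: setSI.
pose I := open_disjoint_itv oV.
have IO k : I k `<=` @Omega R.
  move=> x Ix; have [//] : V x.
  by rewrite (open_disjoint_itv_bigcup oV); exists k.
have mI k : measurable (I k : set (measurableTypeR R)).
  by apply: open_measurable; exact: open_disjoint_itv_open.
have tI : trivIset setT I := @open_disjoint_itv_trivIset _ _ oV.
have /choice[p pE] k := open_interval_itvoo (@open_disjoint_itv_open _ _ oV k)
  (@open_disjoint_itv_is_interval _ _ oV k) (IO k).
have E : nu V = (\sum_(0 <= k <oo) nu (I k))%E.
  by rewrite [in LHS](open_disjoint_itv_bigcup oV) measure_semi_bigcup//; exact: bigcup_measurable.
rewrite E; apply: lime_le; first exact: is_cvg_nneseries.
apply: nearW => N.
pose s := [seq k <- iota 0 N | `[< I k !=set0 >]].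
pose z := [seq p k | k <- s].
have us : uniq s by apply: filter_uniq; exact: iota_uniq.
have sI k : k \in s -> (p k).2 < (p k).1.
  by rewrite mem_filter => /andP[/asboolP Ik _]; have [_ _] := pE k; exact.
have sum_s (m : {measure set (measurableTypeR R) -> \bar R}) :
    (\sum_(0 <= k < N) m (I k) = \sum_(k <- s) m (I k))%E.
  rewrite /s big_filter [RHS]big_mkcond /index_iota subn0; apply: eq_bigr => k _.
  by case: asboolP => // /set0P/negP; rewrite negbK => /eqP ->; rewrite measure0.
have IE k : I k = `](p k).2, (p k).1[%classic by case: (pE k).
have muI k : mu (I k) = ((p k).1 - (p k).2)%:E.
  have [le_p _ _] := pE k.
  rewrite IE; apply: (eq_trans (lebesgue_measure_itv _)); rewrite /= lte_fin; case: ltP => // h.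
  by rewrite (le_anti (y := (p k).1) (x := (p k).2)) ?subrr// le_p h.
have nuI k : (nu (I k) <= (P (p k).1 - P (p k).2)%:E)%E.
  have [le_p _ _] := pE k.
  rewrite -Stieltjes_itvoc//; apply: le_measure; rewrite ?inE//.
  by rewrite IE; apply: subset_itvl; rewrite bnd_simp.
have zs : nonoverlapping z.
  rewrite /nonoverlapping; apply/andP; split.
    by apply/allP => _ /mapP[k ks ->]; have [] := pE k.
  rewrite pairwise_map; move: us; rewrite uniq_pairwise.
  apply: (@sub_in_pairwise _ (mem s)); last exact/allP.
  move=> i j si sj ij /=; rewrite /apart; apply: contraT; rewrite negb_or -!ltNge => /andP[h1 h2].
  (* Two overlapping intervals would have this point in common. *)
  pose x := (Num.max (p i).2 (p j).2 + Num.min (p i).1 (p j).1) / 2.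
  have pi := sI i si; have pj := sI j sj.
  have /= : i = j.
    apply: (tI i j) => //; exists x; rewrite !IE /= !in_itv/= /x.
    by case: (leP (p i).2 (p j).2); case: (leP (p i).1 (p j).1) => *;
      split; apply/andP; split; lra.
  by move: ij => /= /[swap] ->; rewrite eqxx.
have zd : total_length z < delta.
  rewrite -lte_fin; apply: le_lt_trans Vd; rewrite /total_length big_map -sumEFin.
  under eq_bigr do rewrite -muI.
  rewrite -sum_s [in leRHS](open_disjoint_itv_bigcup oV) measure_semi_bigcup//; last first.
    exact: bigcup_measurable.
  exact: nneseries_lim_ge.
rewrite sum_s; have := H z zs zd; rewrite -lee_fin; apply: le_trans.
by rewrite /z big_map -sumEFin; apply: lee_sum => k _; exact: nuI.
Qed.

(** The integrand is the Radon-Nikodym density of the Stieltjes measure. *)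
Lemma ac_growth_primitive F : nondecreasing F -> ac_growth F ->
  exists2 psi : R -> R, mu.-integrable (@Omega R) (EFin \o psi) &
    forall x, Omega x -> F x = F (-1) + \int[mu]_(t in @Omega R) (rlker 1 x t * psi t).
Proof.
move=> nd ac; have [P PF] := cumulativeP nd (ac_growth_right_continuous nd ac).
pose nu : {finite_measure set (measurableTypeR R) -> \bar R} :=
  mfrestr (@measurable_Omega R) (Stieltjes_Omega_lty P).
have numu : nu `<< mu.
  apply/null_content_dominatesP => A mA A0; apply: ac_growth_dominates => //.
  by rewrite PF.
have [f [f0 ffin fi fE]] := radon_nikodym_sigma_finite numu.
have fineE t : (fine (f t))%:E = f t by rewrite fineK.
have psii : mu.-integrable (@Omega R) (EFin \o (fine \o f)).
  rewrite (_ : EFin \o _ = f); first exact: integrableS measurableT (@measurable_Omega R) _ fi.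
  by apply/funext => t /=.
exists (fine \o f) => // x /OmegaE/andP[xN1 x1]; rewrite -PF rlker1_primitive//.
have sub : (`]-1, x]%classic : set R) `<=` @Omega R.
  by move=> t /=; rewrite in_itv/= => /andP[tN1 tx]; apply/OmegaE; rewrite tN1 (le_lt_trans tx).
have mI : measurable (`]-1, x]%classic : set (measurableTypeR R)) by exact: measurable_itv.
have := fE _ mI; rewrite /nu /= /mfrestr /mrestr (setIidl sub) => E.
have {E} := etrans (esym (Stieltjes_itvoc P (ltW xN1))) E => E.
rewrite /Rintegral (_ : (\int[mu]_(t in _) _)%E = (P x - P (-1))%:E) /=; first by ring.
rewrite E; apply: eq_integral => t /set_mem tI; rewrite patchE mem_set//=.
exact: sub.
Qed.

End AbsolutelyContinuousMonotone.

Section AbsolutelyContinuousPrimitive.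
Context {R : realType}.
Local Notation mu := (@lebesgue_measure R).
Implicit Types (f v psi : R -> R) (x y : R) (z : seq (R * R)).

Definition clamp x : R := Num.max (-1) (Num.min x 1).

Lemma clampI x : -1 <= clamp x <= 1.
Proof. by rewrite /clamp le_max ge_max ge_min !lexx orbT/= andbT; lra. Qed.

Lemma clamp_id x : -1 <= x <= 1 -> clamp x = x.
Proof. by move=> /andP[xN1 x1]; rewrite /clamp (min_idPl x1); exact/max_idPr. Qed.

Lemma le_clamp x y : x <= y -> clamp x <= clamp y.
Proof.
move=> xy; rewrite /clamp; case: (leP x 1) => ?; case: (leP y 1) => ?;
  case: (leP (-1) x) => ?; case: (leP (-1) y) => ?; case: (leP (-1) (1 : R)) => ?; lra.
Qed.

Lemma clamp_lipschitz x y : x <= y -> clamp y - clamp x <= y - x.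
Proof.
move=> xy; rewrite /clamp; case: (leP x 1) => ?; case: (leP y 1) => ?;
  case: (leP (-1) x) => ?; case: (leP (-1) y) => ?; case: (leP (-1) (1 : R)) => ?; lra.
Qed.

Let clampz z := [seq (clamp p.1, clamp p.2) | p <- z].

Let clampz_nonoverlapping z : nonoverlapping z -> nonoverlapping (clampz z).
Proof.
move=> /andP[oz sz]; rewrite /nonoverlapping /clampz all_map pairwise_map; apply/andP; split.
  by apply: sub_all oz => p; exact: le_clamp.
apply: sub_pairwise sz => p q; rewrite /apart/=.
by move=> /orP[/le_clamp ->//|/le_clamp ->]; rewrite orbT.
Qed.

Let clampz_inside z : inside (-1) 1 (clampz z).
Proof.
rewrite /inside /clampz all_map; apply/allP => p _ /=.
by have /andP[-> _] := clampI p.2; have /andP[_ ->] := clampI p.1.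
Qed.

Let clampz_length z : nonoverlapping z -> total_length (clampz z) <= total_length z.
Proof.
move=> /andP[/allP oz _]; rewrite /total_length big_map !big_seq; apply: ler_sum => p pz.
by apply: clamp_lipschitz; exact: oz.
Qed.

(** The interval is a finite union of intervals so short that the total variation
    is at most 1 on each of them. *)
Lemma abs_continuous_bounded_variation f :
  abs_continuous (-1) 1 f -> bounded_variation (-1) 1 f.
Proof.
move=> /nonoverlapping_abs_continuous acf; have [delta d0 /sum_total_variation_le H] := acf 1 ltr01.
have small x y : -1 <= x -> x <= y -> y <= 1 -> y - x < delta -> (total_variation x y f <= 1)%E.
  move=> xN1 xy y1 yx; have := H [:: (y, x)].
  rewrite /nonoverlapping /inside /total_length /ordered_itv/= !big_seq1/= xN1 xy y1; exact.
pose h := delta / 2; have h0 : 0 < h by rewrite /h; lra.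
have hd : h < delta by rewrite /h; lra.
have tv k x : -1 <= x <= 1 -> x <= -1 + k%:R * h -> (total_variation (-1) x f <= k%:R%:E)%E.
  elim: k x => [|k IH] x /andP[xN1 x1] xk.
    by rewrite (_ : x = -1) ?total_variationxx//; apply/eqP; rewrite eq_le; lra.
  have [xk'|xk'] := leP x (-1 + k%:R * h).
    by apply: (le_trans (IH x _ xk')); rewrite ?xN1 ?x1// lee_fin ler_nat.
  have kh : 0 <= k%:R * h by rewrite mulr_ge0// ltW.
  rewrite (@total_variationD _ (-1) x (-1 + k%:R * h)); [|lra|exact: ltW].
  rewrite -natr1 EFinD; apply: leeD; first by apply: IH => //; lra.
  by move: xk; rewrite -natr1 mulrDl mul1r => xk; apply: small; lra.
have le11 : -1 <= (1 : R) by lra.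
apply/(bounded_variationP f le11); rewrite ge0_fin_numE ?total_variation_ge0//.
pose k := (Num.trunc (2 / h)).+1.
apply: (le_lt_trans (tv k 1 _ _)); last exact: ltry.
  by apply/andP; split; lra.
have : 2 / h < k%:R by rewrite /k; have /andP[] := @truncn_itv R (2 / h) (divr_ge0 (ler0n _ 2) (ltW h0)).
rewrite ltr_pdivrMr//; lra.
Qed.

Section Variation.
Variables (f : R -> R) (acf : abs_continuous (-1) 1 f).

Let tv x := fine (total_variation (-1) (clamp x) f).

Let tvD x y : x <= y -> (tv y - tv x)%:E = total_variation (clamp x) (clamp y) f.
Proof.
move=> xy; have bv := abs_continuous_bounded_variation acf.
have /andP[xN1 x1] := clampI x; have /andP[yN1 y1] := clampI y.
have cxy := le_clamp xy.
have le11 : -1 <= (1 : R) by lra.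
have fx : total_variation (-1) (clamp x) f \is a fin_num.
  by apply/(bounded_variationP f xN1); exact: bounded_variationl bv.
have fy : total_variation (-1) (clamp y) f \is a fin_num.
  by apply/(bounded_variationP f yN1); exact: bounded_variationl bv.
by rewrite EFinB /tv !fineK// (total_variationD f xN1 cxy) [X in (X - _)%E]addeC addeK.
Qed.

Let f1 := tv.
Let f2 x := tv x - f (clamp x).

Let f1_nondecreasing : nondecreasing f1.
Proof.
move=> x y xy; rewrite -subr_ge0 -lee_fin (tvD xy).
by apply: total_variation_ge0; exact: le_clamp.
Qed.

Let increment_le x y : x <= y -> `|f (clamp y) - f (clamp x)| <= tv y - tv x.
Proof.
move=> xy; rewrite -lee_fin (tvD xy); apply: total_variation_ge; exact: le_clamp.
Qed.

Let f2_nondecreasing : nondecreasing f2.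
Proof.
by move=> x y xy; have := increment_le xy; rewrite ler_norml /f2; lra.
Qed.

Let f1_ac_growth : ac_growth f1.
Proof.
move=> eps eps0; have [delta d0 H] := nonoverlapping_abs_continuous acf eps0.
exists delta => // z zs zl.
have := sum_total_variation_le H (clampz_nonoverlapping zs) (clampz_inside z)
  (le_lt_trans (clampz_length zs) zl).
rewrite -lee_fin; apply: le_trans; rewrite -sumEFin big_map !big_seq; apply: lee_sum => p pz.
by have /andP[/allP/(_ _ pz) op _] := zs; rewrite (tvD op).
Qed.

Let f2_ac_growth : ac_growth f2.
Proof.
move=> eps eps0; have [|delta d0 H] := f1_ac_growth (eps := eps / 2); first by lra.
exists delta => // z zs zl; have := H z zs zl.
have : \sum_(p <- z) (f2 p.1 - f2 p.2) <= \sum_(p <- z) 2 * (f1 p.1 - f1 p.2).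
  rewrite !big_seq; apply: ler_sum => p pz.
  have /andP[/allP/(_ _ pz) op _] := zs.
  by have := increment_le op; rewrite ler_norml /f1 /f2; lra.
by rewrite -mulr_sumr; lra.
Qed.

(** Jordan decomposition reduces the claim to nondecreasing functions. *)
Lemma abs_continuous_primitive : exists2 psi : R -> R,
  mu.-integrable (@Omega R) (EFin \o psi) &
  forall x, Omega x -> f x = f (-1) + \int[mu]_(t in @Omega R) (rlker 1 x t * psi t).
Proof.
have mO := @measurable_Omega R.
have [p1 i1 E1] := ac_growth_primitive f1_nondecreasing f1_ac_growth.
have [p2 i2 E2] := ac_growth_primitive f2_nondecreasing f2_ac_growth.
exists (fun t => p1 t - p2 t); first exact: (integrableB mO i1 i2).
move=> x xO; have /OmegaE/andP[xN1 /ltW x1] := xO.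
under eq_Rintegral do rewrite mulrBr.
rewrite (RintegralB mO (integrable_rlker1 x i1) (integrable_rlker1 x i2)); have := E1 x xO; have := E2 x xO.
rewrite /f2 /f1 !clamp_id//; lra.
Qed.

End Variation.

End AbsolutelyContinuousPrimitive.

Section DerivativeChain.
Context {R : realType}.
Local Notation mu := (@lebesgue_measure R).
Implicit Types (u v w f psi : R -> R).

Lemma iterated_primitive_ae m v w f : {ae mu, forall x, Omega x -> v x = w x} ->
  iterated_primitive m v f -> iterated_primitive m w f.
Proof.
case: m => [|m] vw /=; first by apply: filterS2 vw => x vw vf xO; rewrite -vw ?vf.
move=> [u1 [c [u1i vE h]]]; exists u1, c; split => //.
by apply: filterS2 vw vE => x vw vE xO; rewrite -vw ?vE.
Qed.

(** The values of [v] on the open interval determine its derivative there;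
    [g] is its continuous extension. *)
Lemma abs_continuous_derive1 g v : abs_continuous (-1) 1 g ->
  (forall x, Omega x -> g x = v x) -> exists psi,
  [/\ mu.-integrable (@Omega R) (EFin \o psi),
    {ae mu, forall x, Omega x -> derive1 v x = psi x} &
    forall x, Omega x -> v x = g (-1) + \int[mu]_(t in @Omega R) (rlker 1 x t * psi t)].
Proof.
move=> /abs_continuous_primitive[psi psii gE] gv; exists psi.
have vE x : Omega x -> v x = g (-1) + \int[mu]_(t in @Omega R) (rlker 1 x t * psi t).
  by move=> xO; rewrite -gv// gE.
split => //; apply: filterS (ae_derive_primitive psii) => x dx xO.
have /OmegaE/andP[xN1 x1] := xO.
have d : is_derive x 1 (fun z => g (-1) + \int[mu]_(t in @Omega R) (rlker 1 z t * psi t)) (psi x).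
  by apply: (is_derive_eq (is_deriveD (is_derive_cst (g (-1)) x 1) (dx xO))); rewrite add0r.
rewrite derive1E; have [_ <-] := d; apply: near_eq_derive.
near=> z; apply: vE; apply/OmegaE; apply/andP; split.
  by near: z; exact: lt_nbhsr.
by near: z; exact: lt_nbhsl.
Unshelve. all: by end_near. Qed.

Lemma AC_derivs_iterated_primitive m u : mu.-integrable (@Omega R) (EFin \o u) ->
  AC_derivs m u -> exists psi,
  [/\ mu.-integrable (@Omega R) (EFin \o psi),
    {ae mu, forall x, Omega x -> derive1n m u x = psi x} & iterated_primitive m u psi].
Proof.
move=> ui [_ ac]; case: m ac => [|m] ac.
  by exists u; split => //; exact: aeW.
suff : forall k j, (j + k)%N = m -> exists psi,
    [/\ mu.-integrable (@Omega R) (EFin \o psi),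
      {ae mu, forall x, Omega x -> derive1n m.+1 u x = psi x} &
      iterated_primitive k.+1 (derive1n j u) psi].
  by move=> /(_ m 0 (add0n m)).
elim=> [|k IH] j jk.
  have [|g acg gv] := ac j; first by rewrite -jk addn0.
  have [psi [psii dE vE]] := abs_continuous_derive1 acg gv.
  rewrite addn0 in jk; rewrite -jk; exists psi; split => //.
  by exists psi, (g (-1)); split => //; exact: aeW.
have [|psi [psii dE pE]] := IH j.+1; first by rewrite addSnnS.
have [|g acg gv] := ac j; first by rewrite -jk addnS ltnS -addnS leq_addr.
have [psij [psiji djE vE]] := abs_continuous_derive1 acg gv.
exists psi; split => //; exists psij, (g (-1)); split => //; first exact: aeW.
exact: iterated_primitive_ae djE pE.
Qed.

End DerivativeChain.

(** * Functions of bounded variation *)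

Section BoundedVariation.
Context {R : realType}.
Local Notation mu := (@lebesgue_measure R).
Implicit Types (F g p q : R -> R) (x y : R).

(** The right-continuous regularization of a nondecreasing function. *)
Definition right_limit p x : R := inf [set p y | y in `]x, +oo[%classic].

Section RightLimit.
Variables (p : R -> R) (ndp : nondecreasing p) (c : R) (cp : forall x, c <= p x).

Let has_inf_right x : has_inf [set p y | y in `]x, +oo[%classic].
Proof.
split; last by exists c => _ [y _ <-].
by exists (p (x + 1)), (x + 1) => //=; rewrite in_itv/= andbT ltrDl.
Qed.

Lemma right_limit_le x y : x < y -> right_limit p x <= p y.
Proof.
move=> xy; apply: ge_inf; first by have [] := has_inf_right x.
by exists y => //=; rewrite in_itv/= xy.
Qed.

Lemma ge_right_limit x : p x <= right_limit p x.
Proof.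
apply: lb_le_inf; first by have [] := has_inf_right x.
by move=> _ [y /= + <-]; rewrite in_itv/= andbT => /ltW; exact: ndp.
Qed.

Lemma right_limit_nondecreasing : nondecreasing (right_limit p).
Proof.
move=> x y; rewrite le_eqVlt => /predU1P[->//|xy].
exact: le_trans (right_limit_le xy) (ge_right_limit y).
Qed.

Lemma right_limit_right_continuous : right_continuous (right_limit p).
Proof.
move=> x; apply/cvgrPdist_lt => e e0.
have [_ [y /= + <-] ye] := inf_adherent e0 (has_inf_right x).
rewrite -/(right_limit p x) in ye.
rewrite in_itv/= andbT => xy; near=> z.
have xz : x < z by near: z; exact: nbhs_right_gt.
have zy : z < y by near: z; exact: nbhs_right_lt.
rewrite distrC ger0_norm ?subr_ge0 ?right_limit_nondecreasing ?ltW//.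
by have := right_limit_le zy; lra.
Unshelve. all: by end_near. Qed.

(** The value lies between the one-sided limits, which agree outside the countable
    set of jumps. *)
Lemma right_limitE x : ~ discontinuity p x -> right_limit p x = p x.
Proof.
move=> ndx; apply/eqP; rewrite eq_le ge_right_limit andbT.
have cl : cvg (p z @[z --> x^'-]).
  apply: nondecreasing_at_left_is_cvgr; near=> y; first by move=> a b _ _; exact: ndp.
  by exists (p x) => _ [z /= + <-]; rewrite in_itv/= => /andP[_ /ltW]; exact: ndp.
have cr : cvg (p z @[z --> x^'+]).
  apply: nondecreasing_at_right_is_cvgr; near=> y; first by move=> a b _ _; exact: ndp.
  by exists c => _ [z _ <-].
have lr : lim (p z @[z --> x^'-]) = lim (p z @[z --> x^'+]).
  by apply: contrapT => /eqP lr; apply: ndx.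
apply: (@le_trans _ _ (lim (p z @[z --> x^'+]))).
  apply: limr_ge => //; near=> z; apply: right_limit_le; near: z; exact: nbhs_right_gt.
rewrite -lr; apply: limr_le => //; near=> z; apply/ndp/ltW; near: z; exact: nbhs_left_lt.
Unshelve. all: by end_near. Qed.

Lemma cumulative_ae : exists P : cumulative R R, {ae mu, forall x, Omega x -> p x = P x}.
Proof.
have [P PE] := cumulativeP right_limit_nondecreasing right_limit_right_continuous.
exists P; exists [set x | x \in (`]-1, 1[) /\ discontinuity p x].
have cD : countable [set x | x \in (`](-1 : R), 1[) /\ discontinuity p x].
  by apply: discontinuity_countable => x y _ _; exact: ndp.
split; [by apply: countable_measurable => // t; exact: measurable_set1|exact: countable_lebesgue_measure0|].
move=> x /= h; split; apply: contrapT => h'; apply: h => xO; first by exfalso; apply: h'.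
by rewrite PE right_limitE.
Qed.

End RightLimit.

(** The two monotone functions of the Jordan decomposition are replaced by their
    right limits, which changes them on a countable set only. *)
Lemma bv_decompP F : BV_Omega F -> is_bv_decomp F (bv_decomp F).
Proof.
move=> [g bvg Fg]; rewrite /bv_decomp; case: pselect => [e|[]]; first exact: projT2.
pose q h x := fine (neg_tv (-1) h (clamp x)).
have ndq h : bounded_variation (-1) 1 h -> nondecreasing (q h).
  move=> bvh x y xy; apply: (fine_neg_tv_nondecreasing bvh);
    rewrite ?in_itv/= ?clampI//; exact: le_clamp.
have lbq h : bounded_variation (-1) 1 h -> forall x, q h (-1) <= q h x.
  move=> bvh x; have -> : q h x = q h (clamp x) by rewrite /q (clamp_id (clampI x)).
  by apply: (ndq h bvh); have /andP[] := clampI x.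
have bvN := bounded_variationN bvg.
have [P PE] := cumulative_ae (ndq _ bvN) (lbq _ bvN).
have [N NE] := cumulative_ae (ndq _ bvg) (lbq _ bvg).
exists (P, N) => /=; rewrite /is_bv_decomp.
apply: filterS3 Fg PE NE => x Fx Px Nx xO; have /OmegaE/andP[/ltW xN1 /ltW x1] := xO.
rewrite Fx// -Px// -Nx// (bounded_variation_pos_neg_tvE bvg); last by rewrite in_itv/= xN1.
by rewrite /q clamp_id ?xN1.
Qed.

End BoundedVariation.

(** * Reflection of the interval, and the fractional integrals as potentials *)

Section ScaleNonMeasurable.
Local Open Scope ereal_scope.
Context d (T : measurableType d) (R : realType) (m : {measure set T -> \bar R}).
Implicit Types (f : T -> \bar R) (c : R).
Import HBNNSimple.

Let ge0_integralZ_le f c : (0 < c)%R -> (forall x, 0 <= f x) ->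
  c%:E * \int[m]_x f x <= \int[m]_x (c%:E * f x).
Proof.
move=> c0 f0; have cf0 x : 0 <= c%:E * f x by rewrite mule_ge0// lee_fin ltW.
rewrite -lee_pdivlMl// [in leLHS]ge0_integralTE//; apply: ge_ereal_sup => _ [h hf <-].
rewrite lee_pdivlMl// ge0_integralTE//.
have c0' := ltW c0.
apply: ereal_sup_ubound; exists (scale_nnsfun h c0') => /=.
  by move=> x; rewrite EFinM lee_wpmul2l ?hf// lee_fin.
rewrite -sintegralrM; apply: eq_sintegral => x //.
Qed.

Lemma ge0_integralZ_any f c : (0 < c)%R -> (forall x, 0 <= f x) ->
  \int[m]_x (c%:E * f x) = c%:E * \int[m]_x f x.
Proof.
move=> c0 f0; have ci0 : (0 < c^-1)%R by rewrite invr_gt0.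
have cf0 x : 0 <= c%:E * f x by rewrite mule_ge0// lee_fin ltW.
apply/eqP; rewrite eq_le ge0_integralZ_le// andbT.
have E : (fun x => c^-1%:E * (c%:E * f x)) = f.
  by apply/funext => x; rewrite muleA -EFinM mulVf ?gt_eqF// mul1e.
by have := ge0_integralZ_le ci0 cf0; rewrite E lee_pdivrMl.
Qed.

(** Scaling commutes with the supremum over simple functions, whatever the
    function; an integral that is not finite has value 0 on both sides. *)
Lemma RintegralZ_any (D : set T) (f : T -> R) c : (0 < c)%R ->
  (\int[m]_(x in D) (c * f x) = c * \int[m]_(x in D) f x)%R.
Proof.
move=> c0; have c0' := ltW c0.
have cD : ((fun x => (c * f x)%:E) \_ D) = fun x => c%:E * ((EFin \o f) \_ D) x.
  by apply/funext => x; rewrite !patchE; case: ifP => // _; rewrite mule0.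
rewrite /Rintegral integral_mkcond cD [in RHS]integral_mkcond.
rewrite integralE [in RHS]integralE ge0_funeposM// ge0_funenegM//.
rewrite !ge0_integralZ_any//.
have : 0 <= \int[m]_x (((EFin \o f) \_ D)^\+ x) by exact: integral_ge0.
have : 0 <= \int[m]_x (((EFin \o f) \_ D)^\- x) by exact: integral_ge0.
move: (\int[m]_x _) (\int[m]_x _) => [b| |] [a| |] //= _ _.
- by rewrite mulrBr.
- by rewrite gt0_muley ?lte_fin//= mulr0.
- by rewrite gt0_muley ?lte_fin//= mulr0.
- by rewrite gt0_muley ?lte_fin//= mulr0.
Qed.

Lemma RintegralN_any (D : set T) (f : T -> R) :
  (\int[m]_(x in D) (- f x) = - \int[m]_(x in D) f x)%R.
Proof.
have DN : ((fun x => (- f x)%:E) \_ D) = fun x => - ((EFin \o f) \_ D) x.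
  by apply/funext => x; rewrite !patchE; case: ifP => // _; rewrite oppe0.
rewrite /Rintegral integral_mkcond DN [in RHS]integral_mkcond.
rewrite integralE [in RHS]integralE funeposN funenegN.
have : 0 <= \int[m]_x (((EFin \o f) \_ D)^\+ x) by exact: integral_ge0.
have : 0 <= \int[m]_x (((EFin \o f) \_ D)^\- x) by exact: integral_ge0.
move: (\int[m]_x _) (\int[m]_x _) => [b| |] [a| |] //= _ _; last by rewrite oppr0.
all: by rewrite ?oppr0// opprB.
Qed.

Lemma Rintegral_sign_any (D : set T) (f : T -> R) k :
  (\int[m]_(x in D) ((-1) ^+ k * f x) = (-1) ^+ k * \int[m]_(x in D) f x)%R.
Proof.
rewrite -signr_odd; case: (odd k); last first.
  by rewrite expr0 mul1r; apply: eq_Rintegral => x _; rewrite mul1r.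
by rewrite expr1 mulN1r -RintegralN_any; apply: eq_Rintegral => x _; rewrite mulN1r.
Qed.

End ScaleNonMeasurable.

Section Reflection.
Context {R : realType}.
Local Notation mu := (@lebesgue_measure R).
Implicit Types (f u v w psi : R -> R) (x y t c s : R) (m : nat).

Lemma OmegaN x : Omega (- x) <-> Omega x.
Proof. by rewrite !OmegaE; lra. Qed.

Lemma ae_oppr (P : R -> Prop) : {ae mu, forall x, P x} -> {ae mu, forall x, P (- x)}.
Proof.
move=> [N [mN N0 PN]].
exists ((-%R : R -> measurableTypeR R) @^-1` N); split; last by move=> x /= Px; exact: PN.
  have h : measurable_fun [set: measurableTypeR R] (-%R : R -> measurableTypeR R).
    exact: oppr_measurable.
  by rewrite -[X in measurable X]setTI; exact: (h measurableT _ mN).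
by rewrite -[RHS]N0 -(lebesgue_measureN mN).
Qed.

Lemma ae_neq x : {ae mu, forall t, t <> x}.
Proof.
exists [set x]; split; [exact: measurable_set1|exact: lebesgue_measure_set1|].
by move=> t /= /contrapT.
Qed.

Let patch_opp f x : ((fun x => f (- x)) \_ (@Omega R)) x = (f \_ (@Omega R)) (- x).
Proof.
rewrite !patchE; case: ifPn => [/set_mem/OmegaN xO|/negP xO].
  by rewrite mem_set.
by rewrite memNset// => /OmegaN xO'; apply: xO; exact: mem_set.
Qed.

Lemma measurable_oppr_Omega f : measurable_fun (@Omega R) f ->
  measurable_fun (@Omega R) (fun x => f (- x)).
Proof.
have mO := @measurable_Omega R.
move=> /(measurable_restrictT f mO) mf.
apply/(measurable_restrictT (fun x => f (- x)) mO).
rewrite (_ : _ \_ _ = (f \_ (@Omega R)) \o -%R); last by apply/funext => x; exact: patch_opp.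
have h : measurable_fun [set: measurableTypeR R] (-%R : R -> measurableTypeR R).
  exact: oppr_measurable.
exact: (measurableT_comp mf h).
Qed.

Lemma Rintegral_oppr f : measurable_fun (@Omega R) f ->
  \int[mu]_(x in @Omega R) f (- x) = \int[mu]_(x in @Omega R) f x.
Proof.
have mO := @measurable_Omega R.
move=> /(measurable_restrictT f mO) mf; rewrite /Rintegral integral_mkcond [in RHS]integral_mkcond; congr fine.
have mE : measurable_fun [set: measurableTypeR R] (EFin \o (f \_ (@Omega R))).
  exact/measurable_EFinP.
transitivity (\int[mu]_x (EFin \o (f \_ (@Omega R))) (- x)%R)%E.
  by apply: eq_integral => x _; rewrite /= -(patch_opp f x) !patchE; case: ifP.
rewrite restrict_EFin [LHS]integralE [RHS]integralE; congr (_ - _)%E.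
  rewrite -(ge0_integral_oppr (measurable_funepos mE)) => [|x]; last exact: funepos_ge0.
  by apply: eq_integral => x _; rewrite !funeposE.
rewrite -(ge0_integral_oppr (measurable_funeneg mE)) => [|x]; last exact: funeneg_ge0.
by apply: eq_integral => x _; rewrite !funenegE.
Qed.

Lemma integrable_oppr f : mu.-integrable (@Omega R) (EFin \o f) ->
  mu.-integrable (@Omega R) (EFin \o (fun x => f (- x))).
Proof.
move=> /integrableP[mf fi]; have mf' : measurable_fun (@Omega R) f by apply/measurable_EFinP.
have mO := @measurable_Omega R.
apply/integrableP; split; first by apply/measurable_EFinP; exact: measurable_oppr_Omega.
apply: le_lt_trans fi; rewrite integral_mkcond [leRHS]integral_mkcond.
rewrite -(ge0_integral_oppr (f := (abse \o (EFin \o f)) \_ (@Omega R))).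
- rewrite le_eqVlt; apply/orP; left; apply/eqP; apply: eq_integral => x _.
  rewrite !patchE; case: ifPn => [/set_mem/OmegaN xO|/negP xO].
    by rewrite mem_set.
  by rewrite memNset// => /OmegaN xO'; apply: xO; exact: mem_set.
- by apply/(measurable_restrictT _ mO); exact: measurableT_comp.
- by move=> x; rewrite patchE; case: ifP => // _; exact: abse_ge0.
Qed.

(** Reflecting the interval changes the sign of each primitive; the constants of
    integration absorb the change of base point. *)
Lemma iterated_primitive_oppr m e u f : iterated_primitive m u f ->
  iterated_primitive m (fun x => e * u (- x)) (fun x => e * (-1) ^+ m * f (- x)).
Proof.
have mO := @measurable_Omega R.
elim: m e u => [|m IH] e u /= => [uf|[u1 [c [u1i uE u1E]]]].
  by apply: filterS (ae_oppr uf) => x uf' /OmegaN xO; rewrite mulr1 uf'.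
have u1Ni := integrable_oppr u1i.
exists (fun x => - e * u1 (- x)), (e * (c + \int[mu]_(t in @Omega R) u1 t)); split.
- by have := integrableZl mO (- e) u1Ni; apply: eq_integrable => // x _; rewrite /= EFinM.
- apply: filterS (ae_oppr uE) => x uEx xO; rewrite uEx; last exact/OmegaN.
  have k_ae : {ae mu, forall t, Omega t -> rlker 1 (- x) t * u1 t = u1 t - rlker 1 x (- t) * u1 t}.
    apply: filterS (ae_neq (- x)) => t tx _; rewrite !rlker1 ltrNl ltNge le_eqVlt.
    by rewrite eq_sym (introF eqP tx)/=; case: ltP => _ /=; ring.
  have k_int := integrable_rlker1 x u1Ni.
  have k_int' : mu.-integrable (@Omega R) (EFin \o (fun t => rlker 1 x (- t) * u1 t)).
    have := integrable_oppr k_int.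
    by apply: eq_integrable => // t _; rewrite /= opprK.
  rewrite (ae_eq_Rintegral_any k_ae) (RintegralB mO u1i k_int').
  have -> : \int[mu]_(t in @Omega R) (rlker 1 x t * (- e * u1 (- t))) =
      - e * \int[mu]_(t in @Omega R) (rlker 1 x t * u1 (- t)).
    by rewrite -(RintegralZl _ mO k_int); apply: eq_Rintegral => t _; rewrite mulrCA.
  have -> : \int[mu]_(t in @Omega R) (rlker 1 x t * u1 (- t)) =
      \int[mu]_(t in @Omega R) (rlker 1 x (- t) * u1 t).
    rewrite -(Rintegral_oppr (f := fun t => rlker 1 x t * u1 (- t))).
      by apply: eq_Rintegral => t _; rewrite opprK.
    by have /measurable_EFinP := measurable_int mu k_int.
  by ring.
by rewrite exprS mulN1r mulrN -mulNr; exact: IH.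
Qed.

End Reflection.

Section FractionalIntegrals.
Context {R : realType}.
Local Notation mu := (@lebesgue_measure R).
Implicit Types (f psi : R -> R) (x y s : R).

Lemma fracint_leftE s f psi x : s < 1 ->
  {ae mu, forall y, Omega y -> f y = psi y} -> Omega x ->
  fracint_left s f x = \int[mu]_(y in @Omega R) (rlker (1 - s) x y * psi y).
Proof.
move=> s1 fpsi /OmegaE/andP[xN1 x1].
have g0 : 0 < EulerGamma (1 - s) by apply: Gamma_gt0; rewrite subr_gt0.
rewrite /fracint_left (_ : Gamma (1 - s) = EulerGamma (1 - s)); last by rewrite EulerGamma.unlock.
rewrite -RintegralZ_any ?invr_gt0//.
transitivity (\int[mu]_(y in `]-1, x[) (rlker (1 - s) x y * psi y)).
  apply: ae_eq_Rintegral_any; apply: filterS fpsi => y fpsi /=; rewrite in_itv/= => /andP[yN1 yx].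
  rewrite fpsi; last by apply/OmegaE; rewrite yN1 (lt_trans yx).
  by rewrite rlkerE// (_ : 1 - s - 1 = - s) ?powRN; [ring|lra].
rewrite /Rintegral integral_mkcond [in RHS]integral_mkcond; congr fine.
apply: eq_integral => y _; rewrite !patchE.
case: ifPn => [/set_mem/=|/negP yx].
  by rewrite in_itv/= => /andP[yN1 yx]; rewrite mem_set//; apply/OmegaE; rewrite yN1 (lt_trans yx).
case: ifPn => // /set_mem/OmegaE/andP[yN1 _]; rewrite rlker0 ?mul0r// leNgt; apply/negP => yx'.
by apply: yx; apply/mem_set; rewrite /= in_itv/= yN1.
Qed.

Lemma fracint_rightE s f psi x : s < 1 -> measurable_fun (@Omega R) psi ->
  {ae mu, forall y, Omega y -> f y = psi y} -> Omega x ->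
  fracint_right s f x = \int[mu]_(y in @Omega R) (rlker (1 - s) (- x) y * psi (- y)).
Proof.
move=> s1 mpsi fpsi /OmegaE/andP[xN1 x1].
have g0 : 0 < EulerGamma (1 - s) by apply: Gamma_gt0; rewrite subr_gt0.
transitivity (\int[mu]_(y in @Omega R) (rlker (1 - s) (- x) (- y) * psi y)); last first.
  rewrite -[LHS]Rintegral_oppr; first by apply: eq_Rintegral => y _; rewrite opprK.
  apply: measurable_realfun.measurable_funM => //; apply: measurable_funTS.
  by apply: measurable_rlker => //; exact: oppr_measurable.
rewrite /fracint_right (_ : Gamma (1 - s) = EulerGamma (1 - s)); last by rewrite EulerGamma.unlock.
rewrite -RintegralZ_any ?invr_gt0//.
transitivity (\int[mu]_(y in `]x, 1[) (rlker (1 - s) (- x) (- y) * psi y)).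
  apply: ae_eq_Rintegral_any; apply: filterS fpsi => y fpsi /=; rewrite in_itv/= => /andP[xy y1].
  rewrite fpsi; last by apply/OmegaE; rewrite y1 (lt_trans xN1).
  rewrite rlkerE ?ltrN2// (_ : 1 - s - 1 = - s); last by lra.
  by rewrite powRN opprK [- x + y]addrC; ring.
rewrite /Rintegral integral_mkcond [in RHS]integral_mkcond; congr fine.
apply: eq_integral => y _; rewrite !patchE.
case: ifPn => [/set_mem/=|/negP yx].
  by rewrite in_itv/= => /andP[xy y1]; rewrite mem_set//; apply/OmegaE; rewrite y1 (lt_trans xN1).
case: ifPn => // /set_mem/OmegaE/andP[_ y1]; rewrite rlker0 ?mul0r// lerN2 leNgt; apply/negP => xy.
by apply: yx; apply/mem_set; rewrite /= in_itv/= xy.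
Qed.

End FractionalIntegrals.

(** * Stieltjes measures *)

Section StieltjesFunctionals.
Context {R : realType}.
Local Notation mu := (@lebesgue_measure R).
Implicit Types (P N : cumulative R R) (x y z : R) (phi : R -> R).
Local Notation LS := lebesgue_stieltjes_measure.

(** Continuity of the measure from below, along the half-open intervals on which
    it is known. *)
Lemma Stieltjes_itvoo P x y : x < y ->
  exists2 l, P z @[z --> y^'-] --> l & LS P (`]x, y[%classic : set R) = (l - P x)%:E.
Proof.
move=> xy; have ndP : nondecreasing P := cumulative_is_nondecreasing P.
have cl : cvg (P z @[z --> y^'-]).
  apply: nondecreasing_at_left_is_cvgr; near=> a; first by move=> b c _ _; exact: ndP.
  by exists (P y) => _ [z /= + <-]; rewrite in_itv/= => /andP[_ /ltW]; exact: ndP.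
exists (lim (P z @[z --> y^'-])) => //.
pose yk k : R := y - k.+1%:R^-1.
have yky : yk k @[k --> \oo] --> y.
  rewrite -[X in _ --> X]subr0; apply: cvgB; first exact: cvg_cst.
  exact: cvg_harmonic.
have c1 : (P (yk k) - P x)%:E @[k --> \oo] --> (lim (P z @[z --> y^'-]) - P x)%:E.
  apply: cvg_EFin; first exact: nearW.
  apply: cvgB; last exact: cvg_cst.
  have /cvg_at_leftP := cl; apply; split => // k.
  by rewrite /yk ltrBlDr ltrDl invr_gt0.
have c2 : LS P (`]x, yk k]%classic : set R) @[k --> \oo] --> LS P (`]x, y[%classic : set R).
  rewrite itv_bnd_open_bigcup; apply: nondecreasing_cvg_mu.
  - by move=> k; exact: measurable_itv.
  - by apply: bigcup_measurable => k _; exact: measurable_itv.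
  - move=> i j ij; apply/subsetPset => z /=; rewrite !in_itv/= => /andP[->/=].
    by move/le_trans; apply; rewrite lerB// lef_pV2 ?ler_nat ?posrE.
apply: (cvg_unique _ c2); first exact: ereal_hausdorff.
apply: cvg_trans c1; apply: near_eq_cvg; near=> k.
rewrite Stieltjes_itvoc//; apply/ltW; near: k.
by apply: (cvgr_gt y).
Unshelve. all: by end_near. Qed.

Lemma duality_Stieltjes P (h : R -> R) : measurable_fun [set: R] h ->
  (forall z, Omega z -> Omega (h z)) ->
  duality (fun phi => \int[LS P]_(z in @Omega R) phi (h z)).
Proof.
move=> mh hO.
have hI z : Omega z -> -1 <= h z < 1 by move=> /hO/OmegaE/andP[/ltW -> ->].
have i1 : (LS P).-integrable (@Omega R) (EFin \o (fun=> 1)).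
  apply/integrableP; split; first exact: measurable_cst.
  under eq_integral do rewrite /= normr1.
  rewrite integral_cst ?mul1e; [exact: Stieltjes_Omega_lty|exact: measurable_Omega].
have := duality_measure (m := LS P) (@measurable_Omega R) mh hI i1.
rewrite (_ : (fun phi => _) = fun phi => \int[LS P]_(z in @Omega R) phi (h z))//.
by apply/funext => phi; apply: eq_Rintegral => z _; rewrite mulr1.
Qed.

Lemma Rintegral_Stieltjes_indic P (A : set R) :
  measurable (A : set (measurableTypeR R)) -> A `<=` @Omega R ->
  \int[LS P]_(z in @Omega R) \1_A z = fine (LS P A).
Proof.
move=> mA AO; rewrite /Rintegral integral_indic//; last exact: measurable_Omega.
by congr (fine (LS P _)); exact/setIidl.
Qed.

(** The left-hand side is the measure of the open interval from -1 to [x], which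
    misses the jump of [P] at [x]; almost every [x] is a point of continuity. *)
Lemma ae_Stieltjes_potential_left P : {ae mu, forall x, Omega x ->
  \int[LS P]_(y in @Omega R) rlker 1 x y = P x - P (-1)}.
Proof.
have ndP : nondecreasing P := cumulative_is_nondecreasing P.
have cD : countable [set x | x \in (`](-1 : R), 1[) /\ discontinuity P x].
  by apply: discontinuity_countable => x y _ _; exact: ndP.
exists [set x | x \in (`]-1, 1[) /\ discontinuity P x]; split.
- by apply: countable_measurable => // t; exact: measurable_set1.
- exact: countable_lebesgue_measure0.
move=> x /= h; split; apply: contrapT => h'; apply: h => xO; first by exfalso; apply: h'.
have /OmegaE/andP[xN1 x1] := xO.
have [l cl E] := Stieltjes_itvoo P xN1.
rewrite (_ : \int[LS P]_(y in @Omega R) _ =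
    \int[LS P]_(y in @Omega R) \1_(`]-1, x[%classic) y); last first.
  apply: eq_Rintegral => y /set_mem/OmegaE/andP[yN1 y1]; rewrite rlker1 indicE; congr ((nat_of_bool _)%:R).
  by apply/idP/idP => [yx|/set_mem/=]; [apply/mem_set; rewrite /= in_itv/= yN1|rewrite in_itv/= yN1].
rewrite Rintegral_Stieltjes_indic; [|exact: measurable_itv|]; last first.
  by move=> y /=; rewrite in_itv/= => /andP[yN1 yx]; apply/OmegaE; rewrite yN1 (lt_trans yx).
rewrite E /=; congr (_ - _).
have cr := cumulative_is_right_continuous P x.
have : lim (P z @[z --> x^'-]) = lim (P z @[z --> x^'+]).
  apply: contrapT => /eqP lr; apply: h'; split => //; [exact: cvgP cl|exact: cvgP cr].
by rewrite (cvg_lim (@Rhausdorff R) cl) (cvg_lim (@Rhausdorff R) cr).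
Qed.

Lemma Stieltjes_potential_right P x l : Omega x -> P z @[z --> (1 : R)^'-] --> l ->
  \int[LS P]_(y in @Omega R) rlker 1 (- x) (- y) = l - P x.
Proof.
move=> /OmegaE/andP[xN1 x1] cl; have [l' cl' E] := Stieltjes_itvoo P x1.
rewrite (_ : \int[LS P]_(y in @Omega R) _ =
    \int[LS P]_(y in @Omega R) \1_(`]x, 1[%classic) y); last first.
  apply: eq_Rintegral => y /set_mem/OmegaE/andP[yN1 y1]; rewrite rlker1 ltrN2 indicE; congr ((nat_of_bool _)%:R).
  by apply/idP/idP => [xy|/set_mem/=]; [apply/mem_set; rewrite /= in_itv/= xy|rewrite in_itv/= y1 andbT].
rewrite Rintegral_Stieltjes_indic; [|exact: measurable_itv|]; last first.
  by move=> y /=; rewrite in_itv/= => /andP[xy y1]; apply/OmegaE; rewrite y1 (lt_trans xN1).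
by rewrite E /=; congr (_ - _); exact: (cvg_unique (@Rhausdorff R) cl' cl).
Qed.

End StieltjesFunctionals.

(** * The Chebyshev coefficients *)

Section ChebyshevCoefficients.
Context {R : realType}.
Local Notation mu := (@lebesgue_measure R).
Local Notation LS := lebesgue_stieltjes_measure.
Variables (s : R) (s0 : 0 < s) (s1 : s < 1) (m n : nat) (mn : (m < n)%N).
Hypothesis ms12 : 1 / 2 < m%:R + s.
Implicit Types (u psi : R -> R) (L : (R -> R) -> R).

Local Notation sigma := (m%:R + s).
Local Notation h := (fracheb n sigma).

Lemma integral_chebw_duality u psi L : mu.-integrable (@Omega R) (EFin \o psi) ->
  iterated_primitive m u psi -> duality L ->
  {ae mu, forall x, Omega x ->
    \int[mu]_(y in @Omega R) (rlker (1 - s) x y * psi y) = L (rlker 1 x)} ->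
  \int[mu]_(x in @Omega R) (u x * chebw n x) = L h.
Proof.
move=> psii upsi dL psiL.
exact: integral_chebw_potential (Abel_inversion s0 s1 dL psii psiL) upsi.
Qed.

(** The measure consists of the Stieltjes measure of the fractional integral and
    a point mass at -1, the limit of the fractional integral there. *)
Lemma integral_chebw_left u : W_minus m s u ->
  let PN := bv_decomp (fracint_left s (derive1n m u)) in
  \int[mu]_(x in @Omega R) (u x * chebw n x) = (PN.1 (-1) - PN.2 (-1)) * h (-1) +
    (\int[LS PN.1]_(x in @Omega R) h x - \int[LS PN.2]_(x in @Omega R) h x).
Proof.
move=> [ui ac /bv_decompP FE] PN.
have [psi [psii psiE upsi]] := AC_derivs_iterated_primitive ui ac.
have NI : -1 <= (-1 : R) < 1 by apply/andP; split; lra.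
pose L phi := (PN.1 (-1) - PN.2 (-1)) * phi (-1) +
  (\int[LS PN.1]_(x in @Omega R) phi x - \int[LS PN.2]_(x in @Omega R) phi x).
have mid : measurable_fun [set: R] (idfun : R -> R) by exact: measurable_id.
have dL : duality L.
  apply: dualityD; first by apply: dualityZ; exact: duality_dirac.
  apply: dualityD; first exact: (duality_Stieltjes PN.1 mid (fun z zO => zO)).
  apply: dualityN; exact: (duality_Stieltjes PN.2 mid (fun z zO => zO)).
apply: (integral_chebw_duality psii upsi dL).
apply: filterS3 FE (ae_Stieltjes_potential_left PN.1) (ae_Stieltjes_potential_left PN.2).
move=> x Fx Px Nx xO; have /OmegaE/andP[xN1 _] := xO.
rewrite -(fracint_leftE s1 psiE xO) Fx// /L Px// Nx// rlker1 xN1 -/PN /=; ring.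
Qed.

(** By reflection, the point mass of the measure is now the limit of the
    fractional integral at 1, and the mass of an interval next to 1 enters with a
    minus sign. *)
Lemma integral_chebw_right u : W_plus m s u ->
  let PN := bv_decomp (fracint_right s (derive1n m u)) in
  forall a b : R, PN.1 x @[x --> (1 : R)^'-] --> a -> PN.2 x @[x --> (1 : R)^'-] --> b ->
  \int[mu]_(x in @Omega R) (u x * chebw n x) = (-1) ^+ (n + m) * ((a - b) * h (-1) -
    (\int[LS PN.1]_(x in @Omega R) h (- x) - \int[LS PN.2]_(x in @Omega R) h (- x))).
Proof.
move=> [ui ac /bv_decompP FE] PN a b Pa Nb.
have [psi [psii psiE upsi]] := AC_derivs_iterated_primitive ui ac.
have mpsi : measurable_fun (@Omega R) psi.
  by have /measurable_EFinP := measurable_int mu psii.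
have NI : -1 <= (-1 : R) < 1 by apply/andP; split; lra.
pose L phi := (a - b) * phi (-1) -
  (\int[LS PN.1]_(x in @Omega R) phi (- x) - \int[LS PN.2]_(x in @Omega R) phi (- x)).
have mopp : measurable_fun [set: R] (-%R : R -> R) by exact: oppr_measurable.
have NO x : @Omega R x -> Omega (- x) by move=> /OmegaN.
have dL : duality L.
  apply: dualityD; first by apply: dualityZ; exact: duality_dirac.
  apply: dualityN; apply: dualityD; first exact: (duality_Stieltjes PN.1 mopp NO).
  apply: dualityN; exact: (duality_Stieltjes PN.2 mopp NO).
(* This sign cancels the one that [m] derivatives produce under reflection. *)
have vpsi := iterated_primitive_oppr ((-1) ^+ m) upsi.
have sqr k : (-1) ^+ k * (-1) ^+ k = 1 :> R by rewrite -exprD addnn -signr_odd odd_double.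
have E : \int[mu]_(x in @Omega R) ((-1) ^+ m * u (- x) * chebw n x) = L h.
  apply: (@integral_chebw_duality _ (fun x => psi (- x))) => //.
  - exact: integrable_oppr.
  - move: vpsi; rewrite sqr; set w := (fun x => 1 * _).
    by rewrite (_ : w = fun x => psi (- x))//; apply/funext => x; rewrite /w mul1r.
  apply: filterS (ae_oppr FE) => x Fx xO; have xO' := NO x xO.
  rewrite -[x in rlker _ x]opprK -(fracint_rightE s1 mpsi psiE xO') Fx//.
  rewrite /L -[x in rlker 1 x]opprK (Stieltjes_potential_right xO' Pa).
  rewrite (Stieltjes_potential_right xO' Nb) opprK rlker1.
  by have /OmegaE/andP[-> _] := xO; rewrite -/PN /=; ring.
rewrite -[X in _ * X]/(L h) -E; set I := (X in _ = X).
have mu_ : measurable_fun (@Omega R) (fun x => u x * chebw n x).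
  apply: measurable_realfun.measurable_funM; last exact: measurable_chebw.
  by have /measurable_EFinP := measurable_int mu ui.
rewrite -(Rintegral_oppr mu_) /I -Rintegral_sign_any; apply: eq_Rintegral => x /set_mem xO.
rewrite chebwN// exprD; have := sqr m; move: ((-1) ^+ m) ((-1) ^+ n) => p q pp.
by transitivity (p * p * (q * (u (- x) * chebw n x))); [rewrite pp|]; ring.
Qed.

Lemma Csigma_gt0 : 0 < Csigma sigma.
Proof.
have g0 : 0 < EulerGamma (sigma + 1 / 2) by apply/Gamma_gt0/addr_gt0 => //; exact: lt_trans ms12.
rewrite /Csigma (_ : Gamma _ = EulerGamma (sigma + 1 / 2)); last by rewrite EulerGamma.unlock.
by rewrite invr_gt0 mulr_gt0// mulr_gt0 ?sqrtr_gt0 ?pi_gt0// powR_gt0.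
Qed.

Let n0 : (0 < n)%N. Proof. by rewrite (leq_trans _ mn). Qed.

Let pi2_gt0 : 0 < 2 / pi :> R. Proof. by rewrite divr_gt0// pi_gt0. Qed.

Lemma Stieltjes_fracheb (P : cumulative R R) (k : R -> R) :
  (forall x, Omega x -> Omega (k x)) ->
  2 / pi * \int[LS P]_(x in @Omega R) h (k x) = Csigma sigma *
    \int[LS P]_(x in @Omega R) (rG sigma (n%:R - sigma) (k x) * omega sigma (k x)).
Proof.
move=> kO; rewrite -(RintegralZ_any _ _ _ pi2_gt0) -(RintegralZ_any _ _ _ Csigma_gt0).
by apply: eq_Rintegral => x /set_mem xO; rewrite fracheb_rG//; exact: kO.
Qed.

End ChebyshevCoefficients.

Lemma floor_natB (R : realType) (s : R) (k : nat) : 0 < s -> s < 1 -> (0 < k)%N ->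
  Num.floor (k%:R - s) = k.-1%:Z.
Proof.
move=> s0 s1; case: k => // k _; apply: floor_def; rewrite /= intrD -!pmulrn -natr1; lra.
Qed.

Unset Implicit Arguments.

Theorem theorem2 (R : realType) (s : R) (hs0 : 0 < s) (hs1 : s < 1) (m : nat)
    (u : R -> R) :
  let sigma : R := m%:R + s in
  (W_plus m s u ->
   forall n : nat, sigma <= n%:R -> 1 / 2 < sigma ->
   cheb_coef u n =
   (-1) ^ (n%:Z + Num.floor (n%:R - s)) * Csigma sigma *
   (int_RLderiv_right s (derive1n m u)
      (fun x => lG sigma (n%:R - sigma) x * omega sigma x)
    + lim ((rc_repr (fracint_right s (derive1n m u)) x
            * lG sigma (n%:R - sigma) x * omega sigma x) @[x --> 1^'-])))
  /\
  (W_minus m s u ->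
   forall n : nat, sigma <= n%:R -> 1 / 2 < sigma ->
   cheb_coef u n =
   Csigma sigma *
   (int_RLderiv_left s (derive1n m u)
      (fun x => rG sigma (n%:R - sigma) x * omega sigma x)
    + lim ((rc_repr (fracint_left s (derive1n m u)) x
            * rG sigma (n%:R - sigma) x * omega sigma x) @[x --> (-1)^'+]))).
Proof.
move=> sigma; split=> uW n sn s12.
  have mn : (m < n)%N by rewrite -(ltr_nat R); apply: lt_le_trans sn; rewrite ltrDl.
  have C0 := Csigma_gt0 s12; have Cn0 : Csigma sigma != 0 by rewrite gt_eqF.
  have pi2 : 2 / pi != 0 :> R by rewrite mulf_neq0 ?invr_eq0 ?gt_eqF ?pi_gt0.
  have n0 : (0 < n)%N := leq_ltn_trans (leq0n m) mn.
  set F := fracint_right s (derive1n m u).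
  have [[a Pa] [b Nb]] : (exists a : R, (bv_decomp F).1 x @[x --> (1 : R)^'-] --> a) /\
      (exists b : R, (bv_decomp F).2 x @[x --> (1 : R)^'-] --> b).
    have N11 : -1 < (1 : R) by lra.
    by split; [have [l cl _] := Stieltjes_itvoo (bv_decomp F).1 N11|
      have [l cl _] := Stieltjes_itvoo (bv_decomp F).2 N11]; exists l.
  pose h := fracheb n sigma; pose e : R := (-1) ^+ (n - m).-1.
  have nm0 : (0 < n - m)%N by rewrite subn_gt0.
  have fl : Num.floor (n%:R - sigma) = (n - m).-1%:Z.
    by rewrite -(floor_natB hs0 hs1 nm0) natrB ?(ltnW mn)// /sigma; congr Num.floor; ring.
  have lGE x : Omega x -> Csigma sigma * (lG sigma (n%:R - sigma) x * omega sigma x) =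
      e * (2 / pi * h (- x)).
    move=> /OmegaN xO; rewrite (fracheb_rG n0 s12 xO) /lG fl /rG /omega opprK sqrrN /e.
    by rewrite -exprnP; ring.
  have signE : (-1 : R) ^ (n%:Z + Num.floor (n%:R - s)) = -1.
    rewrite (floor_natB hs0 hs1 n0) -PoszD -exprnP -signr_odd oddD -[n in odd n](prednK n0) /=.
    by case: (odd _).
  have ee : - e = (-1) ^+ (n + m).
    have -> : - e = (-1) ^+ (n - m).-1.+1 by rewrite exprS mulN1r.
    rewrite prednK// -signr_odd -[RHS]signr_odd oddB ?(ltnW mn)//.
    by rewrite oddD.
  have limE : lim ((rc_repr F x * lG sigma (n%:R - sigma) x * omega sigma x) @[x --> 1^'-]) =
      (a - b) * ((Csigma sigma)^-1 * (e * (2 / pi * h (-1)))).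
    apply: (cvg_lim (@Rhausdorff R)).
    have c : ((bv_decomp F).1 x - (bv_decomp F).2 x) *
        ((Csigma sigma)^-1 * (e * (2 / pi * h (- x)))) @[x --> (1 : R)^'-] -->
        (a - b) * ((Csigma sigma)^-1 * (e * (2 / pi * h (-1)))).
      apply: cvgM; first exact: cvgB.
      do 3 apply: cvgMr.
      apply/cvg_at_leftNP; rewrite (_ : _ \o _ = h); first exact: cvg_fracheb_N1.
      by apply/funext => x /=; rewrite opprK.
    apply: cvg_trans c; apply: near_eq_cvg; near=> x.
    have xO : Omega x.
      apply/OmegaE; apply/andP; split; last by near: x; exact: nbhs_left_lt.
      by near: x; apply: nbhs_left_gt; lra.
    by rewrite -lGE// mulKf// /rc_repr mulrA.
  have St (P : cumulative R R) :
      \int[lebesgue_stieltjes_measure P]_(x in @Omega R) (lG sigma (n%:R - sigma) x * omega sigma x) =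
      (Csigma sigma)^-1 * (e * (2 / pi *
        \int[lebesgue_stieltjes_measure P]_(x in @Omega R) h (- x))).
    rewrite (Stieltjes_fracheb mn s12) => [|x /OmegaN//].
    rewrite mulrCA mulKf// -Rintegral_sign_any; apply: eq_Rintegral => x /set_mem xO.
    rewrite /lG fl /rG /omega /e opprK sqrrN -exprnP; ring.
  rewrite limE /int_RLderiv_right /stieltjes !St signE /cheb_coef.
  have := integral_chebw_right hs0 hs1 mn s12 uW Pa Nb; rewrite -/F -ee => E.
  rewrite [X in 2 / pi * X](_ : _ = \int[lebesgue_measure]_(x in @Omega R) (u x * chebw n x))//.
  rewrite E -/h; move: (\int[_]_(x in _) _) (\int[_]_(x in _) _) => i1 i2.
  have pi0 : pi != 0 :> R by rewrite gt_eqF ?pi_gt0.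
  by move: (pi) (Csigma sigma) pi0 Cn0 => p C pi0 Cn0; field; rewrite pi0.
have mn : (m < n)%N by rewrite -(ltr_nat R); apply: lt_le_trans sn; rewrite ltrDl.
have C0 := Csigma_gt0 s12; have Cn0 : Csigma sigma != 0 by rewrite gt_eqF.
have pi0 : pi != 0 :> R by rewrite gt_eqF ?pi_gt0.
have n0 : (0 < n)%N := leq_ltn_trans (leq0n m) mn.
set F := fracint_left s (derive1n m u).
set P := (bv_decomp F).1; set N := (bv_decomp F).2.
pose h := fracheb n sigma.
have limE : lim ((rc_repr F x * rG sigma (n%:R - sigma) x * omega sigma x) @[x --> (-1)^'+]) =
    (P (-1) - N (-1)) * ((Csigma sigma)^-1 * (2 / pi * h (-1))).
  apply: (cvg_lim (@Rhausdorff R)).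
  have c : (P x - N x) * ((Csigma sigma)^-1 * (2 / pi * h x)) @[x --> (-1 : R)^'+] -->
      (P (-1) - N (-1)) * ((Csigma sigma)^-1 * (2 / pi * h (-1))).
    apply: cvgM.
      by apply: cvgB; exact: cumulative_is_right_continuous.
    by do 2 apply: cvgMr; exact: cvg_fracheb_N1.
  apply: cvg_trans c; apply: near_eq_cvg; near=> x.
  have xO : Omega x.
    apply/OmegaE; apply/andP; split; first by near: x; exact: nbhs_right_gt.
    by near: x; apply: nbhs_right_lt; lra.
  by rewrite (fracheb_rG n0 s12 xO) mulKf// /rc_repr mulrA.
have St (Q : cumulative R R) :
    \int[lebesgue_stieltjes_measure Q]_(x in @Omega R) (rG sigma (n%:R - sigma) x * omega sigma x) =
    (Csigma sigma)^-1 * (2 / pi * \int[lebesgue_stieltjes_measure Q]_(x in @Omega R) h x).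
  by rewrite (Stieltjes_fracheb mn s12 Q (k := idfun))// mulKf.
rewrite limE /int_RLderiv_left /stieltjes !St /cheb_coef.
have := integral_chebw_left hs0 hs1 mn s12 uW; rewrite -/F -/P -/N => E.
rewrite [X in 2 / pi * X](_ : _ = \int[lebesgue_measure]_(x in @Omega R) (u x * chebw n x))//.
rewrite E -/h; move: (\int[_]_(x in _) _) (\int[_]_(x in _) _) => i1 i2.
by move: (pi) (Csigma sigma) pi0 Cn0 => p C p0 Cn0; field; rewrite p0.
Unshelve. all: by end_near. Qed.
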